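(* For completely reducible trigonal curves $C$ of maximal degree $3$, there are exactly $8$ different combinatorial types of dessins d'enfants $\Gamma_C$.
   Context: A completely reducible trigonal curve (CRTC) $C$ is a curve given by $(y-y_1)(y-y_2)(y-y_3)=0$ with $y_1,y_2,y_3\in\mathbb{C}[x]$; its maximal degree is $\max\{\deg y_1,\deg y_2,\deg y_3\}=n\ge 1$. All curves are assumed to have no triple intersections: there is no $x_0\in\mathbb{C}$ with $y_1(x_0)=y_2(x_0)=y_3(x_0)$, and (the same condition over $x=\infty$) the coefficients of $x^n$ in $y_1,y_2,y_3$ are not all equal. Put $\lambda=\frac{y_1-y_3}{y_2-y_3}:P^1\to P^1$ and $j_C=\frac{4(\lambda^2-\lambda+1)^3}{27\lambda^2(\lambda-1)^2}:P^1\to P^1$ (the $j$-invariant of $C$), where $P^1=\mathbb{C}\cup\{\infty\}$. The dessin d'enfant of $C$ is the embedded graph $\Gamma_C=j_C^{-1}([0,1])\subset P^1$; its $\bullet$-vertices are the points of $j_C^{-1}(0)$ and its $\circ$-vertices are the points of $j_C^{-1}(1)$. Ramification points of $j_C$ with image in $(0,1)$ are called monochrome vertices; they are not regarded as subdividing edges. The regions of $\Gamma_C$ are the connected components of $P^1\setminus\Gamma_C$. A region is an $m$-gon, where $m$ is its number of boundary edges, counted with $\circ$-vertices disregarded as subdivision points (so $m$ is half the number of passages between a $\bullet$-vertex and a $\circ$-vertex made when traversing the whole boundary of the region once). The combinatorial type of $\Gamma_C$ is the list of these numbers $m$ over all regions, written in non-increasing order. *)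

(* Defs.v *)
From HB Require Import structures.
From mathcomp Require Import all_boot all_order all_algebra.
From mathcomp Require Import all_classical all_reals all_analysis.
From mathcomp Require Import complex finmap.

Set Implicit Arguments.
Unset Strict Implicit.
Unset Printing Implicit Defensive.

Import Order.TTheory GRing.Theory Num.Theory.
Import numFieldNormedType.Exports.

Local Open Scope classical_set_scope.
Local Open Scope ring_scope.

(** MathComp-Analysis.  [R : realType] is the field of real numbers and [R[i]]
    the field of complex numbers, topologized as a [numFieldType] by its
    modulus; [P1 R] is the Riemann sphere, with [None] the point at infinity. *)

Definition P1 (R : realType) : topologicalType :=
  one_point_compactification (R[i] : numFieldType).

Definition fin {R : realType} (z : R[i]) : P1 R := Some z.

Definition infty {R : realType} : P1 R := None.

Definition frac_pt (R : realType) (a b : R[i]) : P1 R :=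
  if b == 0 then infty else fin (a / b).

(** The self-map [p / q] of the sphere, for [p] and [q] with no common root:
    homogenize both to degree [d = max (deg p) (deg q)] and evaluate; the value
    at infinity is the quotient of the coefficients of ['X^d].  (If [p] and [q]
    did have a common root, the value there would be wrong.) *)
Definition ratmap (R : realType) (p q : {poly R[i]}) (x : P1 R) : P1 R :=
  let d := (maxn (size p) (size q)).-1 in
  if x is Some z then frac_pt p.[z] q.[z] else frac_pt p`_d q`_d.

(** Completely reducible trigonal curves [(y - y1) (y - y2) (y - y3) = 0] of
    maximal degree [n], without triple intersections over any point of the
    sphere.  [(size p).-1] is the degree of [p] (and [0] for [p = 0]). *)
Record crtc (R : realType) (n : nat) := Crtc {
  y1 : {poly R[i]};
  y2 : {poly R[i]};
  y3 : {poly R[i]};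
  crtc_deg_gt0 : (0 < n)%N;
  crtc_maxdeg :
    maxn (size y1).-1 (maxn (size y2).-1 (size y3).-1) = n;
  crtc_no_triple : ~ exists x : R[i], y1.[x] = y2.[x] /\ y2.[x] = y3.[x];
  crtc_no_triple_infty : ~ (y1`_n = y2`_n /\ y2`_n = y3`_n) }.

(** The condition on triple intersections makes [y1 - y3] and [y2 - y3]
    coprime, of maximal degree exactly [n]. *)
Definition lambda (R : realType) (n : nat) (C : crtc R n) : P1 R -> P1 R :=
  ratmap (y1 C - y3 C) (y2 C - y3 C).

Definition j_of_lambda (R : realType) : P1 R -> P1 R :=
  ratmap (4%:R *: ('X^2 - 'X + 1) ^+ 3) (27%:R *: ('X^2 * ('X - 1) ^+ 2)).

Definition j_invariant (R : realType) (n : nat) (C : crtc R n) : P1 R -> P1 R :=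
  @j_of_lambda R \o lambda C.

Definition dessin (R : realType) (n : nat) (C : crtc R n) : set (P1 R) :=
  j_invariant C @^-1` [set fin t%:C%C | t in `[0 : R, 1]].

Definition regions (R : realType) (n : nat) (C : crtc R n) : set (set (P1 R)) :=
  [set connected_component (~` dessin C) x | x in ~` dessin C].

(** Passages along the boundary of a region [U].

    Traversing the boundary of [U] with [U] on the left, one meets [•]- and
    [◦]-vertices alternately, and between two of them [j] runs monotonically
    through the interval [[0, 1]], also when monochrome vertices are passed.
    Since [j] preserves orientation, the points of [U] immediately to the left
    have [Im j > 0] on a passage from [•] to [◦], and [Im j < 0] on a passage
    from [◦] to [•].

    [boundary_passage C U s E] states that [E] is the track of such a passage,
    of the first kind if [s = false] and of the second if [s = true].  The
    track [t |-> F (t, 0)], parametrized by the value of [j], comes with a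
    one-sided collar [F] inside [U].  The collar is what selects the right
    continuation of the traversal at a monochrome vertex, where several edges
    cross: it forces consecutive half-edges to bound the same sector.  An edge
    having [U] on both sides yields two passages, one for each [s]. *)
Definition boundary_passage (R : realType) (n : nat) (C : crtc R n)
    (U : set (P1 R)) (s : bool) (E : set (P1 R)) : Prop :=
  exists (d : R) (F : R * R -> P1 R),
    let Q := `[0, 1]%classic `*` `[0, d]%classic in
    [/\ 0 < d,
        {within Q, continuous F},
        forall t h : R, Q (t, h) ->
          j_invariant C (F (t, h)) = fin (t +i* ((-1) ^+ s * h))%C,
        forall t h : R, Q (t, h) -> 0 < h -> U (F (t, h)) &
        E = [set F (t, 0) | t in `[0 : R, 1]]].

Definition gon (R : realType) (n : nat) (C : crtc R n) (U : set (P1 R)) : nat :=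
  #|` fset_set [set e : bool * set (P1 R) | boundary_passage C U e.1 e.2] |./2.

Definition combinatorial_type (R : realType) (n : nat) (C : crtc R n) : seq nat :=
  sort geq [seq gon C U | U <- fset_set (regions C)].

(* Main.v *)
Require Import Defs.
From mathcomp Require Import all_boot all_order all_algebra.
From mathcomp Require Import all_classical all_reals all_analysis.
From mathcomp Require Import complex finmap.
From mathcomp Require Import ring lra zify.

(** A curve enters only through [lambda = p / q], an arbitrary rational map of
    degree 3.  Let [omega] be a primitive cube root of unity,
    [P = p + omega q] and [Q = p + omega^2 q].  In terms of [f = P / Q] the
    j-invariant is [-4 u / (1 - u)^2] with [u = f^3] ([j_of_lambdaE]), and it
    lies in [[0, 1]] exactly where [u] is infinite or a nonpositive real
    ([jval_graph]).  Hence the complement of the dessin is the preimage under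
    [f] of the three open sectors, bisected by the cube roots of unity, that the
    three rays [f^3 <= 0] cut out of the plane.  After a Moebius change of
    coordinate ([normalize], [type_of_homeo]) infinity is a pole of [f], and all
    regions lie in the plane.

    Sectors are convex.  Roots of [P - v Q] depend continuously on [v]
    ([roots_near]), so a region [V] over a sector contains a number of roots
    that does not depend on [v], its degree [m] ([sheets_const]).  The function
    [-4 v^3 / (1 - v^3)^2] is two-to-one on a sector, so near the real axis on
    either side there are [2 m] points of [V] with a given value of [j].  Each
    spreads to a section of [j] over a thin strip along [[0, 1]]
    ([strip_section]), which extends continuously to the boundary
    ([section_limit]) and is one passage; distinct sections have distinct
    tracks, and there is no other passage ([edge_inj], [passage_edge]).
    So [V] is a [2 m]-gon ([gon_sheets]).

    The degrees over one sector add up to 3, so they are determined by the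
    number [n_k] of regions over sector [k]: the type is the union of
    [(6)], [(4, 2)] or [(2, 2, 2)] for [n_k = 1, 2, 3] ([type_of_jmap]).
    Ramification points of [f] are the roots of the wronskian of [P] and [Q],
    at most 4 with multiplicity.  If [r] of them lie over sector [k], then
    [n_k >= 3 - r] ([ncomp_nram]): without ramification [f] has three sections
    over the sector, and with one simple ramification point the third root over
    its value still extends to a section ([component_alone]).  Therefore
    [n_0 + n_1 + n_2 >= 9 - 4 = 5], which leaves eight unordered triples of
    numbers between 1 and 3, and these have distinct types.  All of them occur:
    a ramification point over a sector forces [n_k <= 2] there, a triple point
    forces [n_k = 1], and the values of [f] at the four ramification points can
    be chosen freely enough ([triple_curve], [type113], [type222]). *)

Set Implicit Arguments.
Unset Strict Implicit.
Unset Printing Implicit Defensive.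

Import Order.TTheory GRing.Theory Num.Theory.
Import numFieldNormedType.Exports.
Import ComplexField.Normc.

Local Open Scope classical_set_scope.
Local Open Scope ring_scope.

(** * Complex numbers with a real-valued modulus *)

Section Normc.
Variable R : realType.
Notation C := (R[i] : numFieldType).
Implicit Types x y z : R[i].

Lemma normrE z : `|z| = (normc z)%:C%C.
Proof. by []. Qed.

Lemma normc_ge0 z : 0 <= normc z.
Proof. by case: z => a b; exact: sqrtr_ge0. Qed.

Lemma normcN z : normc (- z) = normc z.
Proof. by case: z => a b; rewrite /= !sqrrN. Qed.

Lemma normcBC x y : normc (x - y) = normc (y - x).
Proof. by rewrite -normcN opprB. Qed.

Lemma normc0P z : (normc z == 0) = (z == 0).
Proof. by apply/eqP/eqP => [/eq0_normc//|->]; exact: normc0. Qed.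

Lemma normc_gt0 z : (0 < normc z) = (z != 0).
Proof. by rewrite lt_def normc_ge0 andbT normc0P. Qed.

Lemma ler_normcD x y : normc (x + y) <= normc x + normc y.
Proof. by have := ler_normD x y; rewrite !normrE -rmorphD lecR. Qed.

Lemma ler_normcB x y z : normc (x - z) <= normc (x - y) + normc (y - z).
Proof. by rewrite (_ : x - z = (x - y) + (y - z)) ?ler_normcD ?addrA ?subrK. Qed.

Lemma normcX z n : normc (z ^+ n) = normc z ^+ n.
Proof. by elim: n => [|n IH]; rewrite ?expr0 ?normc1 // !exprS normcM IH. Qed.

Lemma normc_prod (I : Type) (r : seq I) (F : I -> R[i]) :
  normc (\prod_(i <- r) F i) = \prod_(i <- r) normc (F i).
Proof. by elim/big_ind2: _ => [|? ? ? ? <- <-|]; rewrite ?normc1 ?normcM. Qed.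

Lemma ler_normc_sum (I : Type) (r : seq I) (F : I -> R[i]) :
  normc (\sum_(i <- r) F i) <= \sum_(i <- r) normc (F i).
Proof.
elim: r => [|i r IH]; first by rewrite !big_nil normc0 lexx.
by rewrite !big_cons (le_trans (ler_normcD _ _)) // lerD2l.
Qed.

Lemma Re_le_normc z : `|complex.Re z| <= normc z.
Proof. by case: z => a b /=; rewrite -sqrtr_sqr ler_wsqrtr // lerDl sqr_ge0. Qed.

Lemma Im_le_normc z : `|complex.Im z| <= normc z.
Proof. by case: z => a b /=; rewrite -sqrtr_sqr ler_wsqrtr // lerDr sqr_ge0. Qed.

Lemma normc_le_ReIm z : normc z <= `|complex.Re z| + `|complex.Im z|.
Proof.
case: z => a b; rewrite (_ : (a +i* b)%C = (a +i* 0)%C + (0 +i* b)%C); last first.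
  by simpc.
rewrite (le_trans (ler_normcD _ _)) //.
by rewrite /= !expr0n /= !addr0 !add0r !sqrtr_sqr.
Qed.

Lemma normcR (a : R) : normc a%:C%C = `|a|.
Proof. by rewrite /= expr0n /= addr0 sqrtr_sqr. Qed.

Lemma nbhs_normcP (x : C) (A : set C) : nbhs x A <->
  exists2 e : R, 0 < e & forall y : R[i], normc (x - y) < e -> A y.
Proof.
split.
  move/nbhs_ballP => [[e e'] /=]; rewrite ltcE /= => /andP[/eqP -> e0] h.
  exists e => // y xy; apply: h; rewrite /ball /= normrE.
  by rewrite ltcR.
move=> [e e0 h]; apply/nbhs_ballP; exists e%:C%C; first by rewrite /= ltcR.
by move=> y; rewrite /ball /= normrE ltcR; exact: h.
Qed.

Lemma near_normc (x : C) (e : R) : 0 < e -> \forall y \near x, normc (x - y) < e.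
Proof. by move=> e0; apply/nbhs_normcP; exists e. Qed.

Lemma cvg_normcP (T : Type) (F : set_system T) {FF : Filter F} (f : T -> C) (l : C) :
  f @ F --> l <-> forall e : R, 0 < e -> \forall t \near F, normc (l - f t) < e.
Proof.
split=> [h e e0|h]; first by exact: (h _ (near_normc l e0)).
move=> A /nbhs_normcP[e e0 eA]; apply: filterS (h e e0) => t; exact: eA.
Qed.

Lemma open_normcP (A : set C) : open A <->
  forall x, A x -> exists2 e : R, 0 < e & forall y : R[i], normc (x - y) < e -> A y.
Proof.
rewrite openE; split=> h x Ax; first by move/nbhs_normcP: (h x Ax).
by apply/nbhs_normcP; exact: h.
Qed.

Lemma continuous_ReIm (T : topologicalType) (f g : T -> R) (t : T) :
  {for t, continuous f} -> {for t, continuous g} ->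
  {for t, continuous (fun t => (f t +i* g t)%C : C)}.
Proof.
move=> cf cg; apply/cvg_normcP => e e0.
have e2 : 0 < e / 2 by lra.
have /cvgrPdist_lt/(_ _ e2) nf := cf.
have /cvgrPdist_lt/(_ _ e2) ng := cg.
near=> s; rewrite (le_lt_trans (normc_le_ReIm _))//= (splitr e) ltrD//.
- by near: s.
- by near: s.
Unshelve. all: by end_near. Qed.

Lemma continuous_normc : continuous (@normc R : C -> R).
Proof.
move=> x; apply/(@cvgrPdist_lt _ _ _ _ (@nbhs_filter C x)) => e e0; apply/nbhs_normcP; exists e => // y.
apply: le_lt_trans; rewrite ler_norml; apply/andP; split.
  have := ler_normcD x (y - x); rewrite addrC subrK normcBC; lra.
have := ler_normcD y (x - y); rewrite addrC subrK; lra.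
Qed.

(** A disc sits in a square, and a square is the image of a product of two
    compact intervals. *)
Lemma compact_disc (M : R) : compact [set z : C | normc z <= M].
Proof.
have cS : compact ((fun p : R * R => (p.1 +i* p.2)%C : C) @`
    (`[-M, M]%classic `*` `[-M, M]%classic)).
  apply: continuous_compact; last first.
    by apply: compact_setX; exact: segment_compact.
  apply: continuous_subspaceT => p.
  by apply: continuous_ReIm; [exact: cvg_fst|exact: cvg_snd].
apply: (subclosed_compact _ cS).
  rewrite (_ : [set _ | _] = @normc R @^-1` [set x | x <= M]) //.
  by apply: closed_comp => [? _|]; [exact: continuous_normc|exact: closed_le].
move=> z /= zM; exists (complex.Re z, complex.Im z); last by case: z {zM}.
have := Re_le_normc z; have := Im_le_normc z; rewrite !ler_norml /= !in_itv /=.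
by move=> /andP[? ?] /andP[? ?]; split; apply/andP; split=> /=; lra.
Qed.

Lemma hausdorffC : hausdorff_space C.
Proof. exact: norm_hausdorff. Qed.

End Normc.

(** * Continuity of roots *)

Section Roots.
Variable R : realType.
Implicit Types (z : R[i]) (p q : {poly R[i]}) (rs : seq R[i]).

Lemma coef_bounded p : exists2 B : R, 0 < B & forall k, normc p`_k <= B.
Proof.
exists (1 + \sum_(i < size p) normc p`_i) => [|k].
  by rewrite ltr_pwDl// sumr_ge0// => i _; exact: normc_ge0.
have [kp|kp] := ltnP k (size p); last first.
  rewrite nth_default // normc0 addr_ge0 // sumr_ge0 // => i _; exact: normc_ge0.
rewrite (bigD1 (Ordinal kp)) //= addrCA lerDl addr_ge0 // sumr_ge0 // => i _.
exact: normc_ge0.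
Qed.

Lemma normc_horner_le p z n (d rho : R) : (size p <= n)%N -> 0 <= d ->
  normc z <= rho -> (forall k, normc p`_k <= d) ->
  normc p.[z] <= d * \sum_(i < n) rho ^+ i.
Proof.
move=> pn d0 zr pd; rewrite (horner_coef_wide _ pn) mulr_sumr.
apply: le_trans (ler_normc_sum _ _) _; apply: ler_sum => i _.
by rewrite normcM normcX ler_pM ?exprn_ge0 ?normc_ge0 // lerXn2r ?nnegrE ?normc_ge0 ?(le_trans (normc_ge0 _) zr).
Qed.

(** Dividing by a linear factor, the coefficients of the quotient are computed
    from the top down, each step costing a factor [1 + rho]. *)
Lemma coef_quotient_le p z m (d rho : R) : (size p <= m)%N -> 0 <= d ->
  normc z <= rho -> (forall k, normc (('X - z%:P) * p)`_k <= d) ->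
  forall k, normc p`_k <= d * (1 + rho) ^+ m.
Proof.
move=> pm d0 zr pd; have r0 : 0 <= rho := le_trans (normc_ge0 _) zr.
have H j k : (m <= k + j)%N -> normc p`_k <= d * (1 + rho) ^+ j.
  elim: j k => [|j IH] k mk.
    by rewrite nth_default ?normc0 ?mulr_ge0 ?exprn_ge0 ?addr_ge0// (leq_trans pm)// -(addn0 k).
  have -> : p`_k = (('X - z%:P) * p)`_k.+1 + z * p`_k.+1.
    by rewrite mulrBl coefB coefXM /= mul_polyC coefZ subrK.
  apply: le_trans (ler_normcD _ _) _; rewrite normcM exprS.
  have h1 := pd k.+1; have h2 : normc p`_k.+1 <= d * (1 + rho) ^+ j.
    by apply: IH; rewrite addSnnS.
  have h3 : normc z * normc p`_k.+1 <= rho * (d * (1 + rho) ^+ j).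
    by rewrite ler_pM ?normc_ge0.
  have h4 : d <= d * (1 + rho) ^+ j by rewrite ler_peMr// exprn_ege1// lerDl.
  lra.
move=> k; have [mk|km] := leqP m k.
  by rewrite nth_default ?normc0 ?mulr_ge0 ?exprn_ge0 ?addr_ge0// (leq_trans pm).
have := H (m - k)%N k; rewrite subnKC ?(ltnW km)// => /(_ (leqnn _)) h.
apply: (le_trans h); rewrite ler_wpM2l// ler_weXn2l// ?lerDl// leq_subr//.
Qed.

Definition from_roots (a : R[i]) rs : {poly R[i]} :=
  a *: \prod_(z <- rs) ('X - z%:P).

Lemma from_roots_cons a r rs :
  from_roots a (r :: rs) = ('X - r%:P) * from_roots a rs.
Proof. by rewrite /from_roots big_cons scalerAr. Qed.

Lemma size_from_roots a rs : (size (from_roots a rs) <= (size rs).+1)%N.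
Proof. by rewrite (leq_trans (size_scale_leq _ _))// size_prod_XsubC. Qed.

Lemma lead_from_roots a rs : (from_roots a rs)`_(size rs) = a.
Proof.
have := monic_prod_XsubC rs xpredT id; rewrite monicE lead_coefE.
by rewrite size_prod_XsubC /= /from_roots coefZ => /eqP->; rewrite mulr1.
Qed.

Lemma from_roots_perm a rs rs' : perm_eq rs rs' ->
  from_roots a rs = from_roots a rs'.
Proof. by move=> pe; rewrite /from_roots (perm_big rs'). Qed.

(** Roots depend continuously on the coefficients, multiplicities included.
    The value of the nearby polynomial at a root [r] of the given one is small,
    and it is a product of distances to its roots, so one of them is close to
    [r]; dividing both polynomials by the corresponding linear factors moves the
    coefficients little, and the degree has dropped. *)
Lemma roots_near (rs : seq R[i]) (a : R[i]) (e : R) : a != 0 -> 0 < e ->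
  exists2 d : R, 0 < d & forall a' rs', size rs' = size rs ->
    (forall k, normc ((from_roots a rs)`_k - (from_roots a' rs')`_k) < d) ->
    exists2 ss, perm_eq ss rs' &
      forall i, (i < size rs)%N -> normc (rs`_i - ss`_i) < e.
Proof.
move=> a0 e0; elim: rs => [|r rs [d1 d10 IH]].
  by exists 1 => // a' rs' /size0nil -> _; exists [::].
pose q := from_roots a rs; pose n := size rs.
have [B B0 qB] := coef_bounded q.
pose rho := normc r + 1; have r1 : 1 <= rho by rewrite lerDr normc_ge0.
have r0 : 0 < rho by exact: lt_le_trans r1.
pose K := (1 + rho) ^+ n.+1; have K0 : 0 < K by rewrite exprn_gt0// addr_gt0.
have na : 0 < normc a by rewrite normc_gt0.
pose e1 := Num.min e (Num.min 1 (d1 / (4 * B * K))).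
have e10 : 0 < e1 by rewrite !lt_min e0 ltr01 divr_gt0 ?mulr_gt0.
pose S := \sum_(i < n.+2) rho ^+ i.
have S0 : 0 < S.
  by rewrite /S big_ord_recl expr0 ltr_pwDl// sumr_ge0// => i _; rewrite exprn_ge0 ?ltW.
pose d := Num.min (normc a / 2) (Num.min (normc a / 4 * e1 ^+ n.+1 / S) (d1 / (4 * K))).
have d0 : 0 < d.
  have ek : 0 < e1 ^+ n.+1 by rewrite exprn_gt0.
  have a4 : 0 < normc a / 4 by rewrite divr_gt0.
  have k4 : 0 < 4 * K by rewrite mulr_gt0.
  rewrite !lt_min (divr_gt0 na) //= (divr_gt0 d10 k4) andbT divr_gt0 //.
  by rewrite mulr_gt0.
have da : d <= normc a / 2 by rewrite ge_min lexx.
have dS : d * S <= normc a / 4 * e1 ^+ n.+1.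
  by rewrite -ler_pdivlMr// !ge_min lexx orbT.
have dK : d * K <= d1 / 4.
  by rewrite -ler_pdivlMr// -mulrA -invfM !ge_min lexx !orbT.
have eBK : e1 * B * K <= d1 / 4.
  rewrite -mulrA -ler_pdivlMr ?mulr_gt0// -[X in _ <= X]mulrA -invfM [in X in _ <= X]mulrA.
  by rewrite !ge_min lexx !orbT.
have e1e : e1 <= e by rewrite ge_min lexx.
have e11 : e1 <= 1 by rewrite !ge_min lexx orbT.
exists d => // a' rs' szr' close.
have aa' : normc a / 2 <= normc a'.
  have := close n.+1; rewrite (lead_from_roots a (r :: rs)) -[n.+1]szr' lead_from_roots => h.
  have := ler_normcB a a' 0; rewrite !subr0; lra.
have [r' r'rs' rr'] : exists2 r', r' \in rs' & normc (r - r') < e1.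
  apply: contrapT => far.
  have h : forall r', r' \in rs' -> e1 <= normc (r - r').
    by move=> r' r'rs'; rewrite leNgt; apply/negP => ?; apply: far; exists r'.
  have h1 : normc (from_roots a' rs').[r] <= d * S.
    have -> : (from_roots a' rs').[r] = (from_roots a' rs' - from_roots a (r :: rs)).[r].
      by rewrite hornerD hornerN from_roots_cons hornerM hornerXsubC subrr mul0r subr0.
    apply: normc_horner_le; [|exact: ltW| by rewrite lerDl|] => [|k].
      rewrite (leq_trans (size_polyD _ _))// size_polyN geq_max.
      by rewrite !(leq_trans (size_from_roots _ _)) //= ?szr'.
    by rewrite coefB normcBC ltW.
  have h2 : normc a / 2 * e1 ^+ n.+1 <= normc (from_roots a' rs').[r].
    rewrite /from_roots hornerZ normcM ler_pM ?exprn_ge0 ?divr_ge0 ?normc_ge0 ?(ltW e10)//.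
    rewrite horner_prod normc_prod -[n.+1]szr'.
    elim: (rs') h => [|x s IHs] h; first by rewrite big_nil expr0.
    rewrite big_cons /= exprS ler_pM ?exprn_ge0 ?(ltW e10)//.
      by rewrite !hornerE h// mem_head.
    by apply: IHs => y ys; apply: h; rewrite in_cons ys orbT.
  have : 0 < normc a / 4 * e1 ^+ n.+1 by rewrite mulr_gt0 ?exprn_gt0 ?divr_gt0.
  have : normc a / 2 * e1 ^+ n.+1 = 2 * (normc a / 4 * e1 ^+ n.+1) by field.
  lra.
have pe := perm_to_rem r'rs'; pose ss' := rem r' rs'.
have szs' : size ss' = n by rewrite size_rem// szr'.
have closeq k : normc (q`_k - (from_roots a' ss')`_k) < d1.
  rewrite -coefB; apply: (@le_lt_trans _ _ ((d + e1 * B) * (1 + rho) ^+ n.+1)); last first.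
    rewrite mulrDl -/K; lra.
  apply: (@coef_quotient_le _ r').
  - rewrite (leq_trans (size_polyD _ _))// size_polyN geq_max.
    by rewrite !(leq_trans (size_from_roots _ _)) ?szs'.
  - by rewrite addr_ge0 ?mulr_ge0 ?ltW.
  - have := ler_normcB r' r 0; rewrite !subr0 normcBC /rho; lra.
  move=> l; have -> : ('X - r'%:P) * (q - from_roots a' ss') =
      (from_roots a (r :: rs) - from_roots a' rs') + (r - r') *: q.
    rewrite (from_roots_perm _ pe) !from_roots_cons -/q -mul_polyC polyCB; ring.
  rewrite coefD coefB (coefZ (r - r') q); apply: le_trans (ler_normcD _ _) _; rewrite normcM.
  apply: lerD; first exact: ltW (close l).
  by apply: ler_pM; rewrite ?normc_ge0 ?qB ?(ltW rr').
have [ss pss ssP] := IH a' ss' szs' closeq.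
exists (r' :: ss) => [|[|i] /= ilt].
- by rewrite (perm_trans _ (_ : perm_eq (r' :: ss') rs')) ?perm_cons// perm_sym.
- exact: lt_le_trans e1e.
- exact: ssP.
Qed.

End Roots.

(** * Pencils of polynomials and their fibres *)

(** A property that propagates, in both directions, to nearby points of a
    connected set propagates to the whole set. *)
Lemma connected_invariant (T : topologicalType) (A : set T) (P : T -> Prop) :
  connected A -> (forall x, A x -> \forall y \near x, A y -> (P y <-> P x)) ->
  forall x y, A x -> A y -> P x -> P y.
Proof.
move=> cA loc x y Ax Ay Px; suff AP : A `&` P = A by have [] : (A `&` P) y by rewrite AP.
have op Q : open [set z | \forall y \near z, A y -> Q y].
  exact: (@open_interior _ [set y | A y -> Q y]).
apply: cA; first by exists x.
- exists [set z | \forall y \near z, A y -> P y] => //.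
  apply/seteqP; split=> z [Az]; last by move=> /nbhs_singleton/(_ Az).
  by move=> Pz; split=> //; apply: filterS (loc z Az) => t + At => /(_ At) ->.
- exists (~` [set z | \forall y \near z, A y -> ~ P y]); first exact: open_closedC.
  apply/seteqP; split=> z [Az] h; split=> //; first by move/nbhs_singleton/(_ Az).
  apply: contrapT => nPz; apply: h.
  by apply: filterS (loc z Az) => t + At => /(_ At) ->.
Qed.

Lemma segment_invariant (R : realType) (P : R -> Prop) :
  (forall t, 0 <= t <= 1 -> exists2 d : R, 0 < d &
     forall u, 0 <= u <= 1 -> `|t - u| < d -> (P u <-> P t)) ->
  P 0 -> P 1.
Proof.
move=> loc; apply: (connected_invariant (@segment_connected R 0 1)) => [t||].
- rewrite /= in_itv /= => /loc[d d0 h].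
  by apply/nbhs_ballP; exists d => // u tu; rewrite in_itv /= => u01; exact: h.
- by rewrite /= in_itv /= lexx ler01.
- by rewrite /= in_itv /= lexx ler01.
Qed.

Section Uniform.
Variable R : realType.
Notation C := (R[i] : numFieldType).

(** A positive threshold that can be chosen locally can be chosen uniformly on a
    compact set. *)
Lemma compact_uniform (K : set C) (P : R -> R[i] -> Prop) : compact K ->
  (forall e e' w, 0 < e' <= e -> P e w -> P e' w) ->
  (forall w0, K w0 -> exists2 e : R, 0 < e &
     forall w, K w -> normc (w0 - w) < e -> P e w) ->
  exists2 e : R, 0 < e & forall w, K w -> P e w.
Proof.
move=> /compact_near_coveringP cK mono loc.
have := cK R (0^'+) (fun e w => K w -> P e w) _; case.
  move=> w0 /loc[e e0 h]; near=> w e' => /= Kw; apply: (mono e).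
    apply/andP; split; first by near: e'; exact: nbhs_right_gt.
    by near: e'; apply: nbhs_right_le.
  by apply: h => //; near: w; exact: near_normc.
move=> e /= e0 h; exists (e / 2) => [|w Kw]; first by rewrite divr_gt0.
apply: (h (e / 2)) => //=; last by rewrite divr_gt0.
by rewrite sub0r normrN gtr0_norm ?divr_gt0// ltr_pdivrMr// ltr_pMr// ltr1n.
Unshelve. all: by end_near. Qed.

Lemma min_dist (z : R[i]) (s : seq R[i]) :
  exists2 m : R, 0 < m & forall y, y \in s -> y != z -> m <= normc (z - y).
Proof.
elim: s => [|x s [m m0 IH]]; first by exists 1.
have [->|xz] := eqVneq x z.
  by exists m => // y; rewrite in_cons => /predU1P[->|]; rewrite ?eqxx//; exact: IH.
exists (Num.min m (normc (z - x))) => [|y].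
  by rewrite lt_min m0 normc_gt0 subr_eq0 eq_sym.
rewrite in_cons ge_min => /predU1P[->|ys] yz; first by rewrite lexx orbT.
by rewrite IH.
Qed.

Lemma min_dist2 (s s' : seq R[i]) : exists2 m : R, 0 < m &
  forall x y, x \in s -> y \in s' -> y != x -> m <= normc (x - y).
Proof.
elim: s => [|x s [m m0 IH]]; first by exists 1.
have [m' m'0 h] := min_dist x s'.
exists (Num.min m m') => [|z y]; first by rewrite lt_min m0.
rewrite in_cons ge_min => /predU1P[->|zs] ys yz; first by rewrite (h y) ?orbT.
by rewrite IH.
Qed.

End Uniform.

Section Pencil.
Variable R : realType.
Notation C := (R[i] : numFieldType).
Variables (A B : {poly R[i]}) (n : nat).
Hypothesis sA : (size A <= n.+1)%N.
Hypothesis sB : (size B <= n.+1)%N.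
Implicit Types (w z c : R[i]).

(** The roots of [A - w B] are the finite preimages of [w] under [A / B].  They
    number [n], with multiplicity, unless infinity is a preimage too. *)
Definition pencil w : {poly R[i]} := A - w *: B.
Definition full_degree w := (pencil w)`_n != 0.
Definition fiber w : seq R[i] := sval (closed_field_poly_normal (pencil w)).

Lemma coef_pencil w k : (pencil w)`_k = A`_k - w * B`_k.
Proof. by rewrite coefB coefZ. Qed.

Lemma size_pencil_le w : (size (pencil w) <= n.+1)%N.
Proof.
rewrite (leq_trans (size_polyD _ _))// size_polyN geq_max sA.
by rewrite (leq_trans (size_scale_leq _ _)).
Qed.

Lemma size_pencil w : full_degree w -> size (pencil w) = n.+1.
Proof.
move=> fw; apply/eqP; rewrite eqn_leq size_pencil_le ltnNge.
by apply: contra fw => h; rewrite nth_default.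
Qed.

Lemma pencilE w : pencil w = from_roots (lead_coef (pencil w)) (fiber w).
Proof. exact: (svalP (closed_field_poly_normal (pencil w))). Qed.

Lemma lead_pencil w : full_degree w -> lead_coef (pencil w) = (pencil w)`_n.
Proof. by move=> fw; rewrite lead_coefE size_pencil. Qed.

Lemma lead_pencil_neq0 w : full_degree w -> lead_coef (pencil w) != 0.
Proof. by move=> fw; rewrite lead_pencil. Qed.

Lemma size_fiber w : full_degree w -> size (fiber w) = n.
Proof.
move=> fw; have := size_pencil fw; rewrite {1}pencilE size_scale ?lead_pencil_neq0//.
by rewrite size_prod_XsubC => -[].
Qed.

Lemma mem_fiber w z : full_degree w -> (z \in fiber w) = (A.[z] == w * B.[z]).
Proof.
move=> fw; have -> : (A.[z] == w * B.[z]) = root (pencil w) z.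
  by rewrite rootE /pencil !hornerE subr_eq0.
by rewrite pencilE rootZ ?lead_pencil_neq0// root_prod_XsubC.
Qed.

Lemma fiber_near w0 rs (e : R) : full_degree w0 -> perm_eq rs (fiber w0) -> 0 < e ->
  exists2 d : R, 0 < d & forall w, normc (w0 - w) < d -> full_degree w /\
    exists2 ss, perm_eq ss (fiber w) &
      forall i, (i < n)%N -> normc (rs`_i - ss`_i) < e.
Proof.
move=> fw0 prs e0.
have [d d0 hd] := roots_near rs (lead_pencil_neq0 fw0) e0.
have [M M0 hM] := coef_bounded B.
pose d' := Num.min d (normc (pencil w0)`_n).
have d'0 : 0 < d' by rewrite lt_min d0 normc_gt0.
exists (d' / M) => [|w ww0]; first by rewrite divr_gt0.
have close k : normc ((pencil w0)`_k - (pencil w)`_k) < d'.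
  rewrite !coef_pencil (_ : _ - _ = (w - w0) * B`_k); last by ring.
  rewrite normcM normcBC; move: ww0; rewrite ltr_pdivlMr//; apply: le_lt_trans.
  by rewrite ler_wpM2l ?normc_ge0.
have fw : full_degree w.
  apply/negP => /eqP h; have := close n; rewrite h subr0 lt_min ltxx andbF//.
split=> //; have [||ss pss ssP] := hd (lead_coef (pencil w)) (fiber w).
- by rewrite (perm_size prs) !size_fiber.
- move=> k; rewrite (from_roots_perm _ prs) -!pencilE.
  by apply: lt_le_trans (close k) _; rewrite ge_min lexx.
exists ss => // i; rewrite -(size_fiber fw0) -(perm_size prs); exact: ssP.
Qed.

(** The radius [m] is chosen before the precision [e]: it keeps the root that
    starts at [z0] apart from the others even where those collide. *)
Lemma fiber_isolated w0 z0 : full_degree w0 -> count_mem z0 (fiber w0) = 1%N ->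
  exists2 m : R, 0 < m & forall e : R, 0 < e <= m ->
  exists2 d : R, 0 < d & forall w, normc (w0 - w) < d ->
    full_degree w /\ exists z, [/\ z \in fiber w, normc (z0 - z) < e &
      forall z', z' \in fiber w -> normc (z0 - z') < m -> z' = z].
Proof.
move=> fw0 cz0.
have z0w : z0 \in fiber w0 by rewrite -has_pred1 has_count cz0.
have pe := perm_to_rem z0w; set rs := rem z0 (fiber w0) in pe.
have z0rs : z0 \notin rs.
  by rewrite -has_pred1 has_count -leqNgt; move/permP/(_ (pred1 z0)): pe; rewrite cz0 /= eqxx add1n => -[<-].
have [m m0 hm] := min_dist z0 rs.
exists (m / 2) => [|e /andP[e0 em]]; first by rewrite divr_gt0.
rewrite perm_sym in pe; have [d d0 hd] := fiber_near fw0 pe e0.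
exists d => // w /hd[fw [[|z ss] pss ssP]]; split=> //.
  have := perm_size pss; rewrite size_fiber// -(size_fiber fw0) -(perm_size pe) //.
have szss : size (z :: ss) = n by rewrite (perm_size pss) size_fiber.
have szrs : size rs = size ss.
  by have := perm_size pe; rewrite size_fiber// -szss => -[].
exists z; split.
- by rewrite -(perm_mem pss) mem_head.
- by apply: (ssP 0%N); rewrite -szss.
move=> z'; rewrite -(perm_mem pss) in_cons => /predU1P[//|/(nthP 0)[i ilt <-]] h.
have := ssP i.+1; rewrite -szss ltnS => /(_ ilt) /= h1.
have irs : rs`_i \in rs by rewrite mem_nth ?szrs.
have := hm _ irs; case: eqP irs => [->|_ _ /(_ isT)]; first by rewrite (negPf z0rs).
have := ler_normcB z0 ss`_i rs`_i; rewrite (normcBC ss`_i) => h2 h3; suff : m < m by rewrite ltxx.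
by lra.
Qed.

Lemma fiber_separated w0 : full_degree w0 -> uniq (fiber w0) ->
  exists2 m : R, 0 < m & forall w, normc (w0 - w) < m ->
    forall z z', z \in fiber w -> z' \in fiber w -> normc (z - z') < m -> z' = z.
Proof.
move=> fw0 uw0; have [m m0 hm] := min_dist2 (fiber w0) (fiber w0).
have m3 : 0 < m / 3 by rewrite divr_gt0.
have [d d0 hd] := fiber_near fw0 (perm_refl _) m3.
exists (Num.min d (m / 3)) => [|w]; first by rewrite lt_min d0.
rewrite lt_min => /andP[/hd[fw [ss pss ssP]] _] z z'.
have szss : size ss = n by rewrite (perm_size pss) size_fiber.
rewrite -!(perm_mem pss) => /(nthP 0)[i ilt <-] /(nthP 0)[j jlt <-].
rewrite lt_min => /andP[_ h].
have {}ilt : (i < n)%N by rewrite -szss. have {}jlt : (j < n)%N by rewrite -szss.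
have hi := ssP i ilt; have hj := ssP j jlt.
have [->//|nij] := eqVneq i j.
have := hm (fiber w0)`_i (fiber w0)`_j; rewrite !mem_nth ?size_fiber// nth_uniq ?size_fiber//.
rewrite eq_sym => /(_ isT isT nij).
have := ler_normcB (fiber w0)`_i ss`_i (fiber w0)`_j.
have := ler_normcB ss`_i ss`_j (fiber w0)`_j.
rewrite (normcBC ss`_j) => h1 h2 h3; suff : m < m by rewrite ltxx.
by lra.
Qed.

Lemma fiber_match w0 (e : R) : full_degree w0 -> 0 < e ->
  exists2 d : R, 0 < d & forall w w', normc (w0 - w) < d -> normc (w0 - w') < d ->
    forall z, z \in fiber w -> exists2 z', z' \in fiber w' & normc (z - z') < e.
Proof.
move=> fw0 e0; have e2 : 0 < e / 2 by rewrite divr_gt0.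
have [d d0 hd] := fiber_near fw0 (perm_refl _) e2.
exists d => // w w' /hd[fw [ss pss ssP]] /hd[fw' [ss' pss' ssP']] z.
rewrite -(perm_mem pss) => /(nthP 0)[i + <-].
rewrite (perm_size pss) size_fiber// => ilt; exists ss'`_i.
  by rewrite -(perm_mem pss') mem_nth// (perm_size pss') size_fiber.
have := ler_normcB ss`_i (fiber w0)`_i ss'`_i; rewrite (normcBC ss`_i (fiber w0)`_i).
have := ssP i ilt; have := ssP' i ilt; lra.
Qed.

End Pencil.

(** * Continuous sections over convex sets *)

Section Sections.
Variable R : realType.
Notation C := (R[i] : numFieldType).
Variables (A B : {poly R[i]}) (n : nat).
Hypothesis sA : (size A <= n.+1)%N.
Hypothesis sB : (size B <= n.+1)%N.
Implicit Types (w z c x : R[i]) (K D : set C).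

Local Notation fib := (fiber A B).
Local Notation full := (full_degree A B n).

Definition cont_on K (g : R[i] -> R[i]) := forall w, K w -> forall e : R, 0 < e ->
  exists2 d : R, 0 < d & forall w', K w' -> normc (w - w') < d ->
    normc (g w - g w') < e.

Definition ray c w (t : R) : R[i] := c + t%:C%C * (w - c).

Definition star c K := forall w (t : R), K w -> 0 <= t <= 1 -> K (ray c w t).

(** Over the centre [c] only [x] has to be simple.  This is what allows sections
    in the presence of one ramification point. *)
Definition simple_over c x K := [/\ forall w, K w -> full w,
  count_mem x (fib c) = 1%N & forall w, K w -> w != c -> uniq (fib w)].

Definition section_on c x K g := [/\ cont_on K g, forall w, K w -> g w \in fib w & g c = x].

Lemma ray0 c w : ray c w 0 = c. Proof. by rewrite /ray mul0r addr0. Qed.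
Lemma ray1 c w : ray c w 1 = w. Proof. by rewrite /ray mul1r addrC subrK. Qed.

Lemma normc_ray c w (t u : R) : normc (ray c w t - ray c w u) = `|t - u| * normc (w - c).
Proof.
rewrite (_ : _ - _ = (t - u)%:C%C * (w - c)) ?normcM ?normcR//.
by rewrite /ray rmorphB; ring.
Qed.

Lemma normc_ray_end c w w' (t : R) : 0 <= t <= 1 ->
  normc (ray c w t - ray c w' t) <= normc (w - w').
Proof.
move=> /andP[t0 t1]; rewrite (_ : _ - _ = t%:C%C * (w - w')); last by rewrite /ray; ring.
by rewrite normcM normcR ger0_norm// ler_piMl// normc_ge0.
Qed.

Lemma normc_ray_c c w (t : R) : 0 <= t -> normc (c - ray c w t) = t * normc (w - c).
Proof. by move=> t0; rewrite -{1}(ray0 c w) normc_ray sub0r normrN ger0_norm. Qed.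

(** Over a compact star-shaped set a simple root over the centre extends to a
    continuous choice of roots: cut every ray from the centre into [N] equal
    steps and follow the root from one step to the next.  One [N] serves all
    rays, since roots move little in a step compared with their distance.  Other
    roots may collide over the centre itself; near it, the followed root
    is told apart by staying close to [x]. *)
Lemma compact_section K c x (M : R) : compact K -> K c -> star c K ->
  (forall w, K w -> normc (w - c) <= M) -> simple_over c x K ->
  exists g, section_on c x K g.
Proof.
move=> cK Kc stK KM [Kfull cx Kuniq].
have [m m0 mP] := fiber_isolated sA sB (Kfull c Kc) cx.
have m4 : 0 < m / 4 by rewrite divr_gt0.
have [|r r0 rP] := mP (m / 4).
  by rewrite m4 ler_pdivrMr// ler_peMr ?ltW// ltr1n.
(* The pairs that the followed root can reach: where multiple roots are near,
   it is the root close to [x]. *)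
pose allowed w z := z \in fib w /\ (normc (c - w) < r -> normc (x - z) < m / 4).
have [s s0 sP] : exists2 s : R, 0 < s & forall w, K w -> forall z z',
    allowed w z -> z' \in fib w -> normc (z - z') < s -> z' = z.
  apply: (@compact_uniform _ _ (fun s w => forall z z',
    allowed w z -> z' \in fib w -> normc (z - z') < s -> z' = z) cK).
    move=> e e' w /andP[_ ee'] h z z' az z'w zz'; apply: h => //.
    exact: lt_le_trans ee'.
  move=> w0 Kw0; have [cw0|cw0] := ltP (normc (c - w0)) r.
    exists (Num.min (m / 2) (r - normc (c - w0))) => [|w Kw].
      by rewrite lt_min divr_gt0// subr_gt0.
    rewrite lt_min => /andP[_ w0w] z z' [zw az] z'w.
    rewrite lt_min => /andP[zz' _].
    have cw : normc (c - w) < r by have := ler_normcB c w0 w; lra.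
    have {}az := az cw; have [_ [z1 [z1w xz1 z1P]]] := rP w cw.
    have -> : z' = z1 by apply: z1P z'w _; have := ler_normcB x z z'; lra.
    by symmetry; apply: z1P zw _; lra.
  have w0c : w0 != c.
    by apply: contraTneq cw0 => ->; rewrite subrr normc0 -ltNge.
  have [e e0 eP] := fiber_separated sA sB (Kfull _ Kw0) (Kuniq _ Kw0 w0c).
  exists e => // w Kw w0w z z' [zw _] z'w; exact: eP zw z'w.
(* Four distances below [d] add up to less than the separation [s]; and a root
   within [d] of one that is within [m / 4] of [x] is still within [m] of [x],
   where there is only one. *)
pose d := Num.min (s / 4) (m / 4).
have d0 : 0 < d by rewrite lt_min m4 divr_gt0.
have dsP : d <= s / 4 by rewrite ge_min lexx.
have dmP : d <= m / 4 by rewrite ge_min lexx orbT.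
have [h h0 hP] : exists2 h : R, 0 < h & forall w, K w -> forall w', K w' ->
    normc (w - w') < h -> forall z, z \in fib w ->
    exists2 z', z' \in fib w' & normc (z - z') < d.
  apply: (@compact_uniform _ _ (fun h w => forall w', K w' ->
    normc (w - w') < h -> forall z, z \in fib w ->
    exists2 z', z' \in fib w' & normc (z - z') < d) cK).
    move=> e e' w /andP[_ ee'] H w' Kw' ww'; apply: H => //.
    exact: lt_le_trans ee'.
  move=> w0 Kw0; have [e e0 eP] := fiber_match sA sB (Kfull _ Kw0) d0.
  exists (e / 2) => [|w Kw w0w w' Kw' ww']; first by rewrite divr_gt0.
  apply: eP; first lra; have := ler_normcB w0 w w'; lra.
have M0 : 0 <= M by apply: le_trans (KM c Kc); exact: normc_ge0.
pose N := (Num.truncn (M / h)).+1.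
have N0 : 0 < N%:R :> R by rewrite ltr0n.
have MN : M / N%:R < h.
  rewrite ltr_pdivrMr// mulrC -ltr_pdivrMr//; exact: truncnS_gt.
(* The [i]-th point of the ray to [w], and the root followed that far. *)
pose p i w := ray c w (i%:R / N%:R).
have iN01 i : (i <= N)%N -> 0 <= (i%:R / N%:R : R) <= 1.
  by move=> iN; rewrite divr_ge0//= ler_pdivrMr// mul1r ler_nat.
have Kp i w : (i <= N)%N -> K w -> K (p i w) by move=> iN Kw; apply: stK => //; exact: iN01.
have pS i w : K w -> normc (p i w - p i.+1 w) < h.
  move=> Kw; rewrite normc_ray -mulrBl -opprB -natrB// subSnn mulN1r normrN.
  rewrite ger0_norm ?invr_ge0 ?ler0n// mulrC; apply: le_lt_trans MN.
  by rewrite ler_wpM2r ?invr_ge0 ?ler0n ?KM.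
pose nxt i w z := xget 0 [set z' | z' \in fib (p i w) /\ normc (z - z') < d].
pose g := fix g i w := if i is j.+1 then nxt i w (g j w) else x.
have gS i w : (i < N)%N -> K w -> allowed (p i w) (g i w) ->
    allowed (p i.+1 w) (g i.+1 w) /\ normc (g i w - g i.+1 w) < d.
  move=> iN Kw [gw gx].
  have [gw' gg'] : [set z' | z' \in fib (p i.+1 w) /\ normc (g i w - z') < d] (g i.+1 w).
    apply: xgetPex; have [z' z'w zz'] := hP _ (Kp _ _ (ltnW iN) Kw) _ (Kp _ _ iN Kw) (pS _ _ Kw) _ gw.
    by exists z'.
  split=> //; split=> // cw'.
  have cw : normc (c - p i w) < r.
    apply: le_lt_trans cw'; rewrite !normc_ray_c ?divr_ge0 ?ler0n//.
    by rewrite ler_wpM2r ?normc_ge0// ler_wpM2r ?invr_ge0 ?ler0n// ler_nat.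
  have {}gx := gx cw; have [_ [z1 [z1w xz1 z1P]]] := rP _ cw'.
  have -> : g i.+1 w = z1; last exact: xz1.
  by apply: z1P gw' _; have := ler_normcB x (g i w) (g i.+1 w); lra.
have p0 w : p 0%N w = c by rewrite /p mul0r ray0.
have pN w : p N w = w by rewrite /p divff ?gt_eqF// ray1.
have xc : x \in fib c by rewrite -has_pred1 has_count cx.
have ga i w : (i <= N)%N -> K w -> allowed (p i w) (g i w).
  elim: i => [|i IH] iN Kw; last by have [] := gS i w iN Kw (IH (ltnW iN) Kw).
  by rewrite p0; split=> //= _; rewrite subrr normc0.
have gc i : (i <= N)%N -> g i c = x.
  elim: i => // i IH iN; have [[gw _]] := gS i c iN Kc (ga i c (ltnW iN) Kc).
  have pc k : p k c = c by rewrite /p /ray subrr mulr0 addr0.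
  rewrite IH ?(ltnW iN)// => xg; apply: (sP c Kc) => //.
  - by split=> // _; rewrite subrr normc0.
  - by rewrite pc in gw.
  - by apply: lt_le_trans xg _; lra.
have gcont i : (i <= N)%N -> cont_on K (g i).
  elim: i => [|i IH] iN w Kw e e0.
    by exists 1 => // w' _ _; rewrite /= subrr normc0.
  have mine : 0 < Num.min e d by rewrite lt_min e0.
  have [d1 d10 d1P] := fiber_match sA sB (Kfull _ (Kp _ _ iN Kw)) mine.
  have [d2 d20 d2P] := IH (ltnW iN) w Kw d d0.
  exists (Num.min d1 d2) => [|w' Kw']; first by rewrite lt_min d10.
  rewrite lt_min => /andP[ww1 /(d2P _ Kw') ggi].
  have [[gw _] ggw] := gS i w iN Kw (ga i w (ltnW iN) Kw).
  have [[gw' gx'] ggw'] := gS i w' iN Kw' (ga i w' (ltnW iN) Kw').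
  have [||y yw' gy] := d1P (p i.+1 w) (p i.+1 w') _ _ _ gw.
  - by rewrite subrr normc0.
  - by apply: le_lt_trans ww1; apply: normc_ray_end; exact: iN01.
  move: gy; rewrite lt_min => /andP[gye gyd].
  rewrite -(sP _ (Kp _ _ iN Kw') (g i.+1 w') y) //.
  have h1 := ler_normcB (g i.+1 w') (g i w') y.
  have h2 := ler_normcB (g i w') (g i w) y.
  have h3 := ler_normcB (g i w) (g i.+1 w) y.
  have h4 := normcBC (g i.+1 w') (g i w').
  have h5 := normcBC (g i w') (g i w).
  lra.
exists (g N); split; [exact: gcont| |exact: gc].
by move=> w Kw; have [] := ga N w (leqnn _) Kw; rewrite pN.
Qed.

(** Two continuous choices of simple roots that agree at the centre agree: along
    a ray they neither meet nor separate. *)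
Lemma section_unique c x K K' g g' : star c K -> star c K' ->
  simple_over c x K -> section_on c x K g -> section_on c x K' g' ->
  forall w, K w -> K' w -> g w = g' w.
Proof.
move=> stK stK' [Kfull cx Kuniq] [gcont gf gc] [g'cont g'f g'c] w Kw K'w.
rewrite -(ray1 c w); apply: (@segment_invariant _ (fun t => g (ray c w t) = g' (ray c w t))).
  move=> t t01; set v := ray c w t.
  have [Kv K'v] : K v /\ K' v by split; [exact: stK|exact: stK'].
  have close e : 0 < e -> exists2 d : R, 0 < d & forall u, 0 <= u <= 1 ->
      `|t - u| < d -> normc (v - ray c w u) < e.
    move=> e0; exists (e / (normc (w - c) + 1)) => [|u u01].
      by rewrite divr_gt0// ltr_wpDl ?normc_ge0.
    rewrite normc_ray ltr_pdivlMr ?ltr_wpDl ?normc_ge0//.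
    by apply: le_lt_trans; rewrite ler_wpM2l// lerDl.
  have [gg'|gg'] := eqVneq (g v) (g' v).
    have cgv : count_mem (g v) (fib v) = 1%N.
      have [vc|vc] := eqVneq v c; first by rewrite vc gc.
      by rewrite count_uniq_mem ?gf ?Kuniq.
    have [m m0 mP] := fiber_isolated sA sB (Kfull _ Kv) cgv.
    have [|d d0 dP] := mP m; first by rewrite m0 lexx.
    have [d1 d10 d1P] := gcont v Kv m m0; have [d2 d20 d2P] := g'cont v K'v m m0.
    have [|d3 d30 d3P] := close (Num.min d (Num.min d1 d2)); first by rewrite !lt_min d0 d10.
    exists d3 => // u u01 tu; split=> // _.
    have := d3P u u01 tu; rewrite !lt_min => /andP[/dP[_ [z [_ _ zP]]] /andP[u1 u2]].
    have Ku : K (ray c w u) by exact: stK.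
    have K'u : K' (ray c w u) by exact: stK'.
    rewrite (zP (g (ray c w u))) ?gf ?d1P//; symmetry; apply: zP; first exact: g'f.
    by rewrite gg' d2P.
  have e0 : 0 < normc (g v - g' v) / 2 by rewrite divr_gt0// normc_gt0 subr_eq0.
  have [d1 d10 d1P] := gcont v Kv _ e0; have [d2 d20 d2P] := g'cont v K'v _ e0.
  have [|d3 d30 d3P] := close (Num.min d1 d2); first by rewrite lt_min d10.
  exists d3 => // u u01 tu; split=> [eu|e]; last by rewrite e eqxx in gg'.
  have := d3P u u01 tu; rewrite lt_min => /andP[/d1P u1 /d2P u2].
  have h1 := u1 (stK w u Kw u01); have := u2 (stK' w u K'w u01); rewrite -eu => h2.
  have := ler_normcB (g v) (g (ray c w u)) (g' v).
  rewrite (normcBC (g (ray c w u))) => h3.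
  suff : normc (g v - g' v) < normc (g v - g' v) by rewrite ltxx.
  by lra.
by rewrite ray0 gc g'c.
Qed.

Definition convexC D := forall v w (t : R), D v -> D w -> 0 <= t <= 1 -> D (ray v w t).

(** Compact sets exhausting an open convex set [D]: what is left of a disc after
    removing a neighbourhood of the complement of [D]. *)
Definition inner D (k : nat) : set C :=
  [set w | normc w <= k%:R /\ forall y : R[i], normc (w - y) < k.+1%:R^-1 -> D y].

Lemma inner_compact D k : compact (inner D k).
Proof.
apply: (subclosed_compact _ (@compact_disc R k%:R)); last by move=> w [].
rewrite -[inner D k]setCK; apply: open_closedC; apply/open_normcP => w nw.
have [wk|kw] := leP (normc w) k%:R; last first.
  exists (normc w - k%:R) => [|y wy [yk _]]; first by rewrite subr_gt0.
  by have := ler_normcB w y 0; rewrite !subr0; lra.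
have [y wy nDy] : exists2 y : R[i], normc (w - y) < k.+1%:R^-1 & ~ D y.
  apply: contrapT => h; apply: nw; split=> // y wy; apply: contrapT => nDy.
  by apply: h; exists y.
move: wy; set q := (k.+1%:R^-1 : R) => wy.
exists (q - normc (w - y)) => [|v wv [_ vD]]; first by rewrite subr_gt0.
by apply: nDy; apply: vD; have := ler_normcB v w y; rewrite (normcBC v w) -/q; lra.
Qed.

Lemma inner_star D c k : convexC D -> inner D k c -> star c (inner D k).
Proof.
move=> cD [ck cDk] w t [wk wDk] /andP[t0 t1]; split=> [|y].
  rewrite (_ : ray c w t = (1 - t)%:C%C * c + t%:C%C * w); last first.
    by rewrite /ray rmorphB rmorph1; ring.
  apply: le_trans (ler_normcD _ _) _; rewrite !normcM !normcR !ger0_norm ?subr_ge0//.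
  have h1 : (1 - t) * normc c <= (1 - t) * k%:R by rewrite ler_wpM2l ?subr_ge0.
  have h2 : t * normc w <= t * k%:R by rewrite ler_wpM2l.
  by lra.
set e := y - ray c w t => h; have -> : y = ray (c + e) (w + e) t.
  by rewrite /e /ray; ring.
have he (v : R[i]) : normc (v - (v + e)) = normc (ray c w t - y).
  by congr normc; rewrite /e; ring.
apply: cD; last by rewrite t0.
  by apply: cDk; rewrite he.
by apply: wDk; rewrite he.
Qed.

Lemma inner_cover D w : open D -> D w -> exists k0, exists2 e : R, 0 < e &
  forall k (y : R[i]), (k0 <= k)%N -> normc (w - y) < e -> inner D k y.
Proof.
move=> /open_normcP oD /oD[e e0 eD]; have e2 : 0 < e / 2 by rewrite divr_gt0.
exists (Num.truncn (normc w + e / 2 + (e / 2)^-1)).+1; exists (e / 2) => // k y k0k wy.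
have hk : normc w + e / 2 + (e / 2)^-1 < k%:R.
  by apply: lt_le_trans (truncnS_gt _) _; rewrite ler_nat.
have i0 : 0 < (e / 2)^-1 by rewrite invr_gt0.
have w0 := normc_ge0 w; split=> [|z yz].
  by have := ler_normcB y w 0; rewrite !subr0 (normcBC y w); lra.
apply: eD; move: yz; set q := (k.+1%:R^-1 : R) => yz; have : q <= e / 2.
  rewrite /q -[e / 2]invrK lef_pV2 ?posrE ?ltr0n// (le_trans (ltW (lt_trans _ hk)))//.
    by lra.
  by rewrite ler_nat.
by have := ler_normcB w y z; lra.
Qed.

Lemma simple_overS c x K K' : K' `<=` K -> simple_over c x K -> simple_over c x K'.
Proof. by move=> KK' [h1 h2 h3]; split=> // w /KK'; [exact: h1|exact: h3]. Qed.

Lemma open_section D c x : open D -> convexC D -> D c -> simple_over c x D ->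
  exists g, section_on c x D g.
Proof.
move=> oD cD Dc sD; have [k0 [e e0 k0P]] := inner_cover oD Dc.
pose K k := inner D (k0 + k); have KD k : K k `<=` D.
  by move=> w [_]; apply; rewrite subrr normc0 invr_gt0 ltr0n.
have Kc k : K k c by apply: k0P; rewrite ?leq_addr// subrr normc0.
have stK k : star c (K k) by apply: inner_star cD (Kc k).
have sK k : simple_over c x (K k) by exact: simple_overS (KD k) sD.
have /choice[gs gsP] : forall k, exists g, section_on c x (K k) g.
  move=> k; apply: (@compact_section _ _ _ ((k0 + k)%:R + (k0 + k)%:R)) => //.
  - exact: inner_compact.
  - move=> w [wk _]; have [ck _] := Kc k; apply: le_trans (ler_normcD _ _) _.
    by rewrite normcN lerD.
pose idx w := xget 0%N [set k | K k w].
have Kidx k w : K k w -> K (idx w) w by move=> kw; apply: (@xgetPex _ 0%N [set k | K k w]); exists k.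
have gE k w : K k w -> gs (idx w) w = gs k w.
  move=> kw; apply: (section_unique (stK (idx w)) (stK k) (sK (idx w))) => //.
  exact: Kidx kw.
exists (fun w => gs (idx w) w); split.
- move=> w Dw r r0; have [k1 [d1 d10 k1P]] := inner_cover oD Dw.
  have Kw (y : R[i]) : normc (w - y) < d1 -> K k1 y by apply: k1P; rewrite leq_addl.
  have Kww : K k1 w by apply: Kw; rewrite subrr normc0.
  have [gcont _ _] := gsP k1; have [d2 d20 d2P] := gcont w Kww r r0.
  exists (Num.min d1 d2) => [|w' Dw']; first by rewrite lt_min d10.
  rewrite lt_min => /andP[/Kw Kw' ww']; rewrite !(gE k1)//; exact: d2P.
- move=> w Dw; have [k1 [d1 d10 k1P]] := inner_cover oD Dw.
  have Kww : K k1 w by apply: k1P; rewrite ?leq_addl// subrr normc0.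
  by rewrite (gE k1)//; have [_ + _] := gsP k1; apply.
- by rewrite (gE 0%N)//; have [_ _] := gsP 0%N.
Qed.

End Sections.

(** * Components and their degrees *)

Section Components.
Variable R : realType.
Notation C := (R[i] : numFieldType).
Implicit Types (X : set C) (z y : R[i]).

Lemma continuous_ray z y : continuous (ray z y : R -> C).
Proof.
move=> t; apply/cvg_normcP => e e0; apply/nbhs_ballP.
exists (e / (normc (y - z) + 1)) => [|u] /=.
  by rewrite /= divr_gt0// ltr_wpDl ?normc_ge0.
rewrite /ball /= normc_ray ltr_pdivlMr ?ltr_wpDl ?normc_ge0//.
by apply: le_lt_trans; rewrite ler_wpM2l// lerDl.
Qed.

Lemma segment_component X z y :
  (forall t : R, 0 <= t <= 1 -> X (ray z y t)) -> connected_component X z y.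
Proof.
move=> h; have cI : connected ((ray z y : R -> C) @` `[0, 1]%classic).
  apply: connected_continuous_connected; first exact: segment_connected.
  by apply: continuous_subspaceT; exact: continuous_ray.
apply: (connected_component_max _ _ cI).
- by exists 0; rewrite /= ?in_itv /= ?lexx ?ler01 ?ray0.
- by move=> _ [t /= + <-]; rewrite in_itv /=; exact: h.
- by exists 1; rewrite /= ?in_itv /= ?lexx ?ler01 ?ray1.
Qed.

Lemma disc_component X z (e : R) : (forall y, normc (z - y) < e -> X y) ->
  forall y, normc (z - y) < e -> connected_component X z y.
Proof.
move=> h y zy; apply: segment_component => t /andP[t0 t1]; apply: h.
rewrite normc_ray_c// normcBC; apply: le_lt_trans zy.
by rewrite ler_piMl// normc_ge0.
Qed.

Lemma component_near X x z (e : R) : (forall y, normc (z - y) < e -> X y) ->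
  forall y, normc (z - y) < e ->
  (connected_component X x y <-> connected_component X x z).
Proof.
move=> /disc_component h y /h zy; split=> h1; last exact: connected_component_trans zy.
exact: connected_component_trans (connected_component_sym zy).
Qed.

Lemma continuous_horner (p : {poly R[i]}) : continuous (horner p : C -> C).
Proof.
elim/poly_ind: p => [|p c IH] z.
  rewrite (_ : (horner 0 : C -> C) = cst 0); first exact: cst_continuous.
  by apply/funext => y; rewrite horner0.
pose f : C -> C := horner p; pose d : C := c.
rewrite (_ : (horner _ : C -> C) = f \* id \+ cst d); last first.
  by apply/funext => y; rewrite hornerMXaddC.
apply: continuousD; last exact: cst_continuous.
by apply: continuousM; [exact: IH|exact: cvg_id].
Qed.

Variables (A B : {poly R[i]}) (n : nat).
Hypothesis sA : (size A <= n.+1)%N.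
Hypothesis sB : (size B <= n.+1)%N.
Hypothesis AB_coprime : forall z, B.[z] = 0 -> A.[z] != 0.
Implicit Types (w c x : R[i]) (D : set C).

Local Notation fib := (fiber A B).
Local Notation full := (full_degree A B n).

Definition quot z : R[i] := A.[z] / B.[z].

Definition quot_preim D : set C := [set z | B.[z] != 0 /\ D (quot z)].

Lemma mem_fiber_quot w z : full w -> (z \in fib w) = (B.[z] != 0) && (quot z == w).
Proof.
move=> fw; rewrite (mem_fiber sA sB)//; have [Bz|Bz] := eqVneq B.[z] 0.
  by rewrite Bz mulr0 (negPf (AB_coprime Bz)).
by rewrite /quot /= -(can2_eq (mulfVK Bz) (mulfK Bz)).
Qed.

Lemma quot_near z (e : R) : B.[z] != 0 -> 0 < e -> exists2 d : R, 0 < d &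
  forall y, normc (z - y) < d -> B.[y] != 0 /\ normc (quot z - quot y) < e.
Proof.
move=> Bz e0.
have cq : {for z, continuous (quot : C -> C)}.
  exact: (cvgM (@continuous_horner A z) (cvgV Bz (@continuous_horner B z))).
have /(cvg_normcP (quot : C -> C))/(_ e e0)/nbhs_normcP[d d0 dP] := cq.
have nB : 0 < normc B.[z] by rewrite normc_gt0.
have /(cvg_normcP (horner B : C -> C))/(_ _ nB)/nbhs_normcP[d' d'0 d'P] := @continuous_horner B z.
exists (Num.min d d') => [|y]; first by rewrite lt_min d0.
rewrite lt_min => /andP[/dP zy /d'P By]; split=> //.
by apply: contraTneq By => ->; rewrite subr0 ltxx.
Qed.

Lemma preim_open D : open D -> open (quot_preim D).
Proof.
move=> /open_normcP oD; apply/open_normcP => z [Bz /oD[e e0 eD]].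
have [d d0 dP] := quot_near Bz e0; exists d => // y /dP[By qy]; split=> //.
exact: eD.
Qed.

Lemma fiber_preim D w z : D w -> full w -> z \in fib w -> quot_preim D z.
Proof. by move=> Dw fw; rewrite mem_fiber_quot// => /andP[Bz /eqP qz]; split; rewrite ?qz. Qed.

Lemma preim_fiber D z : (forall w, D w -> full w) -> quot_preim D z -> z \in fib (quot z).
Proof. by move=> Df [Bz Dz]; rewrite mem_fiber_quot ?Bz//=; exact: Df. Qed.

(** A component on which the map is unramified meets a fibre only once: a section
    through one of its points is onto, as the points [z] with [g (quot z) = z] form
    an open and closed subset. *)
Lemma component_alone D c x z : open D -> convexC D -> D c ->
  simple_over A B n c x D -> connected_component (quot_preim D) x z -> z \in fib c -> z = x.
Proof.
move=> oD cD Dc sD; have [g [gcont gf gc]] := open_section sA sB oD cD Dc sD.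
have [Df cx Du] := sD; have xc : x \in fib c by rewrite -has_pred1 has_count cx.
have fqP w y : full w -> y \in fib w -> quot y = w.
  by move=> fw; rewrite mem_fiber_quot// => /andP[_ /eqP].
move=> xz zc; suff : g (quot z) = z by rewrite (fqP c)// ?gc//; exact: Df.
have cV : connected (connected_component (quot_preim D) x) by exact: component_connected.
pose P (y : C) := g (quot y) = y; rewrite -[_ = _]/(P z).
apply: (@connected_invariant _ _ P cV _ x z _ xz) => [y Vy||]; last 2 first.
- by apply: connected_component_refl; apply: fiber_preim xc; rewrite // Df.
- by rewrite /P (fqP c)//; exact: Df.
rewrite /P.
have [By Dy] := connected_component_sub Vy.
have [gy|gy] := eqVneq (g (quot y)) y.
  have cy : count_mem y (fib (quot y)) = 1%N.
    have [yc|yc] := eqVneq (quot y) c; first by rewrite -{1}gy yc gc.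
    by rewrite count_uniq_mem ?Du// -{1}gy gf.
  have [m m0 mP] := fiber_isolated sA sB (Df _ Dy) cy.
  have [|d d0 dP] := mP m; first by rewrite m0 lexx.
  have [d1 d10 d1P] := gcont _ Dy m m0.
  have [|d2 d20 d2P] := quot_near By (e := Num.min d d1); first by rewrite lt_min d0.
  apply/nbhs_normcP; exists (Num.min m d2) => [|u]; first by rewrite lt_min m0.
  rewrite lt_min => /andP[yu /d2P[Bu]]; rewrite lt_min => /andP[/dP[_ [v [_ _ vP]]] qyu] Vu.
  have [_ Du'] := connected_component_sub Vu; split=> // _.
  rewrite (vP (g (quot u))) ?gf//; last by rewrite -gy; exact: d1P.
  by rewrite (vP u)// (preim_fiber Df).
have e0 : 0 < normc (g (quot y) - y) / 2 by rewrite divr_gt0// normc_gt0 subr_eq0.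
have [d d0 dP] := gcont _ Dy _ e0; have [d1 d10 d1P] := quot_near By d0.
apply/nbhs_normcP; exists (Num.min d1 (normc (g (quot y) - y) / 2)) => [|u].
  by rewrite lt_min d10.
rewrite lt_min => /andP[/d1P[Bu /dP qyu] yu] Vu; split=> [gu|e]; last by rewrite e eqxx in gy.
have [_ Du'] := connected_component_sub Vu; have := qyu Du'; rewrite gu => h.
have := ler_normcB (g (quot y)) u y; rewrite (normcBC u y) => h1.
suff : normc (g (quot y) - y) < normc (g (quot y) - y) by rewrite ltxx.
by lra.
Qed.

Lemma eq_count_nth (T : Type) (x0 : T) (a : pred T) (s s' : seq T) :
  size s = size s' -> (forall i, (i < size s)%N -> a (nth x0 s i) = a (nth x0 s' i)) ->
  count a s = count a s'.
Proof.
elim: s s' => [|x s IH] [|y s'] //= [ss] h; rewrite (h 0%N)//.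
by congr addn; apply: IH => // i ilt; exact: (h i.+1).
Qed.

Lemma preim_margin D (s : seq R[i]) : open D -> (forall z, z \in s -> quot_preim D z) ->
  exists2 e : R, 0 < e & forall z, z \in s -> forall y, normc (z - y) < e -> quot_preim D y.
Proof.
move=> /preim_open/open_normcP oP; elim: s => [|z s IH] h; first by exists 1.
have [|e e0 eP] := IH; first by move=> y ys; apply: h; rewrite in_cons ys orbT.
have [d d0 dP] := oP z (h z (mem_head _ _)).
exists (Num.min e d) => [|y]; first by rewrite lt_min e0.
by rewrite in_cons => /predU1P[->|ys] u; rewrite lt_min => /andP[eu du]; [exact: dP|exact: eP ys _ _].
Qed.

(** The degree of the map on the component of [x]. *)
Definition sheets D x w : nat :=
  count (fun z => `[< connected_component (quot_preim D) x z >]) (fib w).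

(** Along a segment in [D] no root changes component, as it moves little and a
    small disc around it lies in a single component. *)
Lemma sheets_const D x w w' : open D -> convexC D -> (forall w, D w -> full w) ->
  D w -> D w' -> sheets D x w' = sheets D x w.
Proof.
move=> oD cD Df Dw Dw'; rewrite -(ray1 w w').
apply: (@segment_invariant _ (fun t => sheets D x (ray w w' t) = sheets D x w)); last first.
  by rewrite ray0.
move=> t t01; set v := ray w w' t; have Dv : D v by exact: cD.
have [e e0 eP] := preim_margin oD (fun z => @fiber_preim D v z Dv (Df v Dv)).
have [d d0 dP] := fiber_near sA sB (Df v Dv) (perm_refl _) e0.
have /cvg_normcP/(_ _ d0)/nbhs_ballP[r r0 rP] := @continuous_ray w w' t.
exists r => // u u01 /rP /= /dP[fu [ss pss ssP]].
suff -> : sheets D x (ray w w' u) = sheets D x v by [].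
rewrite /sheets -(permP pss); apply/esym/(@eq_count_nth _ 0).
  by rewrite (perm_size pss) !(size_fiber sA sB)//; exact: Df.
rewrite (size_fiber sA sB); last exact: Df.
move=> i ilt; apply: asbool_equiv_eq; apply: iff_sym.
apply: component_near (ssP i ilt) => y; apply: eP; rewrite mem_nth// (size_fiber sA sB)//.
exact: Df.
Qed.

End Components.

(** * Dessins of self-maps of the sphere *)

Section AbstractDessin.
Variable R : realType.
Notation P1 := (P1 R).
Implicit Types (j h : P1 -> P1) (U E : set P1).

(** The notions attached to a curve only involve its j-invariant.  Stated for an
    arbitrary self-map of the sphere they can be transported along a change of
    coordinate. *)
Definition graph_of j : set P1 := j @^-1` [set fin t%:C%C | t in `[0 : R, 1]].

Definition regions_of j : set (set P1) :=
  [set connected_component (~` graph_of j) x | x in ~` graph_of j].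

Definition passage_of j U (s : bool) E : Prop :=
  exists (d : R) (F : R * R -> P1),
    let Q := `[0, 1]%classic `*` `[0, d]%classic in
    [/\ 0 < d,
        {within Q, continuous F},
        forall t h : R, Q (t, h) -> j (F (t, h)) = fin (t +i* ((-1) ^+ s * h))%C,
        forall t h : R, Q (t, h) -> 0 < h -> U (F (t, h)) &
        E = [set F (t, 0) | t in `[0 : R, 1]]].

Definition gon_of j U : nat :=
  #|` fset_set [set e : bool * set P1 | passage_of j U e.1 e.2] |./2.

Definition type_of j : seq nat := sort geq [seq gon_of j U | U <- fset_set (regions_of j)].

Lemma combinatorial_typeE n (C : crtc R n) :
  combinatorial_type C = type_of (j_invariant C).
Proof. by []. Qed.

Lemma fset_set_perm (T : choiceType) (A : set T) (s : seq T) : uniq s ->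
  (forall x, A x <-> x \in s) -> perm_eq (fset_set A) s.
Proof.
move=> us As; have -> : A = [set` [fset x in s]%fset].
  by apply/seteqP; split=> x /=; rewrite in_fset => /As.
rewrite set_fsetK; apply: uniq_perm => // x.
by rewrite in_fset.
Qed.

Lemma sort_geq_perm (s s' : seq nat) : perm_eq s s' -> sort geq s = sort geq s'.
Proof.
move=> ss'; apply/perm_sortP: ss' => [m n|n m p /= nm mp|m n].
- exact: leq_total.
- exact: leq_trans mp nm.
- by rewrite /geq /= andbC => /anti_leq.
Qed.

Lemma type_of_enum j Us : uniq Us -> (forall U, regions_of j U <-> U \in Us) ->
  type_of j = sort geq [seq gon_of j U | U <- Us].
Proof. by move=> u jU; apply: sort_geq_perm; apply: perm_map; exact: fset_set_perm. Qed.

Lemma gon_of_enum j U Es : uniq Es ->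
  (forall e, passage_of j U e.1 e.2 <-> e \in Es) -> gon_of j U = (size Es)./2.
Proof. by move=> u jU; rewrite /gon_of (perm_size (fset_set_perm u jU)). Qed.

Lemma card_fset_set_bij (T T' : choiceType) (f : T' -> T) (f' : T -> T') (A : set T) :
  cancel f f' -> cancel f' f -> #|` fset_set (f @^-1` A)| = #|` fset_set A|.
Proof.
move=> fK f'K; have [fA|nA] := pselect (finite_set A).
  have -> : f @^-1` A = f' @` A.
    apply/seteqP; split=> [x Ax|_ [x Ax <-]]; first by exists (f x).
    by rewrite /= f'K.
  by rewrite fset_set_image// card_imfset//; exact: can_inj f'K.
have nA' : ~ finite_set (f @^-1` A).
  move=> fA; apply: nA; rewrite (_ : A = f @` (f @^-1` A)).
    exact: finite_image.
  by apply/seteqP; split=> [x Ax|_ [x Ax <-]//]; exists (f' x); rewrite /= f'K.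
by rewrite /fset_set; do 2 case: pselect.
Qed.

Section Homeo.
Variables (h h' : P1 -> P1).
Hypothesis hK : cancel h h'.
Hypothesis h'K : cancel h' h.
Hypothesis hc : continuous h.
Hypothesis h'c : continuous h'.

Lemma component_homeo (A : set P1) x :
  connected_component (h @^-1` A) x = h @^-1` connected_component A (h x).
Proof.
have sub g (B : set P1) y : continuous g -> g @` connected_component (g @^-1` B) y
    `<=` connected_component B (g y).
  move=> gc _ [z yz <-].
  have By : (g @^-1` B) y by exact: connected_component_sub (connected_component_sym yz).
  have c1 : connected (g @` connected_component (g @^-1` B) y).
    apply: connected_continuous_connected; first exact: component_connected.
    exact: continuous_subspaceT.
  apply: (connected_component_max _ _ c1).
  - by exists y => //; exact: connected_component_refl.
  - by move=> _ [t + <-] => /connected_component_sub.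
  - by exists z.
apply/seteqP; split=> y /=; first by move=> xy; apply: sub => //; exists y.
move=> xy; rewrite -(hK y) -(hK x); apply: sub => //; exists (h y) => //.
congr connected_component: xy; apply/seteqP; split=> z /=; rewrite ?h'K//.
Qed.

Lemma graph_of_homeo j : ~` graph_of (j \o h) = h @^-1` (~` graph_of j).
Proof. by []. Qed.

Lemma regions_of_homeo j U : regions_of (j \o h) (h @^-1` U) <-> regions_of j U.
Proof.
split=> [[x jx xU]|[x jx <-]].
  exists (h x) => //; apply/seteqP; split=> y.
    by rewrite -[y in X in X -> _]h'K => xy; rewrite -[y]h'K; have : (h @^-1` U) (h' y); rewrite // -xU graph_of_homeo component_homeo.
  rewrite -[y]h'K => Uy; have : (h @^-1` U) (h' y) by [].
  by rewrite -xU graph_of_homeo component_homeo.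
exists (h' x); first by rewrite graph_of_homeo /= h'K.
by rewrite graph_of_homeo component_homeo h'K.
Qed.

Lemma passage_of_homeo j U s E :
  passage_of (j \o h) (h @^-1` U) s (h @^-1` E) <-> passage_of j U s E.
Proof.
split=> -[d [F [d0 cF jF UF EF]]].
  exists d, (h \o F); split=> //.
  - by apply: within_continuous_comp cF => x _; exact: hc.
  - apply/seteqP; split=> [y Ey|_ [t t01 <-]].
      have : (h @^-1` E) (h' y) by rewrite /= h'K.
      by rewrite EF => -[t t01 ty]; exists t => //=; rewrite ty h'K.
    by have : (h @^-1` E) (F (t, 0)) by rewrite EF; exists t.
exists d, (h' \o F); split=> //.
- by apply: within_continuous_comp cF => x _; exact: h'c.
- by move=> t u Qtu; rewrite /= h'K; exact: jF.
- by move=> t u Qtu u0; rewrite /= h'K; exact: UF.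
apply/seteqP; split=> [y /=|_ [t t01 <-] /=]; rewrite EF.
  by move=> [t t01 ty]; exists t => //=; rewrite ty hK.
by exists t => //; rewrite h'K.
Qed.

Lemma preimage_homeoK : cancel (fun U : set P1 => h @^-1` U) (fun U => h' @^-1` U).
Proof. by move=> U; apply/seteqP; split=> x /=; rewrite h'K. Qed.

Lemma preimage_homeoK' : cancel (fun U : set P1 => h' @^-1` U) (fun U => h @^-1` U).
Proof. by move=> U; apply/seteqP; split=> x /=; rewrite hK. Qed.

Lemma gon_of_homeo j U : gon_of (j \o h) (h @^-1` U) = gon_of j U.
Proof.
rewrite /gon_of; congr (_./2).
rewrite -(@card_fset_set_bij _ _ (fun e : bool * set P1 => (e.1, h @^-1` e.2))
  (fun e => (e.1, h' @^-1` e.2))).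
- congr (#|` fset_set _|); apply/seteqP.
  by split=> -[s E] /=; move/(passage_of_homeo j U s E).
- by move=> [s E] /=; rewrite preimage_homeoK.
- by move=> [s E] /=; rewrite preimage_homeoK'.
Qed.

(** A homeomorphism of the sphere carries regions to regions and the passages
    along their boundaries to passages. *)
Lemma type_of_homeo j Us : uniq Us -> (forall U, regions_of j U <-> U \in Us) ->
  type_of (j \o h) = type_of j.
Proof.
move=> u jU; rewrite (type_of_enum u jU).
rewrite (@type_of_enum _ [seq h @^-1` U | U <- Us]).
- by rewrite -map_comp; congr sort; apply: eq_map => U; exact: gon_of_homeo.
- by rewrite map_inj_uniq//; exact: can_inj preimage_homeoK.
move=> U; rewrite -(preimage_homeoK' U) regions_of_homeo jU.
by rewrite mem_map//; exact: can_inj preimage_homeoK.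
Qed.

End Homeo.

(** * Topology of the sphere *)

Section Sphere.
Notation C := (R[i] : numFieldType).

Lemma nbhs_finP (z : R[i]) (A : set P1) : nbhs (fin z : P1) A <->
  exists2 e : R, 0 < e & forall y : R[i], normc (z - y) < e -> A (fin y).
Proof. exact: (@nbhs_normcP R z (Some @^-1` A)). Qed.

Lemma nbhs_inftyP (A : set P1) : nbhs (infty : P1) A <->
  A infty /\ exists M : R, forall y : R[i], M < normc y -> A (fin y).
Proof.
split=> [[K [cK _] KA]|[Ainf [M MA]]].
  split; first by apply: KA; right.
  have /compact_near_coveringP cK' := cK.
  have [] := cK' R (+oo%R) (fun M x => normc x < M) _.
    move=> x Kx; near=> y M => /=; apply: (@lt_trans _ _ (normc x + 1)).
      have xy : normc (x - y) < 1 by near: y; exact: near_normc.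
      by have := ler_normcB y x 0; rewrite !subr0 (normcBC y); lra.
    by near: M; apply: nbhs_pinfty_gt; rewrite num_real.
  move=> M [Mreal KM]; exists (M + 1) => y My; apply: KA; left; exists y => // Ky.
  by have := KM (M + 1) _ y Ky; rewrite ltrDl ltr01 => /(_ isT); lra.
exists [set z | normc z <= M].
  split; first exact: compact_disc.
  by apply: compact_closed; [exact: hausdorffC|exact: compact_disc].
move=> _ [[y /= /negP + <-]|->//]; rewrite -ltNge; exact: MA.
Unshelve. all: by end_near. Qed.

Definition unfin (x : P1) : R[i] := if x is Some z then z else 0.

Lemma continuous_fin : continuous (fin : C -> P1).
Proof. exact: one_point_compactification_some_continuous. Qed.

Lemma continuous_unfin (z : R[i]) : {for (fin z : P1), continuous (unfin : P1 -> C)}.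
Proof. by move=> A Az; exact: Az. Qed.

(** The plane is an open subspace of the sphere, so components may be computed
    in the plane. *)
Lemma component_fin (X : set C) (z : R[i]) : X z ->
  connected_component (fin @` X : set P1) (fin z) = fin @` connected_component X z.
Proof.
move=> Xz; apply/seteqP; split.
  move=> y zy; have zX : (fin @` X : set P1) (fin z) by exists z.
  pose V := connected_component (fin @` X : set P1) (fin z).
  have VX : V `<=` fin @` X by exact: connected_component_sub.
  have cV : connected ((unfin : P1 -> C) @` V).
    apply: connected_continuous_connected; first exact: component_connected.
    apply: continuous_in_subspaceT => x /set_mem /VX [t _ <-].
    exact: continuous_unfin.
  have [t Xt ty] := VX _ zy; exists t => //.
  apply: (connected_component_max _ _ cV).
  - by exists (fin z) => //; exact: connected_component_refl.
  - by move=> _ [x /VX[u Xu <-] <-].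
  - by exists y => //; rewrite -ty.
have cV : connected ((fin : C -> P1) @` connected_component X z).
  apply: connected_continuous_connected; first exact: component_connected.
  exact: continuous_subspaceT continuous_fin.
apply: (connected_component_max _ _ cV).
- by exists z => //; exact: connected_component_refl.
- by move=> _ [x /connected_component_sub Xx <-]; exists x.
Qed.

Definition inversion (x : P1) : P1 :=
  if x is Some z then if z == 0 then infty else fin z^-1 else fin 0.

Definition translation (a : R[i]) (x : P1) : P1 :=
  if x is Some z then fin (z + a) else infty.

Lemma inversionK : involutive inversion.
Proof.
move=> [z|] /=; last by rewrite eqxx.
by have [->//|z0] := eqVneq z 0; rewrite /= invr_eq0 (negPf z0) invrK.
Qed.

Lemma translationK a : cancel (translation a) (translation (- a)).
Proof. by move=> [z|] //=; rewrite addrK. Qed.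

Lemma continuous_translation a : continuous (translation a).
Proof.
move=> [z|] A.
  move/nbhs_finP => [e e0 eA]; apply/nbhs_finP; exists e => // y zy; apply: eA.
  by rewrite (_ : _ - _ = z - y)//; ring.
move/nbhs_inftyP => [Ai [M MA]]; apply/nbhs_inftyP; split=> //.
exists (M + normc a) => y My; apply: MA.
have := ler_normcB (y + a) a 0; rewrite !subr0 addrK.
have := ler_normcB (y + a) 0 a; rewrite !subr0 sub0r normcN addrK; lra.
Qed.

Lemma continuous_inversion : continuous inversion.
Proof.
move=> [z|] A.
  have [->|z0] := eqVneq z 0.
    rewrite /= eqxx => /nbhs_inftyP[Ai [M MA]]; apply/nbhs_finP.
    exists (1 / (`|M| + 1)) => [|y]; first by rewrite divr_gt0// ltr_wpDl.
    rewrite sub0r normcN ltr_pdivlMr ?ltr_wpDl// => h.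
    rewrite /= ; case: eqVneq => // y0; apply: MA; rewrite normcV.
    have ny : 0 < normc y by rewrite normc_gt0.
    rewrite -[M](mulfK (lt0r_neq0 ny)) -[X in _ < X]mul1r ltr_pM2r ?invr_gt0//.
    have : M * normc y <= `|M| * normc y by rewrite ler_wpM2r ?ler_norm// ltW.
    by rewrite mulrC; lra.
  rewrite /= (negPf z0) => /nbhs_finP[e e0 eA]; apply/nbhs_finP.
  have [d d0 dP] : exists2 d : R, 0 < d & forall y : R[i],
      normc (z - y) < d -> normc (z^-1 - y^-1) < e.
    have [||d d0 dP] := @quot_near R 1 'X z e; rewrite ?hornerX//.
    by exists d => // y /dP[_]; rewrite /quot !hornerC !hornerX !div1r.
  exists (Num.min d (normc z)) => [|y]; first by rewrite lt_min d0 normc_gt0.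
  rewrite lt_min => /andP[/dP zy yz]; rewrite /=; case: eqP => [y0|_].
    by move: yz; rewrite y0 subr0 ltxx.
  exact: eA.
move/nbhs_finP => [e e0 eA]; apply/nbhs_inftyP; split.
  by apply: eA; rewrite subrr normc0.
exists e^-1 => y ey; have ny : 0 < normc y by apply: lt_trans ey; rewrite invr_gt0.
rewrite /=; case: eqP => [y0|_]; first by move: ny; rewrite y0 normc0 ltxx.
by apply: eA; rewrite sub0r normcN normcV -[e]invrK ltf_pV2// posrE invr_gt0.
Qed.

End Sphere.
End AbstractDessin.

(** * Passages along the boundary of a region *)

Section Collars.
Variable R : realType.
Notation C := (R[i] : numFieldType).
Notation P1 := (P1 R).
Variables (A B : {poly R[i]}) (n : nat).
Hypothesis sA : (size A <= n.+1)%N.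
Hypothesis sB : (size B <= n.+1)%N.
Hypothesis AB_coprime : forall z, B.[z] = 0 -> A.[z] != 0.
Hypothesis A_neq0 : A != 0.
Hypothesis AB_full : forall w, w != 0 -> full_degree A B n w.
Implicit Types (w z c x : R[i]).

Local Notation fib := (fiber A B).
Local Notation full := (full_degree A B n).

(** [jj] extends [A / B] to the sphere.  Infinity is mapped to [0], an endpoint
    of the interval, so that it is the end of a passage and never inside one. *)
Variable jj : P1 -> P1.
Hypothesis jj_fin : forall z, jj (fin z) = frac_pt A.[z] B.[z].
Hypothesis jj_infty : jj infty = fin 0.

Variable d : R.
Hypothesis d_gt0 : 0 < d.
(** All branch values outside the real axis are at distance at least [2 * d]
    from it. *)
Hypothesis fib_uniq : forall w, 0 < `|complex.Im w| < 2 * d -> uniq (fib w).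

(** [strip s] lies on the side of the real axis on which the collars of the
    passages of kind [s] take their values. *)
Definition signed (s : bool) (h : R) : R := (-1) ^+ s * h.
Definition strip_pt s (t h : R) : R[i] := (t +i* signed s h)%C.
Definition strip s : set C := [set w | 0 < signed s (complex.Im w) < 2 * d].
Definition mid s : R[i] := strip_pt s 2^-1 d.

Lemma signedK s : involutive (signed s).
Proof. by move=> h; rewrite /signed mulrA -expr2 sqrr_sign mul1r. Qed.

Lemma strip_ptE s w : w = strip_pt s (complex.Re w) (signed s (complex.Im w)).
Proof. by rewrite /strip_pt signedK; case: w. Qed.

Lemma strip_strip_pt s t h : strip s (strip_pt s t h) = (0 < h < 2 * d).
Proof. by rewrite /strip /= signedK. Qed.

Lemma strip_mid s : strip s (mid s).
Proof. by rewrite strip_strip_pt d_gt0 /= ltr_pMl// ltr1n. Qed.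

Lemma signed_ray s v w t : signed s (complex.Im (ray v w t)) =
  (1 - t) * signed s (complex.Im v) + t * signed s (complex.Im w).
Proof. by case: v w => [a b] [a' b'] /=; rewrite /signed; ring. Qed.

Lemma strip_convex s : convexC (strip s).
Proof.
move=> v w t; rewrite /strip /= signed_ray.
move: (signed s (complex.Im v)) (signed s (complex.Im w)) => p q /andP[p0 p1] /andP[q0 q1] /andP[t0 t1].
have [->|t00] := eqVneq t 0; first by apply/andP; split; lra.
have tp : 0 < t by rewrite lt_def t00.
have h1 : 0 <= (1 - t) * p by rewrite mulr_ge0 ?subr_ge0// ltW.
have h2 : 0 < t * q by rewrite mulr_gt0.
have h3 : (1 - t) * p <= (1 - t) * (2 * d) by rewrite ler_wpM2l ?subr_ge0// ltW.
have h4 : t * q < t * (2 * d) by rewrite ltr_pM2l.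
by apply/andP; split; lra.
Qed.

Lemma signed_lip s v w : `|signed s (complex.Im v) - signed s (complex.Im w)| <= normc (v - w).
Proof.
rewrite /signed -mulrBr normrM normr_sign mul1r.
by have := Im_le_normc (v - w); case: v w => [? ?] [? ?].
Qed.

Lemma strip_open s : open (strip s).
Proof.
apply/open_normcP => w; rewrite /strip /= => /andP[w0 w1].
exists (Num.min (signed s (complex.Im w)) (2 * d - signed s (complex.Im w))) => [|v].
  by rewrite lt_min w0 subr_gt0.
rewrite lt_min => /andP[h1 h2]; have := signed_lip s w v.
by rewrite ler_norml => /andP[h3 h4]; apply/andP; split; lra.
Qed.

Lemma strip_Im s w : strip s w -> 0 < `|complex.Im w| < 2 * d.
Proof.
rewrite /strip /= => h; rewrite -[complex.Im w](signedK s).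
rewrite /signed normrM normr_sign mul1r; case/andP: h => h0 h1.
by rewrite gtr0_norm// h0.
Qed.

Lemma Im_neq0 w : 0 < `|complex.Im w| -> w != 0.
Proof. by apply: contraTneq => ->; rewrite /= normr0 ltxx. Qed.

Lemma strip_full s w : strip s w -> full w.
Proof. by move/strip_Im/andP => [/Im_neq0 w0 _]; exact: AB_full. Qed.

Lemma strip_simple s c x (K : set C) : K `<=` strip s -> K c -> x \in fib c ->
  simple_over A B n c x K.
Proof.
move=> Ks Kc xc; split=> [w /Ks/strip_full//||w /Ks/strip_Im/fib_uniq//].
by rewrite count_uniq_mem ?xc// fib_uniq//; apply: (@strip_Im s); exact: Ks.
Qed.

Lemma strip_section s c x : strip s c -> x \in fib c ->
  exists g, section_on A B c x (strip s) g.
Proof.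
move=> sc xc; apply: (open_section sA sB (@strip_open s) (@strip_convex s) sc).
exact: (@strip_simple s c x (strip s)).
Qed.

Lemma strip_star s c : strip s c -> star c (strip s).
Proof. by move=> sc w t sw t01; exact: strip_convex. Qed.

(** The possible limits of a section at a point of the real axis, with a
    basis of neighbourhoods for each. *)
Definition near_pt (e : R) (l : P1) (z : R[i]) : Prop :=
  if l is Some r then normc (r - z) < e else e^-1 < normc z.

Lemma near_pt_mono e e' l z : 0 < e <= e' -> near_pt e l z -> near_pt e' l z.
Proof.
move=> /andP[e0 ee']; case: l => [r|] /= h; first exact: lt_le_trans ee'.
by apply: le_lt_trans h; rewrite lef_pV2// posrE// (lt_le_trans e0).
Qed.

Lemma near_pt_nbhs (l : P1) (N : set P1) : nbhs l N ->
  exists2 e : R, 0 < e & forall z, near_pt e l z -> N (fin z).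
Proof.
case: l => [r|]; first by move/nbhs_finP => [e e0 eN]; exists e.
move/nbhs_inftyP => [_ [M MN]]; exists (`|M| + 1)^-1 => [|z].
  by rewrite invr_gt0 ltr_wpDl.
rewrite /near_pt /= invrK => h; apply: MN; apply: le_lt_trans h.
by rewrite (le_trans (ler_norm _))// lerDl.
Qed.

Lemma near_pt_separated (L : seq P1) : exists2 m : R, 0 < m &
  forall l l' z z', l \in L -> l' \in L -> near_pt m l z -> near_pt m l' z' ->
  normc (z - z') < m -> l = l'.
Proof.
pose rs := map (@unfin R) L.
have [m m0 mP] := min_dist2 rs rs.
pose M := \sum_(r <- rs) normc r.
have M0 : 0 <= M by apply: sumr_ge0 => r _; exact: normc_ge0.
have rM r : r \in rs -> normc r <= M.
  by move=> rL; rewrite /M (big_rem r)//= lerDl sumr_ge0// => y _; exact: normc_ge0.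
pose e := Num.min (m / 3) (M + 3)^-1.
have e0 : 0 < e by rewrite lt_min divr_gt0// invr_gt0 ltr_wpDl.
have em : e <= m / 3 by rewrite ge_min lexx.
have eM : M + 3 <= e^-1.
  by rewrite -[M + 3]invrK lef_pV2 ?posrE ?invr_gt0 ?ltr_wpDl// ge_min lexx orbT.
have e1 : e < 1.
  apply: (@le_lt_trans _ _ (M + 3)^-1); first by rewrite ge_min lexx orbT.
  by rewrite invf_lt1; lra.
have key r z z' : r \in rs -> e^-1 < normc z -> normc (r - z') < e -> normc (z - z') < e -> False.
  move=> /rM rM' h1 h2 h3; have := ler_normcB z z' 0; have := ler_normcB z' r 0.
  rewrite !subr0 (normcBC z' r) => h4 h5; have : (0 : R) < 0 by lra.
  by rewrite ltxx.
have inrs r : (Some r : P1) \in L -> r \in rs by move=> rL; apply/mapP; exists (Some r).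
exists e => // -[r|] [r'|] z z' lL l'L //= h1 h2 h3.
- have [->//|rr'] := eqVneq r' r; have := mP r r' (inrs _ lL) (inrs _ l'L) rr'.
  have := ler_normcB r z r'; have := ler_normcB z z' r'.
  rewrite (normcBC z' r') => h4 h5 h6; have : (0 : R) < 0 by lra.
  by rewrite ltxx.
- by case: (key r z' z (inrs _ lL)) => //; rewrite normcBC.
- by case: (key r' z z' (inrs _ l'L)).
Qed.

Lemma half_disc_ray s (t0 r : R) v w t : strip s v -> strip s w ->
  normc (t0%:C%C - v) < r -> normc (t0%:C%C - w) < r -> 0 <= t <= 1 ->
  strip s (ray v w t) /\ normc (t0%:C%C - ray v w t) < r.
Proof.
move=> sv sw tv tw t01; split; first exact: strip_convex.
have [t00 t1] := andP t01.
rewrite (_ : _ - _ = (1 - t)%:C%C * (t0%:C%C - v) + t%:C%C * (t0%:C%C - w)); last first.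
  by rewrite /ray rmorphB rmorph1; ring.
apply: le_lt_trans (ler_normcD _ _) _; rewrite !normcM !normcR !ger0_norm ?subr_ge0//.
have [->|tn0] := eqVneq t 0; first by rewrite subr0 mul1r mul0r addr0.
have tp : 0 < t by rewrite lt_def tn0.
have h1 : (1 - t) * normc (t0%:C%C - v) <= (1 - t) * r by rewrite ler_wpM2l ?subr_ge0// ltW.
have h2 : t * normc (t0%:C%C - w) < t * r by rewrite ltr_pM2l.
by lra.
Qed.

Lemma half_disc_nonempty s (t0 r : R) : 0 < r ->
  exists2 h : R, 0 < h & forall h', 0 < h' <= h ->
    strip s (strip_pt s t0 h') /\ normc (t0%:C%C - strip_pt s t0 h') < r.
Proof.
move=> r0; exists (Num.min (r / 2) d) => [|h]; first by rewrite lt_min divr_gt0.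
rewrite le_min => /and3P[h0 hr hd]; split; first by rewrite strip_strip_pt h0 /=; lra.
rewrite (_ : _ - _ = (0 +i* - signed s h)%C); last by simpc.
rewrite /= expr0n /= add0r sqrrN sqrtr_sqr /signed normrM normr_sign mul1r.
by rewrite gtr0_norm//; lra.
Qed.

Definition limit_at s (g : R[i] -> R[i]) (t0 : R) (l : P1) :=
  forall N, nbhs l N -> exists2 r : R, 0 < r &
    forall w, strip s w -> normc (t0%:C%C - w) < r -> N (fin (g w)).

(** Near a boundary point all roots lie in small disjoint neighbourhoods of
    finitely many points, and a section over a half-disc cannot jump from one of
    them to another. *)
Lemma limit_exists s c x g (t0 : R) (L : seq P1) :
  section_on A B c x (strip s) g ->
  (forall e : R, 0 < e -> exists2 r : R, 0 < r & forall w, strip s w ->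
     normc (t0%:C%C - w) < r -> forall z, z \in fib w -> exists2 l, l \in L & near_pt e l z) ->
  exists2 l, l \in L & limit_at s g t0 l.
Proof.
move=> [gcont gf _] LP; have [m m0 mP] := near_pt_separated L.
have [r r0 rP] := LP m m0; have [h h0 hP] := half_disc_nonempty s t0 r0.
have [|s1 t1] := hP h; first by rewrite h0 lexx.
set w1 := strip_pt s t0 h in s1 t1; have [l lL lP] := rP _ s1 t1 _ (gf _ s1).
have allP w : strip s w -> normc (t0%:C%C - w) < r -> near_pt m l (g w).
  move=> sw tw; rewrite -(ray1 w1 w).
  apply: (@segment_invariant _ (fun t => near_pt m l (g (ray w1 w t)))); last by rewrite ray0.
  move=> t t01; have [st tt] := half_disc_ray s1 sw t1 tw t01.
  have [d1 d10 d1P] := gcont _ st m m0.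
  have /cvg_normcP/(_ _ d10)/nbhs_ballP[q q0 qP] := @continuous_ray R w1 w t.
  exists q => // u u01 /qP /= tu; have [su tu'] := half_disc_ray s1 sw t1 tw u01.
  have h1 := d1P _ su tu.
  have [l1 l1L l1P] := rP _ st tt _ (gf _ st); have [l2 l2L l2P] := rP _ su tu' _ (gf _ su).
  have l12 := mP _ _ _ _ l1L l2L l1P l2P h1.
  split=> h2.
    by rewrite normcBC in h1; have -> := mP _ _ _ _ lL l1L h2 l1P h1.
  by have -> := mP _ _ _ _ lL l2L h2 l2P h1.
exists l => // N /near_pt_nbhs[e e0 eN].
have me0 : 0 < Num.min m e by rewrite lt_min m0.
have [q q0 qP] := LP _ me0; exists (Num.min r q) => [|w sw]; first by rewrite lt_min r0.
rewrite lt_min => /andP[wr wq]; apply: eN; have [l' l'L l'P] := qP _ sw wq _ (gf _ sw).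
have -> : l = l'.
  apply: (mP _ _ (g w) (g w) lL l'L (allP w sw wr)); last by rewrite subrr normc0.
  by apply: near_pt_mono l'P; rewrite me0 ge_min lexx.
by apply: near_pt_mono l'P; rewrite me0 ge_min lexx orbT.
Qed.

Lemma limits_neq0 s (t0 : R) : t0 != 0 -> forall e : R, 0 < e ->
  exists2 r : R, 0 < r & forall w, strip s w -> normc (t0%:C%C - w) < r ->
  forall z, z \in fib w -> exists2 l, l \in map (@fin R) (fib t0%:C%C) & near_pt e l z.
Proof.
move=> t00 e e0; have f0 : full t0%:C%C by apply: AB_full; rewrite eq_complex /= negb_and t00.
have [q q0 qP] := fiber_near sA sB f0 (perm_refl _) e0.
exists q => // w _ /qP[fw [ss pss ssP]] z.
rewrite -(perm_mem pss) => /(nthP 0)[i + <-].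
rewrite (perm_size pss) (size_fiber sA sB)// => ilt; exists (fin (fib t0%:C%C)`_i).
  by apply: map_f; rewrite mem_nth// (size_fiber sA sB).
exact: ssP.
Qed.

(** Over [0] roots may escape to infinity. *)
Lemma limits_0 s (e : R) : 0 < e ->
  exists2 r : R, 0 < r & forall w, strip s w -> normc ((0 : R)%:C%C - w) < r ->
  forall z, z \in fib w -> exists2 l, l \in infty :: map (@fin R) (fib 0) & near_pt e l z.
Proof.
move=> e0; have AE : A = from_roots (lead_coef A) (fib 0).
  by have := pencilE A B 0; rewrite /pencil scale0r subr0.
have nA : 0 < normc (lead_coef A) by rewrite normc_gt0 lead_coef_eq0.
have [b b0 bP] := coef_bounded B.
pose S := b * \sum_(i < n.+1) (e^-1) ^+ i.
have S0 : 0 < S.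
  rewrite mulr_gt0// big_ord_recl expr0 ltr_pwDl// sumr_ge0// => i _.
  by rewrite exprn_ge0// invr_ge0 ltW.
pose low := normc (lead_coef A) * e ^+ size (fib 0).
have low0 : 0 < low by rewrite mulr_gt0 ?exprn_gt0.
exists (low / S) => [|w sw]; first by rewrite divr_gt0.
rewrite sub0r normcN ltr_pdivlMr// => wS z.
rewrite (mem_fiber sA sB) ?(strip_full sw)// => /eqP Az.
have [ze|ze] := ltP e^-1 (normc z); first by exists infty; rewrite ?mem_head.
have [[r r0 rz]|far] := pselect (exists2 r, r \in fib 0 & normc (r - z) < e).
  by exists (fin r) => //; rewrite in_cons map_f ?orbT.
have far' r : r \in fib 0 -> e <= normc (z - r).
  by move=> r0; rewrite normcBC leNgt; apply/negP => h; apply: far; exists r.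
have : low <= normc A.[z].
  rewrite AE /from_roots hornerZ normcM .
  rewrite /low ler_pM ?exprn_ge0 ?normc_ge0 ?(ltW e0)// horner_prod normc_prod.
  elim: (fib 0) far' => [|y ys IH] h; first by rewrite big_nil expr0.
  rewrite big_cons /= exprS ler_pM ?exprn_ge0 ?(ltW e0)// ?hornerXsubC ?h ?mem_head//.
  by apply: IH => u uy; apply: h; rewrite in_cons uy orbT.
have : normc B.[z] <= S by apply: normc_horner_le => //; exact: ltW.
rewrite Az normcM => h1 h2.
have : normc w * normc B.[z] <= normc w * S by rewrite ler_wpM2l ?normc_ge0.
move=> h3; have : low < low by lra.
  by rewrite ltxx.
Qed.

Lemma jj_fiber w z : full w -> (z \in fib w) = (jj (fin z) == fin w).
Proof.
move=> fw; rewrite (mem_fiber_quot sA sB AB_coprime)// jj_fin /frac_pt.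
by case: eqVneq => // Bz; rewrite /quot /=; apply/eqP/eqP => [->//|[]].
Qed.

(** The limit is a preimage of [t0] because the candidates are: the roots over
    [t0] and, for [t0 = 0], infinity. *)
Lemma section_limit s c x g (t0 : R) : section_on A B c x (strip s) g ->
  exists2 l, jj l = fin t0%:C%C & limit_at s g t0 l.
Proof.
move=> sg; have [->|t00] := eqVneq t0 0.
  have [l lL lim] := limit_exists sg (@limits_0 s); exists l => //.
  move: lL; rewrite in_cons => /predU1P[->//|/mapP[z z0 ->]].
  have : A.[z] = 0.
    have := pencilE A B 0; rewrite /pencil scale0r subr0 => ->.
    by apply/rootP; rewrite rootZ ?lead_coef_eq0// root_prod_XsubC.
  move=> Az; rewrite jj_fin /frac_pt; case: eqP => [/AB_coprime|_]; first by rewrite Az eqxx.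
  by rewrite Az mul0r.
have [l /mapP[z zt ->] lim] := limit_exists sg (@limits_neq0 s t0 t00).
exists (fin z) => //; apply/eqP; rewrite -jj_fiber//.
by apply: AB_full; rewrite eq_complex /= negb_and t00.
Qed.

Lemma sphere_hausdorff : hausdorff_space P1.
Proof.
apply: one_point_compactification_hausdorff; last exact: hausdorffC.
move=> x _; exists [set z | normc z <= normc x + 1]; last first.
  split; first exact: compact_disc.
  by apply: compact_closed; [exact: hausdorffC|exact: compact_disc].
rewrite withinET; apply/nbhs_normcP; exists 1 => // y xy /=.
by have := ler_normcB y x 0; rewrite !subr0 (normcBC y); lra.
Qed.

Lemma sphere_regular : regular_space P1.
Proof.
move=> x; apply: (@compact_regular _ x setT) => //.
- exact: sphere_hausdorff.
- exact: one_point_compactification_compact.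
- exact: filterT.
Qed.

Lemma within_boxP (Q : set (R * R)) (F : R * R -> P1) :
  {within Q, continuous F} <-> forall p, Q p -> forall N, nbhs (F p) N ->
  exists2 r : R, 0 < r & forall q, Q q -> `|p.1 - q.1| < r -> `|p.2 - q.2| < r -> N (F q).
Proof.
rewrite subspace_continuousP; split=> h p Qp N.
  move=> /(h p Qp)/nbhs_ballP[r r0 rP]; exists r => // q Qq h1 h2.
  by apply: rP => //; split.
move=> /(h p Qp)[r r0 rP]; apply/nbhs_ballP; exists r => // q [h1 h2] Qq.
exact: rP.
Qed.

Definition boundary_limit s g (t : R) : P1 :=
  xget infty [set l | jj l = fin t%:C%C /\ limit_at s g t l].

(** A section read in the coordinates of the collar, and extended by its limits
    to the real axis. *)
Definition collar s g (p : R * R) : P1 :=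
  if 0 < p.2 then fin (g (strip_pt s p.1 p.2)) else boundary_limit s g p.1.

Lemma boundary_limitP s c x g t : section_on A B c x (strip s) g ->
  jj (boundary_limit s g t) = fin t%:C%C /\ limit_at s g t (boundary_limit s g t).
Proof.
move=> sg; have [l jl lim] := section_limit t sg.
exact: (@xgetI _ infty [set l | jj l = fin t%:C%C /\ limit_at s g t l] l).
Qed.

Lemma normc_strip_pt s t h t' h' :
  normc (strip_pt s t h - strip_pt s t' h') <= `|t - t'| + `|h - h'|.
Proof.
apply: le_trans (normc_le_ReIm _) _; rewrite /strip_pt /= /signed -mulrBr normrM.
by rewrite normr_sign mul1r.
Qed.

Lemma strip_pt0 s t : strip_pt s t 0 = t%:C%C.
Proof. by rewrite /strip_pt /signed mulr0. Qed.

(** At a boundary point, continuity of the extension also has to be checked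
    along the boundary, whose values are themselves limits; this is where the
    regularity of the sphere is used. *)
Lemma collar_passage s c x g (U : set P1) : section_on A B c x (strip s) g ->
  (forall w, strip s w -> U (fin (g w))) ->
  passage_of jj U s [set collar s g (t, 0) | t in `[0 : R, 1]].
Proof.
move=> sg Ug; have [gcont gf _] := sg; exists d, (collar s g) => Q.
have Qs p : Q p -> 0 < p.2 -> strip s (strip_pt s p.1 p.2).
  move=> [_]; rewrite /= in_itv /= strip_strip_pt => /andP[_ pd] p0.
  by rewrite p0 (le_lt_trans pd)// ltr_pMl// ltr1n.
have Q2 p : Q p -> 0 <= p.2 by move=> [_]; rewrite /= in_itv /= => /andP[].
split=> //.
- apply/within_boxP => p Qp N; rewrite {1}/collar; case: ifPn => [p0|].
    move/nbhs_finP => [e e0 eN]; have [r r0 rP] := gcont _ (Qs p Qp p0) e e0.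
    exists (Num.min (p.2) (r / 2)) => [|q Qq]; first by rewrite lt_min p0 divr_gt0.
    rewrite !lt_min => /andP[_ h1] /andP[h2 h3].
    have q0 : 0 < q.2 by have := ler_norm (p.2 - q.2); lra.
    rewrite /collar q0; apply: eN; apply: rP; first exact: Qs.
    by apply: le_lt_trans (normc_strip_pt _ _ _ _ _) _; lra.
  rewrite -leNgt => p0; have {}p0 : p.2 = 0 by apply: le_anti; rewrite p0 Q2.
  move=> /sphere_regular[N' lN' N'N]; have [_ lim] := boundary_limitP p.1 sg.
  have [r r0 rP] := lim _ lN'; have r2 : 0 < r / 2 by rewrite divr_gt0.
  exists (r / 2) => // q Qq h1; rewrite p0 sub0r normrN => h2; apply: N'N.
  have near h : `|h| < r / 2 -> normc (p.1%:C%C - strip_pt s q.1 h) < r.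
    move=> hr; rewrite -(strip_pt0 s); apply: le_lt_trans (normc_strip_pt _ _ _ _ _) _.
    by rewrite sub0r normrN; lra.
  rewrite /collar; case: ifPn => [q0|_].
    by apply: subset_closure; apply: rP; [exact: Qs|exact: near].
  move=> N'' /(proj2 (boundary_limitP q.1 sg))[r' r'0 r'P].
  have [h h0 hP] := half_disc_nonempty s q.1 r'0.
  pose k := Num.min h (r / 4).
  have k0 : 0 < k by rewrite lt_min h0 divr_gt0.
  have [|sk tk] := hP k; first by rewrite k0 ge_min lexx.
  exists (fin (g (strip_pt s q.1 k))); split; last exact: r'P.
  apply: rP => //; apply: near; rewrite gtr0_norm//.
  by apply: (@le_lt_trans _ _ (r / 4)); [rewrite ge_min lexx orbT|lra].
- move=> t h Qth; rewrite /collar /=; case: ifPn => [h0|]; last first.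
    rewrite -leNgt => h0; have -> : h = 0 by apply: le_anti; rewrite h0 (Q2 _ Qth).
    by rewrite mulr0; have [] := boundary_limitP t sg.
  have sth := Qs _ Qth h0; apply/eqP; rewrite -jj_fiber; first exact: gf.
  exact: strip_full sth.
- by move=> t h Qth h0; rewrite /collar /= h0; apply: Ug; exact: Qs Qth h0.
Qed.

(** Regions: components of an open set containing every point over which the
    value is finite and not real. *)
Variable X : set C.
Hypothesis X_open : open X.
Hypothesis X_strip : forall z, B.[z] != 0 -> complex.Im (quot A B z) != 0 -> X z.

Lemma fiber_X s w z : strip s w -> z \in fib w -> X z.
Proof.
move=> sw; rewrite (mem_fiber_quot sA sB AB_coprime); last exact: strip_full sw.
case/andP=> Bz /eqP qz; apply: X_strip => //; rewrite qz.
by have /andP[] := strip_Im sw; rewrite normr_gt0.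
Qed.

(** The values of a section over a strip avoid the dessin, so they stay in one
    region. *)
Lemma section_component s c x g y v w : section_on A B c x (strip s) g ->
  strip s v -> strip s w ->
  connected_component X y (g v) -> connected_component X y (g w).
Proof.
move=> [gcont gf _] sv sw Vv; rewrite -(ray1 v w).
apply: (@segment_invariant _ (fun t => connected_component X y (g (ray v w t)))).
  move=> t t01; have st : strip s (ray v w t) by exact: strip_convex.
  have Xt := fiber_X st (gf _ st).
  have [e e0 eP] := (open_normcP _).1 X_open _ Xt.
  have [r r0 rP] := gcont _ st _ e0.
  have /cvg_normcP/(_ _ r0)/nbhs_ballP[q q0 qP] := @continuous_ray R v w t.
  exists q => // u u01 /qP /= tu; have su : strip s (ray v w u) by exact: strip_convex.
  exact: component_near eP _ (rP _ su tu).
by rewrite ray0.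
Qed.

Definition the_section s x : R[i] -> R[i] :=
  xget (fun _ => 0) [set g | section_on A B (mid s) x (strip s) g].

Lemma the_sectionP s x : x \in fib (mid s) ->
  section_on A B (mid s) x (strip s) (the_section s x).
Proof.
move=> xm; have [g sg] := strip_section (strip_mid s) xm.
exact: (@xgetI _ (fun _ => 0) [set g | section_on A B (mid s) x (strip s) g] g).
Qed.

Definition edge s x : set P1 := [set collar s (the_section s x) (t, 0) | t in `[0 : R, 1]].

Lemma strip_section_unique s c x g g' : strip s c -> x \in fib c ->
  section_on A B c x (strip s) g -> section_on A B c x (strip s) g' ->
  forall w, strip s w -> g w = g' w.
Proof.
move=> sc xc sg sg' w sw.
apply: (section_unique sA sB (strip_star sc) (strip_star sc) _ sg sg') => //.
exact: (@strip_simple s c x (strip s)).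
Qed.

(** The collar of a passage is a section over part of the strip.  It extends to
    a section [g] over the whole strip, and by uniqueness the two have the same
    limits on the real axis. *)
Lemma passage_edge s y E :
  passage_of jj (fin @` connected_component X y) s E ->
  exists2 x, x \in fib (mid s) & connected_component X y x /\ E = edge s x.
Proof.
set V := connected_component X y => -[d' [F []]].
set Q := (X in {within X, continuous F}); move=> d'0 /within_boxP Fc jF UF ->.
pose e := Num.min d' d.
have e0 : 0 < e by rewrite lt_min d'0.
have ed' : e <= d' by rewrite ge_min lexx.
have ed : e <= d by rewrite ge_min lexx orbT.
have Qt t h : 0 <= t <= 1 -> 0 <= h <= e -> Q (t, h).
  move=> t01 /andP[h0 he]; split; rewrite /= in_itv //=.
  by rewrite h0 (le_trans he).
have half : 0 <= (2^-1 : R) <= 1 by rewrite invr_ge0 ler0n invf_le1 ?ler1n.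
have sth t h : 0 < h <= e -> strip s (strip_pt s t h).
  by move=> /andP[h0 he]; rewrite strip_strip_pt h0 /=; lra.
have Ff t h : 0 <= t <= 1 -> 0 < h <= e -> exists2 x, F (t, h) = fin x &
    V x /\ x \in fib (strip_pt s t h).
  move=> t01 h0e; have [h0 he] := andP h0e.
  have Qth : Q (t, h) by apply: Qt; rewrite ?(ltW h0).
  have [x Vx xF] := UF t h Qth h0; exists x => //; split=> //.
  rewrite jj_fiber; last by apply: strip_full (sth t h h0e).
  by rewrite xF; apply/eqP; exact: jF.
have ee : 0 < e <= e by rewrite e0 lexx.
have [x1 Fx1 [Vx1 x1c]] := Ff 2^-1 e half ee.
set c1 := strip_pt s 2^-1 e in x1c; have sc1 : strip s c1 by exact: sth.
have [g sg] := strip_section sc1 x1c; have [gcont gf gc] := sg.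
have xm := gf _ (strip_mid s); exists (g (mid s)) => //; split.
  by apply: section_component sg sc1 (strip_mid s) _; rewrite gc.
have sg' : section_on A B (mid s) (g (mid s)) (strip s) g by [].
have gE := strip_section_unique (strip_mid s) xm sg' (the_sectionP xm).
(* The rectangle over which the collar [F], in the form [f], and the section [g]
   are both defined. *)
pose K : set C := [set w | 0 <= complex.Re w <= 1 /\ 0 < signed s (complex.Im w) <= e].
pose f w := unfin (F (complex.Re w, signed s (complex.Im w))).
have Ks : K `<=` strip s by move=> w [_ h]; rewrite [w](strip_ptE s); exact: sth.
have fF w : K w -> F (complex.Re w, signed s (complex.Im w)) = fin (f w).
  by move=> [w1 w2]; have [x Fx _] := Ff _ _ w1 w2; rewrite /f Fx.
have Kc1 : K c1 by split; rewrite /= ?signedK.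
have stK : star c1 K.
  move=> w t [w1 w2] /andP[t0 t1]; split; last first.
    rewrite signed_ray /= signedK; move: w2; move: (signed s _) => p /andP[p0 pe].
    have h1 : 0 <= (1 - t) * e by rewrite mulr_ge0 ?subr_ge0// ltW.
    have h2 : t * p <= t * e by rewrite ler_wpM2l.
    apply/andP; split; last by lra.
    have [->|tn0] := eqVneq t 0; first by lra.
    by have : 0 < t * p by [rewrite mulr_gt0// lt_def tn0]; lra.
  have -> : complex.Re (ray c1 w t) = (1 - t) * 2^-1 + t * complex.Re w.
    by case: (w) => a b /=; ring.
  move: w1; move: (complex.Re w) => p /andP[p0 p1].
  have h1 : 0 <= (1 - t) * 2^-1 by rewrite mulr_ge0 ?subr_ge0.
  have h2 : 0 <= t * p by rewrite mulr_ge0.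
  have h3 : t * p <= t by rewrite ler_piMr.
  by apply/andP; split; lra.
have sf : section_on A B c1 x1 K f.
  split.
  - move=> w Kw r r0; have [w1 w2] := Kw; have [w20 w2e] := andP w2.
    have [||q q0 qP] := Fc (complex.Re w, signed s (complex.Im w)) _
        (fin @` [set z | normc (f w - z) < r]).
    + by apply: Qt; rewrite ?(ltW w20).
    + by rewrite fF//; apply/nbhs_finP; exists r => // z; exists z.
    exists q => // w' Kw' ww'; have [w'1 w'2] := Kw'; have [w'20 w'2e] := andP w'2.
    have [|||z zr] := qP (complex.Re w', signed s (complex.Im w')).
    + by apply: Qt; rewrite ?(ltW w'20).
    + apply: le_lt_trans ww'; have := Re_le_normc (w - w').
      by case: (w) (w') => [? ?] [? ?].
    + by apply: le_lt_trans ww'; exact: signed_lip.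
    by rewrite fF// => -[<-].
  - move=> w [w1 w2]; have [x Fx [_]] := Ff _ _ w1 w2.
    by rewrite -(strip_ptE s) /f Fx.
  - by rewrite /f /= signedK Fx1.
have sgK : section_on A B c1 x1 K g.
  split=> // [w Kw r r0|w Kw]; last by apply: gf; exact: Ks.
  have [q q0 qP] := gcont _ (Ks _ Kw) r r0; exists q => // w' Kw'.
  by apply: qP; exact: Ks.
have gfK w : K w -> g w = f w.
  move=> Kw; apply: (section_unique sA sB stK stK _ sgK sf) => //.
  exact: strip_simple Ks Kc1 x1c.
have key t : 0 <= t <= 1 -> F (t, 0) = collar s (the_section s (g (mid s))) (t, 0).
  move=> t01; rewrite /collar ltxx /=.
  have [_ lim] := boundary_limitP t (the_sectionP xm).
  apply: sphere_hausdorff => N N' FN lN'.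
  have [|r r0 rP] := Fc (t, 0) _ _ FN; first by apply: Qt; rewrite // lexx ltW.
  have [r' r'0 r'P] := lim _ lN'; have [h h0 hP] := half_disc_nonempty s t r'0.
  pose k := Num.min (Num.min h e) (r / 2).
  have he0 : 0 < Num.min h e by rewrite lt_min h0 e0.
  have k0 : 0 < k by rewrite lt_min he0 divr_gt0.
  have kh : k <= h by rewrite ge_min [Num.min h e <= h]ge_min lexx.
  have ke : k <= e by rewrite ge_min [Num.min h e <= e]ge_min lexx orbT.
  have kr : k <= r / 2 by rewrite ge_min lexx orbT.
  have k0h : 0 < k <= h by rewrite k0.
  have [sk tk] := hP k k0h; pose w := strip_pt s t k.
  have Kw : K w by split; rewrite /= ?signedK ?k0.
  exists (F (t, k)); split.
    apply: rP => /=; last by rewrite sub0r normrN gtr0_norm//; lra.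
      by apply: Qt; rewrite ?(ltW k0).
    by rewrite subrr normr0.
  have -> : F (t, k) = fin (the_section s (g (mid s)) w).
    by rewrite -gE ?gfK// -fF//= signedK.
  exact: r'P.
apply/seteqP; split=> _ [t t01 <-]; exists t => //; move: t01; rewrite /= in_itv /=.
  by move=> /key ->.
by move=> /key ->.
Qed.

(** Some point of the interval is not a branch value. *)
Hypothesis generic : exists t : R, [/\ 0 <= t <= 1, t != 0 & uniq (fib t%:C%C)].

(** Two sections with the same boundary values agree near a boundary point over
    which the map is unramified. *)
Lemma edge_inj s : {in fib (mid s) &, injective (edge s)}.
Proof.
move=> x x' xm x'm EE; have [t [t01 t0 ut]] := generic.
have sg := the_sectionP xm; have sg' := the_sectionP x'm.
set g := the_section s x in sg; set g' := the_section s x' in sg'.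
have [jl lim] := boundary_limitP t sg; have [jl' lim'] := boundary_limitP t sg'.
have ll' : boundary_limit s g t = boundary_limit s g' t.
  have : edge s x (boundary_limit s g t).
    by exists t; rewrite /= ?in_itv//= /collar /= ltxx.
  rewrite EE => -[u _]; rewrite /collar /= ltxx => lu.
  have [ju _] := boundary_limitP u sg'; move: ju; rewrite lu jl => -[tu].
  by rewrite -lu tu.
rewrite -ll' in lim'; case lE: (boundary_limit s g t) jl lim lim' => [r|]; last first.
  by rewrite -[None]/(@infty R) jj_infty => -[/esym/eqP]; rewrite (negPf t0).
rewrite -[Some r]/(fin r) => jr lim lim'.
have ft : full t%:C%C by apply: AB_full; rewrite eq_complex /= negb_and t0.
have rt : r \in fib t%:C%C by rewrite jj_fiber// jr.
have cr : count_mem r (fib t%:C%C) = 1%N by rewrite count_uniq_mem// rt.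
have [m m0 mP] := fiber_isolated sA sB ft cr.
have [|q q0 qP] := mP m; first by rewrite m0 lexx.
have nN : nbhs (fin r : P1) (fin @` [set z | normc (r - z) < m]).
  by apply/nbhs_finP; exists m => // z; exists z.
have [a a0 aP] := lim _ nN; have [a' a'0 a'P] := lim' _ nN.
have minq : 0 < Num.min q (Num.min a a') by rewrite !lt_min q0 a0.
have [h h0 hP] := half_disc_nonempty s t minq.
have [|sw] := hP h; first by rewrite h0 lexx.
set w := strip_pt s t h in sw *; rewrite !lt_min => /andP[/qP[_ [z [_ _ zP]]] /andP[wa wa']].
have [_ gf gm] := sg; have [_ gf' gm'] := sg'.
have [u um [ug]] := aP _ sw wa; have [u' u'm [u'g]] := a'P _ sw wa'.
have gg' : g' w = g w.
  have -> : g w = z by apply: zP; [exact: gf|rewrite -ug; exact: um].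
  by apply: zP; [exact: gf'|rewrite -u'g; exact: u'm].
have sgw : section_on A B w (g w) (strip s) g by case: sg.
have sgw' : section_on A B w (g w) (strip s) g' by case: sg' => h1 h2 _; split.
by rewrite -gm -gm' (strip_section_unique sw (gf _ sw) sgw sgw')//; exact: strip_mid.
Qed.

(** Passages correspond to sections over the two strips, hence to roots over
    their midpoints. *)
Lemma gon_count y : gon_of jj (fin @` connected_component X y) =
  (count (fun z => `[< connected_component X y z >]) (fib (mid false)) +
   count (fun z => `[< connected_component X y z >]) (fib (mid true)))./2.
Proof.
set a := fun z => _.
have mid_uniq s : uniq (fib (mid s)) by apply: fib_uniq; exact: strip_Im (strip_mid s).
pose side s := [seq (s, edge s x) | x <- fib (mid s) & a x].
rewrite (@gon_of_enum _ _ _ (side false ++ side true)).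
- by rewrite size_cat !size_map !size_filter.
- have us s : uniq (side s).
    rewrite map_inj_in_uniq ?filter_uniq// => x x'.
    rewrite !mem_filter => /andP[_ xm] /andP[_ x'm] [/edge_inj]; exact.
  rewrite cat_uniq !us /= andbT; apply/hasPn => -[s E] /mapP[x _ [-> _]].
  by apply/mapP => -[].
move=> [s E] /=; rewrite mem_cat; split=> [/passage_edge[x xm [Vx ->]]|].
  have xs : (s, edge s x) \in side s.
    by apply/mapP; exists x => //; rewrite mem_filter xm andbT; exact/asboolP.
  by case: s xm xs => xm ->; rewrite ?orbT.
have side_passage s' x : x \in [seq x <- fib (mid s') | a x] ->
    passage_of jj (fin @` connected_component X y) s' (edge s' x).
  rewrite mem_filter => /andP[/asboolP Vx xm]; have sg := the_sectionP xm.
  apply: (collar_passage sg) => w sw; exists (the_section s' x w) => //.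
  apply: (section_component sg (strip_mid s') sw).
  by have [_ _ ->] := sg.
by case/orP => /mapP[x xm [-> ->]]; exact: side_passage.
Qed.
End Collars.

(** * Ramification and the wronskian *)

Section Ramification.
Variable R : realType.
Variables (A B : {poly R[i]}) (n : nat).
Hypothesis sA : (size A <= n.+1)%N.
Hypothesis sB : (size B <= n.+1)%N.
Hypothesis AB_coprime : forall z, B.[z] = 0 -> A.[z] != 0.
Implicit Types (w z : R[i]).
Local Notation fib := (fiber A B).
Local Notation full := (full_degree A B n).

Definition wronskian : {poly R[i]} := A^`() * B - A * B^`().

(** All members of the pencil have the same wronskian with [B], so a multiple
    root of any of them is a root of it. *)
Lemma wronskian_pencil w :
  wronskian = (pencil A B w)^`() * B - pencil A B w * B^`().
Proof. by rewrite /wronskian /pencil derivB derivZ -!mul_polyC; ring. Qed.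

Lemma pencil_rem w z : z \in fib w ->
  pencil A B w = ('X - z%:P) * from_roots (lead_coef (pencil A B w)) (rem z (fib w)).
Proof.
by move=> zw; rewrite {1}pencilE (from_roots_perm _ (perm_to_rem zw)) from_roots_cons.
Qed.

Lemma count_rem1 w z : z \in fib w ->
  count_mem z (fib w) = (count_mem z (rem z (fib w))).+1.
Proof. by move=> zw; have /permP -> := perm_to_rem zw; rewrite /= eqxx. Qed.

Lemma ramified_root w z : full w -> (2 <= count_mem z (fib w))%N -> root wronskian z.
Proof.
move=> fw c2; have zw : z \in fib w by rewrite -has_pred1 has_count (leq_trans _ c2).
rewrite (wronskian_pencil w) (pencil_rem zw); set q := from_roots _ _.
have qz : root q z.
  rewrite rootZ ?lead_coef_eq0 ?root_prod_XsubC.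
    by rewrite -has_pred1 has_count -ltnS -count_rem1.
  by rewrite -size_poly_gt0 (size_pencil sA sB fw).
clearbody q; rewrite rootE derivM derivXsubC !hornerE (eqP qz); apply/eqP; ring.
Qed.

Lemma ramified2_dvd w z : (3 <= count_mem z (fib w))%N ->
  (('X - z%:P) ^+ 2 %| wronskian)%R.
Proof.
move=> c3; have zw : z \in fib w by rewrite -has_pred1 has_count (leq_trans _ c3).
rewrite count_rem1// ltnS in c3; have pe := perm_to_rem zw.
set rs := rem z (fib w) in c3 pe.
have zrs : z \in rs by rewrite -has_pred1 has_count (leq_trans _ c3).
have pe' := perm_to_rem zrs; set ss := rem z rs in pe'.
have zss : z \in ss.
  by move/permP/(_ (pred1 z)): pe'; rewrite /= eqxx -has_pred1 has_count => e; move: c3; rewrite e.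
rewrite (wronskian_pencil w) {1 2}pencilE (from_roots_perm _ pe) from_roots_cons.
rewrite (from_roots_perm _ pe') from_roots_cons (from_roots_perm _ (perm_to_rem zss)).
rewrite from_roots_cons; set q := from_roots _ _; set X := 'X - z%:P.
rewrite !derivM derivXsubC.
rewrite (_ : _ - _ = (3%:R * q * B + X * (q^`() * B - q * B^`())) * X ^+ 2); last by ring.
exact: dvdp_mull.
Qed.

Lemma root_ramified z : root wronskian z -> B.[z] != 0 -> full (quot A B z) ->
  (2 <= count_mem z (fib (quot A B z)))%N.
Proof.
move=> Wz Bz fw; have zw : z \in fib (quot A B z).
  by rewrite (mem_fiber_quot sA sB AB_coprime)// Bz eqxx.
rewrite count_rem1// ltnS -has_count has_pred1.
move: Wz; rewrite (wronskian_pencil (quot A B z)) (pencil_rem zw).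
set rs := rem z _; set a := lead_coef _; set q := from_roots a rs.
have : root q z -> z \in rs.
  rewrite rootZ ?root_prod_XsubC//.
  by rewrite lead_coef_eq0 -size_poly_gt0 (size_pencil sA sB fw).
clearbody q => qrs; rewrite rootE derivM derivXsubC !hornerE.
rewrite (_ : _ - _ = q.[z] * B.[z]); last by ring.
by rewrite mulf_eq0 (negPf Bz) orbF => /qrs.
Qed.

Lemma unramified_simple w z : full w -> z \in fib w -> ~~ root wronskian z ->
  count_mem z (fib w) = 1%N.
Proof.
move=> fw zw Wz; apply/eqP; rewrite eqn_leq -has_count has_pred1 zw andbT leqNgt.
by apply: contra Wz; exact: ramified_root.
Qed.

Lemma unramified_uniq w : full w -> (forall z, z \in fib w -> ~~ root wronskian z) ->
  uniq (fib w).
Proof.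
move=> fw h; apply/count_mem_uniq => z; case: (boolP (z \in fib w)) => zw.
  exact: unramified_simple (h z zw).
by apply/count_memPn.
Qed.

(** Otherwise each of [A], [B] would divide its own derivative. *)
Lemma wronskian_neq0 : (1 < size A)%N || (1 < size B)%N -> wronskian != 0.
Proof.
have cop : coprimep B A.
  by apply: Pdiv.ClosedField.root_coprimep => z /rootP; exact: AB_coprime.
have main (p q : {poly R[i]}) : coprimep p q -> (1 < size p)%N -> p^`() * q != p * q^`().
  move=> cpq p1; apply/eqP => e.
  have : p %| p^`() by rewrite -(Gauss_dvdpr _ cpq) mulrC e dvdp_mulr.
  have p0 : p != 0 by rewrite -size_poly_gt0 (ltn_trans _ p1).
  have p'0 : p^`() != 0.
    apply/eqP => p'0; have : p^`()`_(size p).-2 = 0 by rewrite p'0 coef0.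
    rewrite coef_deriv; move: p1 (p0); rewrite -lead_coef_eq0 lead_coefE.
    case: (size p) => [|[|k]] //= _ pk /eqP.
    by rewrite -mulr_natr mulf_eq0 (negPf pk) pnatr_eq0.
  by move/(dvdp_leq p'0); rewrite leqNgt lt_size_deriv.
rewrite /wronskian => /orP[A1|B1]; rewrite subr_eq0.
  by apply: main; rewrite // coprimep_sym.
by rewrite eq_sym [A * _]mulrC [_ * B]mulrC; exact: main.
Qed.

(** The branch values are the images of the roots of the wronskian. *)
Lemma branch_values : (1 < size A)%N || (1 < size B)%N ->
  exists s : seq R[i], forall w, full w -> w \notin s -> uniq (fib w).
Proof.
move=> s1; have W0 := wronskian_neq0 s1.
have [rs WE] := closed_field_poly_normal wronskian.
exists (map (quot A B) rs) => w fw ws; apply: unramified_uniq => // z zw.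
apply: contra ws => Wz; apply/mapP; exists z; last first.
  by move: zw; rewrite (mem_fiber_quot sA sB AB_coprime)// => /andP[_ /eqP].
by rewrite -root_prod_XsubC -(@rootZ _ _ (lead_coef wronskian)) ?lead_coef_eq0// -WE.
Qed.

End Ramification.

(** * The three sectors *)

Section Sectors.
Variable R : realType.
Notation C := (R[i] : numFieldType).
Implicit Types (u v w : R[i]) (k : nat).

Let r3 : R := Num.sqrt 3.

Lemma r3_gt0 : 0 < r3. Proof. by rewrite sqrtr_gt0. Qed.
Lemma r3_sqr : r3 ^+ 2 = 3. Proof. by rewrite sqr_sqrtr. Qed.

Definition omega : R[i] := (- (1 / 2) +i* (Num.sqrt 3 / 2))%C.

Lemma omega_sqr : omega ^+ 2 = -1 - omega.
Proof.
have h := r3_sqr; rewrite /omega -/r3 expr2; simpc.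
by apply/eqP; rewrite eq_complex /=; apply/andP; split; apply/eqP; lra.
Qed.

(** The three sectors between the rays from [0] on which the cube is real and
    nonpositive; sector [k] is bisected by [omega ^ k]. *)
Definition sector k : set C := [set v | match k with
  | 0 => - (Num.sqrt 3 * complex.Re v) < complex.Im v < Num.sqrt 3 * complex.Re v
  | 1 => (0 < complex.Im v) && (Num.sqrt 3 * complex.Re v < complex.Im v)
  | _ => (complex.Im v < 0) && (complex.Im v < - (Num.sqrt 3 * complex.Re v))
  end].

Definition neg_real u := complex.Im u = 0 /\ complex.Re u <= 0.

Lemma convex_lt (p q t : R) : 0 < p -> 0 < q -> 0 <= t <= 1 -> 0 < (1 - t) * p + t * q.
Proof.
move=> p0 q0 /andP[t0 t1]; have [->|tn0] := eqVneq t 0; first by lra.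
by rewrite ltr_wpDl ?mulr_ge0 ?subr_ge0 ?(ltW p0)// mulr_gt0// lt_def tn0.
Qed.

Lemma sector_convex k : convexC (sector k).
Proof.
move=> [a b] [a' b'] t; case: k => [|[|k]] /= /andP[h1 h2] /andP[h3 h4] t01.
- have := @convex_lt (b + r3 * a) (b' + r3 * a') t _ _ t01.
  have := @convex_lt (r3 * a - b) (r3 * a' - b') t _ _ t01.
  rewrite /r3 => H1 H2; apply/andP; split.
    by have : 0 < (1 - t) * (b + Num.sqrt 3 * a) + t * (b' + Num.sqrt 3 * a') by [apply: H2; lra]; lra.
  by have : 0 < (1 - t) * (Num.sqrt 3 * a - b) + t * (Num.sqrt 3 * a' - b') by [apply: H1; lra]; lra.
- have := @convex_lt b b' t _ _ t01; have := @convex_lt (b - r3 * a) (b' - r3 * a') t _ _ t01.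
  rewrite /r3 => H1 H2; apply/andP; split.
    by have : 0 < (1 - t) * b + t * b' by [apply: H2; lra]; lra.
  by have : 0 < (1 - t) * (b - Num.sqrt 3 * a) + t * (b' - Num.sqrt 3 * a') by [apply: H1; lra]; lra.
have := @convex_lt (- b) (- b') t _ _ t01; have := @convex_lt (- b - r3 * a) (- b' - r3 * a') t _ _ t01.
rewrite /r3 => H1 H2; apply/andP; split.
  by have : 0 < (1 - t) * (- b) + t * (- b') by [apply: H2; lra]; lra.
by have : 0 < (1 - t) * (- b - Num.sqrt 3 * a) + t * (- b' - Num.sqrt 3 * a') by [apply: H1; lra]; lra.
Qed.

Lemma half_plane_open (p q : R) : open [set v : C | 0 < p * complex.Re v + q * complex.Im v].
Proof.
apply/open_normcP => v /= v0; exists ((p * complex.Re v + q * complex.Im v) / (`|p| + `|q| + 1)).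
  by rewrite divr_gt0// ltr_wpDl ?addr_ge0.
have D0 : 0 < `|p| + `|q| + 1 by rewrite ltr_wpDl ?addr_ge0.
move=> w; rewrite ltr_pdivlMr// => h.
have hR := Re_le_normc (v - w); have hI := Im_le_normc (v - w).
have e : p * complex.Re w + q * complex.Im w = (p * complex.Re v + q * complex.Im v)
   - (p * complex.Re (v - w) + q * complex.Im (v - w)).
  by case: (v) (w) => [? ?] [? ?] /=; ring.
have h1 : p * complex.Re (v - w) <= `|p| * normc (v - w).
  by rewrite (le_trans (ler_norm _))// normrM ler_wpM2l.
have h2 : q * complex.Im (v - w) <= `|q| * normc (v - w).
  by rewrite (le_trans (ler_norm _))// normrM ler_wpM2l.
have := normc_ge0 (v - w); rewrite e; lra.
Qed.

Lemma sector_open k : open (sector k).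
Proof.
have E p q p' q' : [set v : C | 0 < p * complex.Re v + q * complex.Im v] `&`
    [set v : C | 0 < p' * complex.Re v + q' * complex.Im v] = sector k -> open (sector k).
  by move=> <-; apply: openI; exact: half_plane_open.
case: k E => [|[|k]] E.
- apply: (E r3 1 r3 (-1)); apply/seteqP; split=> v /=.
    by move=> [h1 h2]; apply/andP; split; move: h1 h2; rewrite /r3; lra.
  by move=> /andP[h1 h2]; split; move: h1 h2; rewrite /r3; lra.
- apply: (E 0 1 (- r3) 1); apply/seteqP; split=> v /=.
    by move=> [h1 h2]; apply/andP; split; move: h1 h2; rewrite /r3; lra.
  by move=> /andP[h1 h2]; split; move: h1 h2; rewrite /r3; lra.
apply: (E 0 (-1) (- r3) (-1)); apply/seteqP; split=> v /=.
  by move=> [h1 h2]; apply/andP; split; move: h1 h2; rewrite /r3; lra.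
by move=> /andP[h1 h2]; split; move: h1 h2; rewrite /r3; lra.
Qed.

Lemma sector_disjoint k l v : (k < 3)%N -> (l < 3)%N -> sector k v -> sector l v -> k = l.
Proof.
case: k l => [|[|[|k]]] [|[|[|l]]] //= _ _ /andP[h1 h2] /andP[h3 h4]; exfalso; move: h1 h2 h3 h4.
all: by move=> h1 h2 h3 h4; have : (0 : R) < 0 by [lra]; rewrite ltxx.
Qed.

Lemma sector_omega k v : (k < 3)%N -> sector k v -> sector (k.+1 %% 3) (omega * v).
Proof.
have h := r3_sqr; have h0 := r3_gt0.
case: v => a b; case: k => [|[|[|k]]] //= _ /andP[h1 h2]; rewrite /omega -/r3.
all: move: h1 h2; rewrite -/r3 => h1 h2; apply/andP.
all: have e : r3 * (r3 / 2 * b) = 3 / 2 * b by rewrite -h; ring.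
all: split; lra.
Qed.

Lemma cubeE v : v ^+ 3 = (complex.Re v * (complex.Re v ^+ 2 - 3 * complex.Im v ^+ 2)
  +i* (complex.Im v * (3 * complex.Re v ^+ 2 - complex.Im v ^+ 2)))%C.
Proof.
case: v => a b; rewrite exprS expr2 /=; simpc.
by apply/eqP; rewrite eq_complex /=; apply/andP; split; apply/eqP; ring.
Qed.

(** The imaginary part of the cube of [a + ib] is
    [b (sqrt 3 a - b) (sqrt 3 a + b)], which vanishes on the lines that carry the
    boundary rays; the real part then has to be positive inside a sector. *)
Lemma sector_cube k v : sector k v -> ~ neg_real (v ^+ 3).
Proof.
have h := r3_sqr; have h0 := r3_gt0.
rewrite cubeE /neg_real /=; case: v => a b /= + [/eqP]; rewrite mulf_eq0.
have -> : 3 * a ^+ 2 - b ^+ 2 = (r3 * a - b) * (r3 * a + b) by rewrite -h; ring.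
rewrite mulf_eq0 => + H1 H2.
have HH : b = 0 \/ b = r3 * a \/ b = - (r3 * a).
  case/or3P: H1 => /eqP e; [by left|by right; left; lra|by right; right; lra].
have key : a ^+ 2 * 3 = (r3 * a) ^+ 2 by rewrite exprMn h; ring.
case: k => [|[|k]] /andP[] /=; rewrite -/r3 => h1 h2.
- have ra : 0 < r3 * a by lra.
  have a0 : 0 < a by rewrite pmulr_rgt0 in ra.
  case: HH => [b0|[]]; [|by lra|by lra].
  move: H2; rewrite b0 expr0n /= mulr0 subr0 -exprS => H2.
  by have := exprn_gt0 3 a0; lra.
- case: HH => [|[]]; [by lra|by lra|] => bE; have ra : 0 < r3 * - a by lra.
  have a0 : 0 < - a by rewrite pmulr_rgt0 in ra.
  move: H2; rewrite bE sqrrN exprMn h (_ : a * _ = 8 * (- a) ^+ 3); last by ring.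
  by have := exprn_gt0 3 a0; lra.
case: HH => [|[]]; [by lra| |by lra] => bE; have ra : 0 < r3 * - a by lra.
have a0 : 0 < - a by rewrite pmulr_rgt0 in ra.
move: H2; rewrite bE exprMn h (_ : a * _ = 8 * (- a) ^+ 3); last by ring.
by have := exprn_gt0 3 a0; lra.
Qed.

Lemma cube_sector v : ~ neg_real (v ^+ 3) -> exists2 k, (k < 3)%N & sector k v.
Proof.
have h := r3_sqr; have h0 := r3_gt0.
move=> nv; apply: contrapT => ns; apply: nv; rewrite cubeE /neg_real /=.
case: v ns => a b /= ns.
have n0 : ~~ (- (r3 * a) < b < r3 * a) by apply/negP => s; apply: ns; exists 0%N.
have n1 : ~~ ((0 < b) && (r3 * a < b)) by apply/negP => s; apply: ns; exists 1%N.
have n2 : ~~ ((b < 0) && (b < - (r3 * a))) by apply/negP => s; apply: ns; exists 2%N.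
have fin_case : b ^+ 2 = 3 * a ^+ 2 -> 0 <= a ->
    b * (3 * a ^+ 2 - b ^+ 2) = 0 /\ a * (a ^+ 2 - 3 * b ^+ 2) <= 0.
  move=> e a0; rewrite e subrr mulr0; split=> //.
  rewrite (_ : a * _ = - (8 * a ^+ 3)); last by ring.
  by rewrite oppr_le0 mulr_ge0 ?exprn_ge0.
have [b0|b0|b0] := ltrgtP b 0.
- move: n2; rewrite b0 /= -leNgt => h1; move: n0; rewrite negb_and -!leNgt => /orP[h2|]; last by lra.
  have bE : b = - (r3 * a) by lra.
  by apply: fin_case; [rewrite bE sqrrN exprMn h; ring|rewrite -(pmulr_rge0 _ h0); lra].
- move: n1; rewrite b0 /= -leNgt => h1; move: n0; rewrite negb_and -!leNgt => /orP[|h2]; first by lra.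
  have bE : b = r3 * a by lra.
  by apply: fin_case; [rewrite bE exprMn h; ring|rewrite -(pmulr_rge0 _ h0); lra].
move: n0; rewrite b0 negb_and -!leNgt => n0.
have ra : r3 * a <= 0 by case/orP: n0; lra.
have a0 : a <= 0 by rewrite -(pmulr_rle0 _ h0).
rewrite mul0r; split=> //; rewrite expr0n /= mulr0 subr0.
by rewrite mulr_le0_ge0// sqr_ge0.
Qed.

Lemma omega_cube : omega ^+ 3 = 1. Proof. by have h := omega_sqr; ring: h. Qed.

Lemma sector_omegaX k m v : (k < 3)%N -> sector k v -> sector ((k + m) %% 3) (omega ^+ m * v).
Proof.
move=> k3 kv; elim: m => [|m IH]; first by rewrite addn0 modn_small// expr0 mul1r.
have := sector_omega (ltn_pmod _ (isT : 0 < 3)%N) IH.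
by rewrite exprS mulrA addnS -[((k + m) %% 3).+1]addn1 modnDml addn1.
Qed.

Lemma sector_cube_root k u : (k < 3)%N -> ~ neg_real u ->
  exists2 v, sector k v & v ^+ 3 = u.
Proof.
move=> k3 nu; have [v /rootP] : exists v, root ('X^3 - u%:P) v.
  by apply/closed_rootP; rewrite size_XnsubC.
rewrite !hornerE => /eqP; rewrite subr_eq0 => /eqP vu.
have [l l3 lv] : exists2 l, (l < 3)%N & sector l v by apply: cube_sector; rewrite vu.
exists (omega ^+ (k + (3 - l)) * v).
  have := sector_omegaX (k + (3 - l)) l3 lv.
  by rewrite addnCA subnKC ?(ltnW l3)// modnDr modn_small.
by rewrite exprMn vu -exprM mulnC exprM omega_cube expr1n mul1r.
Qed.

End Sectors.

(** * The j-invariant as a function of a cube *)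

Section Koebe.
Variable R : realType.
Implicit Types (a b u v w s : R[i]) (t : R).

Definition jval a b : P1 R := frac_pt (-4 * a ^+ 3 * b ^+ 3) ((a ^+ 3 - b ^+ 3) ^+ 2).

Lemma frac_pt_scale (k a b : R[i]) : k != 0 -> frac_pt (k * a) (k * b) = frac_pt a b.
Proof.
move=> k0; rewrite /frac_pt mulf_eq0 (negPf k0) /=.
by case: eqP => // _; rewrite invfM mulrACA divff// mul1r.
Qed.

(** For [u = a + ib] with [b <> 0] the imaginary part of the equation gives
    [t (1 - a) = 2], and then the real part gives [(t b)^2 = 4 (t - 1) <= 0]. *)
Lemma koebe_neg t u : 0 <= t <= 1 -> t%:C%C * (1 - u) ^+ 2 + 4 * u = 0 -> neg_real u.
Proof.
move=> /andP[t0 t1]; case: u => a b /eqP.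
have -> : (t%:C%C * (1 - (a +i* b)%C) ^+ 2 + 4 * (a +i* b)%C : R[i]) =
    ((t * ((1 - a) ^+ 2 - b ^+ 2) + 4 * a) +i* (- 2 * t * (1 - a) * b + 4 * b))%C.
  have -> : (4 : R[i]) = (4 : R)%:C%C by rewrite rmorph_nat.
  rewrite expr2 -[1](rmorph1 (real_complex R)) /=; simpc.
  by apply/eqP; rewrite eq_complex /=; apply/andP; split; apply/eqP; ring.
rewrite eq_complex /= => /andP[/eqP e1 /eqP e2].
have b0 : b = 0.
  apply/eqP; apply: contraTT isT => b0; exfalso.
  have e3 : t * (1 - a) = 2.
    by apply: (mulIf b0); rewrite -[LHS]mulrA; move: e2; lra.
  have tp : 0 < t by rewrite lt_def t0 andbT; apply/eqP => tz; move: e3; rewrite tz mul0r; lra.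
  have e4 : t * (t * ((1 - a) ^+ 2 - b ^+ 2) + 4 * a) = 4 + t * 4 - 8 - (t * b) ^+ 2.
    rewrite (_ : t * _ = (t * (1 - a)) ^+ 2 - (t * b) ^+ 2 + 4 * t - 4 * (t * (1 - a))); last by ring.
    by rewrite e3; ring.
  have : 0 < (t * b) ^+ 2 by rewrite exprn_even_gt0//= mulf_neq0// gt_eqF.
  by move: e4; rewrite e1 mulr0; lra.
split=> //=; rewrite b0 in e1; rewrite leNgt; apply/negP => a0.
have : 0 <= t * ((1 - a) ^+ 2 - 0 ^+ 2) by rewrite expr0n subr0 mulr_ge0// sqr_ge0.
by lra.
Qed.

Lemma neg_koebe u : neg_real u -> exists2 t, 0 <= t <= 1 &
  t%:C%C * (1 - u) ^+ 2 + 4 * u = 0 /\ 1 - u != 0.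
Proof.
case: u => a b [/= -> a0]; rewrite complexr0.
have a1 : 0 < (1 - a) ^+ 2 by rewrite exprn_gt0//; lra.
exists (- 4 * a / (1 - a) ^+ 2).
  rewrite divr_ge0 ?(ltW a1)//=; last by lra.
  rewrite ler_pdivrMr// mul1r (_ : (1 - a) ^+ 2 = (1 + a) ^+ 2 - 4 * a); last by ring.
  by have := sqr_ge0 (1 + a); lra.
have e1 : 1 - a%:C%C = (1 - a)%:C%C :> R[i] by rewrite rmorphB rmorph1.
split; last by rewrite e1 eq_complex /= negb_and gt_eqF//; lra.
rewrite e1 -rmorphXn -rmorphM /= mulfVK ?gt_eqF//.
have -> : (4 : R[i]) = (4 : R)%:C%C by rewrite rmorph_nat.
by rewrite -[X in _ + X]rmorphM -rmorphD mulNr addNr rmorph0.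
Qed.

Lemma jval_quot a b : b != 0 ->
  jval a b = frac_pt (-4 * (a / b) ^+ 3) ((1 - (a / b) ^+ 3) ^+ 2).
Proof.
move=> b0; rewrite /jval -(@frac_pt_scale (b ^+ 6) (-4 * _)) ?expf_neq0//.
by congr frac_pt; field.
Qed.

(** On the sphere, [-4u/(1-u)^2] takes a value in [[0, 1]] at [u] exactly when
    [u] is infinite or a nonpositive real number. *)
Lemma jval_graph a b : a != 0 \/ b != 0 ->
  [set fin t%:C%C | t in `[0 : R, 1]] (jval a b) <-> b = 0 \/ neg_real ((a / b) ^+ 3).
Proof.
move=> ab; have [b0|b0] := eqVneq b 0.
  have a0 : a != 0 by case: ab; rewrite ?b0 ?eqxx.
  split=> _; [by left|exists 0; first by rewrite /= in_itv /= lexx ler01].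
  rewrite /jval b0 [0 ^+ 3]expr0n /= mulr0 subr0 /frac_pt !expf_eq0 /= (negPf a0).
  by rewrite mul0r.
rewrite jval_quot//; set u := (a / b) ^+ 3; split.
  move=> [t /= + ]; rewrite in_itv /= => t01; rewrite /frac_pt; case: eqVneq => // u1 [e].
  by right; apply: (koebe_neg t01); rewrite e mulfVK//; ring.
move=> [/eqP|/neg_koebe[t t01 [e u1]]]; first by rewrite (negPf b0).
exists t; rewrite /= ?in_itv//= /frac_pt expf_eq0 /= (negPf u1).
congr fin; apply: (mulIf (expf_neq0 2 u1)); rewrite mulfVK ?expf_neq0//.
by apply/eqP; rewrite -subr_eq0 -e; apply/eqP; ring.
Qed.

(** With [s^2 = 1 - w], the two solutions of [-4u/(1-u)^2 = w] are
    [(s - 1)/(s + 1)] and its inverse. *)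
Lemma koebe_split w : complex.Im w != 0 -> exists u1 u2 : R[i],
  [/\ ~ neg_real u1, ~ neg_real u2 & forall a b,
   -4 * a * b - w * (a - b) ^+ 2 = - w * ((a - u1 * b) * (a - u2 * b))].
Proof.
move=> w0; have [s /rootP] : exists s, root ('X^2 - (1 - w)%:P) s.
  by apply/closed_rootP; rewrite size_XnsubC.
rewrite !hornerE => /eqP; rewrite subr_eq0 => /eqP sw.
have wn0 : w != 0 by apply: contra_neq w0 => ->.
have wE : w = 1 - s ^+ 2 by rewrite sw; ring.
have s1 : s - 1 != 0.
  apply: contra_neq wn0 => s1; have e : s = 1 by apply/eqP; rewrite -subr_eq0 s1.
  by rewrite wE e expr1n subrr.
have s2 : s + 1 != 0.
  apply: contra_neq wn0 => s2; have e : s = -1 by apply/eqP; rewrite -addr_eq0 s2.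
  by rewrite wE e sqrrN expr1n subrr.
exists ((s - 1) / (s + 1)), ((s + 1) / (s - 1)).
have nw u : w * (1 - u) ^+ 2 + 4 * u = 0 -> ~ neg_real u.
  move=> e /neg_koebe[t _ [e' u1]]; move/eqP: w0; apply.
  have -> : w = t%:C%C; last by [].
  apply: (mulIf (expf_neq0 2 u1)); apply: (addIr (4 * u)).
  by rewrite e e'.
split; last by move=> a b; rewrite wE; field; rewrite s1 s2.
- by apply: nw; rewrite wE; field.
- by apply: nw; rewrite wE; field.
Qed.

End Koebe.

Lemma horner_pencil (R : realType) (A B : {poly R[i]}) w z :
  (pencil A B w).[z] = A.[z] - w * B.[z].
Proof. by rewrite /pencil hornerD hornerN hornerZ. Qed.

(** * Gons from degrees *)

Section Pair.
Variable R : realType.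
Notation C := (R[i] : numFieldType).
Notation P1 := (P1 R).
Variables P Q : {poly R[i]}.
Hypothesis sP : size P = 4%N.
Hypothesis sQ : (size Q <= 3)%N.
Hypothesis PQ_coprime : forall z, Q.[z] = 0 -> P.[z] != 0.
Implicit Types (z w v u : R[i]) (k : nat).

(** At infinity both polynomials are read as forms of degree 3. *)
Definition jmap (x : P1) : P1 :=
  if x is Some z then jval P.[z] Q.[z] else jval P`_3 Q`_3.

Definition jnum : {poly R[i]} := -4%:R *: (P ^+ 3 * Q ^+ 3).
Definition jden : {poly R[i]} := (P ^+ 3 - Q ^+ 3) ^+ 2.

Let P3 : P`_3 != 0.
Proof. by have := lead_coef_eq0 P; rewrite lead_coefE sP /= -size_poly_eq0 sP => ->. Qed.

Let Q3 : Q`_3 = 0. Proof. by rewrite nth_default. Qed.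

Let sP' : (size P <= 3.+1)%N. Proof. by rewrite sP. Qed.
Let sQ' : (size Q <= 3.+1)%N. Proof. exact: leqW. Qed.

Lemma full_PQ w : full_degree P Q 3 w.
Proof. by rewrite /full_degree coef_pencil Q3 mulr0 subr0. Qed.

Lemma Q_neq0 : Q != 0.
Proof.
apply/eqP => Q0; have [z Pz] : exists z, root P z by apply/closed_rootP; rewrite sP.
by have := PQ_coprime (z := z); rewrite Q0 horner0 (eqP Pz) eqxx => /(_ erefl).
Qed.

Lemma size_P3 : size (P ^+ 3) = 10%N.
Proof. by have := size_exp P 3; rewrite sP; case: (size _) => //= n ->. Qed.

Lemma size_Q3 : (size (Q ^+ 3) <= 7)%N.
Proof.
have := size_exp Q 3; case: (size (Q ^+ 3)) => //= n ->.
by move: sQ; case: (size Q) => [|[|[|[|]]]].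
Qed.

Lemma size_jden : size jden = 19%N.
Proof.
have s : size (P ^+ 3 - Q ^+ 3) = 10%N.
  have lt : (size (- Q ^+ 3) < size (P ^+ 3)%R)%N.
    by rewrite size_polyN size_P3 (leq_ltn_trans size_Q3).
  by rewrite (size_polyDl lt) size_P3.
by have := size_exp (P ^+ 3 - Q ^+ 3) 2; rewrite s /jden; case: (size _) => //= n ->.
Qed.

Lemma size_jnum : (size jnum <= 16)%N.
Proof.
apply: leq_trans (size_scale_leq _ _) _; apply: leq_trans (size_polyMleq _ _) _.
by rewrite size_P3 /= (leq_trans (_ : _ <= 9 + 7)%N)// leq_add2l size_Q3.
Qed.

Lemma jnum_neq0 : jnum != 0.
Proof.
rewrite scaler_eq0 negb_or oppr_eq0 pnatr_eq0 /= mulf_neq0 ?expf_neq0 ?Q_neq0//.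
by rewrite -size_poly_gt0 sP.
Qed.

Lemma jnumE z : jnum.[z] = -4 * P.[z] ^+ 3 * Q.[z] ^+ 3.
Proof. by rewrite /jnum hornerZ hornerM !horner_exp mulrA. Qed.

Lemma jdenE z : jden.[z] = (P.[z] ^+ 3 - Q.[z] ^+ 3) ^+ 2.
Proof. by rewrite /jden horner_exp hornerD hornerN !horner_exp. Qed.

Lemma jnum_jden_coprime z : jden.[z] = 0 -> jnum.[z] != 0.
Proof.
rewrite jdenE jnumE => /eqP; rewrite expf_eq0 /= subr_eq0 => /eqP e.
rewrite e -mulrA -exprD mulf_eq0 expf_eq0 /= oppr_eq0 pnatr_eq0 /=.
apply/eqP => Qz; have P0 : P.[z] ^+ 3 = 0 by rewrite e Qz expr0n.
by move/eqP: P0; rewrite expf_eq0 /= (negPf (PQ_coprime Qz)).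
Qed.

Lemma jfull w : w != 0 -> full_degree jnum jden 18 w.
Proof.
move=> w0; rewrite /full_degree coef_pencil nth_default; last first.
  by apply: leq_trans size_jnum _.
rewrite sub0r oppr_eq0 mulf_neq0//.
have : lead_coef jden != 0 by rewrite lead_coef_eq0 -size_poly_gt0 size_jden.
by rewrite lead_coefE size_jden.
Qed.

Lemma jmap_fin z : jmap (fin z) = frac_pt jnum.[z] jden.[z].
Proof. by rewrite /= /jval jnumE jdenE. Qed.

Lemma jmap_infty : jmap infty = fin 0.
Proof.
rewrite /= Q3 /jval [0 ^+ 3]expr0n /= mulr0 subr0 /frac_pt !expf_eq0 /= (negPf P3).
by rewrite mul0r.
Qed.

Let snum : (size jnum <= 19)%N. Proof. exact: leq_trans size_jnum _. Qed.
Let sden : (size jden <= 19)%N. Proof. by rewrite size_jden. Qed.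

Definition part_of k : set C := quot_preim P Q (@sector R k).
Definition offgraph : set C := [set z | exists2 k, (k < 3)%N & part_of k z].

Lemma offgraphE : ~` graph_of jmap = fin @` offgraph.
Proof.
have ng z : graph_of jmap (fin z) <-> ~ offgraph z.
  have ab : P.[z] != 0 \/ Q.[z] != 0.
    by case: (eqVneq Q.[z] 0) => [/PQ_coprime|]; [left|right].
  split=> [/(jval_graph ab)[Qz|nz] [k k3 [Qz0 kz]]|nz].
  - by rewrite Qz eqxx in Qz0.
  - exact: sector_cube kz nz.
  apply/(jval_graph ab); have [Qz|Qz] := eqVneq Q.[z] 0; [by left|right].
  by apply: contrapT => /cube_sector[k k3 kz]; apply: nz; exists k.
apply/seteqP; split=> [[z|] /= gx|_ [z zX <-] /ng//].
  by exists z => //; apply: contrapT => nz; apply: gx; apply/ng.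
exfalso; apply: gx; exists 0; first by rewrite /= in_itv /= lexx ler01.
exact: esym jmap_infty.
Qed.

Lemma part_open k : open (part_of k).
Proof. by apply: preim_open; exact: sector_open. Qed.

Lemma part_disjoint k l z : (k < 3)%N -> (l < 3)%N -> part_of k z -> part_of l z -> k = l.
Proof. by move=> k3 l3 [_ kz] [_ lz]; exact: sector_disjoint kz lz. Qed.

Lemma offgraph_open : open offgraph.
Proof.
rewrite (_ : offgraph = \bigcup_(k in `I_3) part_of k).
  by apply: bigcup_open => k _; exact: part_open.
by apply/seteqP; split=> z [k k3 kz]; exists k.
Qed.

Lemma component_part k z : (k < 3)%N -> part_of k z ->
  connected_component offgraph z = connected_component (part_of k) z.
Proof.
move=> k3 kz; apply/seteqP; split=> y zy; last first.
  apply: (connected_component_max _ _ (@component_connected _ (part_of k) z)) => //.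
    exact: connected_component_refl.
  by move=> x /connected_component_sub kx; exists k.
have cV := @component_connected _ offgraph z.
have zz : connected_component offgraph z z by apply: connected_component_refl; exists k.
apply: (connected_component_max _ _ cV) => // x zx.
apply: (@connected_invariant _ _ (part_of k) cV _ z x zz zx kz) => t /connected_component_sub.
move=> [l l3 lt]; have nt : nbhs t (part_of l) by apply: open_nbhs_nbhs; split=> //; exact: part_open.
apply: filterS nt => s ls _.
by split=> h; [rewrite -(part_disjoint l3 k3 ls h)|rewrite -(part_disjoint l3 k3 lt h)].
Qed.

Lemma offgraph_strip z : jden.[z] != 0 -> complex.Im (quot jnum jden z) != 0 -> offgraph z.
Proof.
move=> dz iz; have : (~` graph_of jmap) (fin z).
  move=> [t _]; rewrite jmap_fin /frac_pt (negPf dz) => -[e].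
  by move: iz; rewrite /quot -e eqxx.
by rewrite offgraphE => -[y yX [<-]].
Qed.

Lemma from_rootsM (a b : R[i]) rs ss :
  from_roots a rs * from_roots b ss = from_roots (a * b) (rs ++ ss).
Proof. by rewrite /from_roots big_cat /= -!mul_polyC polyCM; ring. Qed.

Lemma from_roots_inj (a b : R[i]) rs ss : a != 0 -> size rs = size ss ->
  from_roots a rs = from_roots b ss -> perm_eq rs ss.
Proof.
move=> a0 srs e; have ab : a = b by rewrite -(lead_from_roots a rs) e srs lead_from_roots.
by apply: prod_XsubC_eq; apply: (scalerI a0); rewrite -/(from_roots a rs) e ab.
Qed.

Lemma cube_pencil v : P ^+ 3 - v ^+ 3 *: Q ^+ 3 =
  pencil P Q v * (pencil P Q (omega R * v) * pencil P Q (omega R ^+ 2 * v)).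
Proof.
have h : (omega R)%:P ^+ 2 = -1 - (omega R)%:P by rewrite -polyC_exp omega_sqr polyCB polyCN.
rewrite /pencil -!mul_polyC (polyC_exp 3 v) (polyCM (omega R) v) (polyCM (omega R ^+ 2) v).
by rewrite (polyC_exp 2 (omega R)); ring: h.
Qed.

Definition cube_fiber v := fiber P Q v ++ (fiber P Q (omega R * v) ++ fiber P Q (omega R ^+ 2 * v)).

Lemma cube_pencilE v : exists2 a, P ^+ 3 - v ^+ 3 *: Q ^+ 3 = from_roots a (cube_fiber v) &
  size (cube_fiber v) = 9%N.
Proof.
rewrite cube_pencil (pencilE P Q v) (pencilE P Q (omega R * v)) (pencilE P Q (omega R ^+ 2 * v)).
rewrite !from_rootsM; eexists; first reflexivity.
by rewrite !size_cat !(size_fiber sP' sQ' (full_PQ _)).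
Qed.

(** The 18 points over [w] lie over six points of the plane, the cube roots of
    the two solutions [u]. *)
Lemma jfiber_split k w : (k < 3)%N -> complex.Im w != 0 -> exists v1 v2,
  [/\ @sector R k v1, @sector R k v2 &
      perm_eq (fiber jnum jden w) (cube_fiber v1 ++ cube_fiber v2)].
Proof.
move=> k3 w0; have [u1 [u2 [n1 n2 e]]] := koebe_split w0.
have [v1 kv1 vu1] := sector_cube_root k3 n1; have [v2 kv2 vu2] := sector_cube_root k3 n2.
exists v1, v2; split=> //.
have wn0 : w != 0 by apply: contra_neq w0 => ->.
have [a1 E1 s1] := cube_pencilE v1; have [a2 E2 s2] := cube_pencilE v2.
have pE : pencil jnum jden w = from_roots (- w * (a1 * a2)) (cube_fiber v1 ++ cube_fiber v2).
  have -> : from_roots (- w * (a1 * a2)) (cube_fiber v1 ++ cube_fiber v2) =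
    (- w)%:P * ((P ^+ 3 - u1 *: Q ^+ 3) * (P ^+ 3 - u2 *: Q ^+ 3)).
    by rewrite -vu1 -vu2 E1 E2 from_rootsM mul_polyC /from_roots scalerA.
  apply/eqP; rewrite -subr_eq0.
  have H : forall z, (pencil jnum jden w - (- w)%:P * ((P ^+ 3 - u1 *: Q ^+ 3) * (P ^+ 3 - u2 *: Q ^+ 3))).[z] = 0.
    move=> z; rewrite hornerD hornerN horner_pencil jnumE jdenE.
    rewrite hornerM hornerC hornerM !hornerD !hornerN !hornerZ !horner_exp -e; ring.
  apply: contraT => p0; have [z] : exists z, ~~ root (pencil jnum jden w - (- w)%:P * ((P ^+ 3 - u1 *: Q ^+ 3) * (P ^+ 3 - u2 *: Q ^+ 3))) z.
    by apply/closed_nonrootP.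
  by rewrite rootE H eqxx.
apply: (from_roots_inj (lead_pencil_neq0 snum sden (jfull wn0))); last first.
  by rewrite -pencilE; exact: pE.
by rewrite (size_fiber snum sden (jfull wn0)) size_cat s1 s2.
Qed.

(** Only one of the three cube roots of a number lies in a given sector. *)
Lemma count_cube_fiber k x v v0 : (k < 3)%N -> @sector R k v -> @sector R k v0 ->
  count (fun z => `[< connected_component (part_of k) x z >]) (cube_fiber v) =
  sheets P Q (@sector R k) x v0.
Proof.
move=> k3 kv kv0; rewrite /cube_fiber !count_cat.
have z0 m : (0 < m < 3)%N ->
    count (fun z => `[< connected_component (part_of k) x z >]) (fiber P Q (omega R ^+ m * v)) = 0%N.
  move=> /andP[m0 m3]; apply/eqP; rewrite -leqn0 leqNgt -has_count.
  apply/hasPn => z; rewrite (mem_fiber_quot sP' sQ' PQ_coprime) ?full_PQ// => /andP[Qz /eqP qz].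
  apply/asboolP => /connected_component_sub[_]; rewrite qz => kw.
  have := sector_disjoint k3 (ltn_pmod _ _) kw (sector_omegaX m k3 kv) => /(_ isT).
  by move: k3 m0 m3; case: (k) => [|[|[|]]] //; case: (m) => [|[|[|]]].
rewrite -[omega R * v]/(omega R ^+ 1 * v) !z0// !addn0.
apply: (sheets_const sP' sQ' PQ_coprime) => //; [exact: sector_open|exact: sector_convex|].
by move=> ? _; exact: full_PQ.
Qed.

(** A component of degree [m] contains [2 m] of the points over the midpoint of
    either strip, hence has [4 m] passages. *)
Lemma gon_sheets k x v : (k < 3)%N -> part_of k x -> @sector R k v ->
  gon_of jmap (fin @` connected_component (part_of k) x) = (sheets P Q (@sector R k) x v).*2.
Proof.
move=> k3 kx kv; rewrite -(component_part k3 kx).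
have s1 : (1 < size jnum)%N || (1 < size jden)%N by rewrite size_jden orbT.
have [bs bsP] := branch_values snum sden jnum_jden_coprime s1.
have [m m0 mP] := min_dist 0 (map (fun w : R[i] => (complex.Im w)%:C%C) bs).
have d0 : 0 < m / 2 by rewrite divr_gt0.
have uniq_strip w : 0 < `|complex.Im w| < 2 * (m / 2) -> uniq (fiber jnum jden w).
  move=> /andP[w0 wm]; apply: bsP; first by apply: jfull; exact: Im_neq0.
  apply/negP => wb; have := mP (complex.Im w)%:C%C (map_f _ wb).
  rewrite sub0r normcN normcR eq_complex /= eqxx andbT -normr_gt0 w0 => /(_ isT).
  by lra.
have generic : exists t : R, [/\ 0 <= t <= 1, t != 0 & uniq (fiber jnum jden t%:C%C)].
  have [e e0 eP] := min_dist 0 bs.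
  have h0 : 0 < Num.min 1 (e / 2) by rewrite lt_min ltr01 divr_gt0.
  exists (Num.min 1 (e / 2)); split.
  - by rewrite (ltW h0) ge_min lexx.
  - by rewrite gt_eqF.
  have tn0 : (Num.min 1 (e / 2))%:C%C != 0 :> R[i] by rewrite eq_complex /= negb_and gt_eqF.
  apply: bsP; first exact: jfull.
  apply/negP => /eP /(_ tn0); rewrite sub0r normcN normcR gtr0_norm//.
  have : Num.min 1 (e / 2) <= e / 2 by rewrite ge_min lexx orbT.
  by lra.
rewrite (gon_count snum sden jnum_jden_coprime jnum_neq0 jfull jmap_fin jmap_infty d0 uniq_strip offgraph_open offgraph_strip generic).
have count2 s : count (fun z => `[< connected_component offgraph x z >])
    (fiber jnum jden (mid (m / 2) s)) = (sheets P Q (@sector R k) x v).*2.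
  have ms : complex.Im (mid (m / 2) s) != 0.
    have /andP[+ _] := strip_Im (strip_mid d0 s).
    by rewrite normr_gt0.
  have [v1 [v2 [kv1 kv2 pe]]] := jfiber_split k3 ms.
  rewrite (permP pe) count_cat (component_part k3 kx).
  by rewrite (count_cube_fiber x k3 kv1 kv) (count_cube_fiber x k3 kv2 kv) addnn.
by rewrite !count2 addnn doubleK.
Qed.

End Pair.

(** * Components over the three sectors *)

(** The gons over a sector with [n] regions: a region of degree [m] is a
    [2 m]-gon, and the degrees form a partition of 3 into [n] parts. *)
Definition gons_of_sector (n : nat) : seq nat :=
  match n with 1 => [:: 6] | 2 => [:: 4; 2] | _ => [:: 2; 2; 2] end%N.

Lemma gons_of_labels (T : eqType) (L : seq T) : size L = 3%N ->
  perm_eq [seq (count_mem x L).*2 | x <- undup L] (gons_of_sector (size (undup L))).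
Proof.
case: L => [|a [|b [|c []]]] //= _; rewrite !inE.
have [<-|ab] := eqVneq a b; have [<-|ac] := eqVneq a c => //=.
- by rewrite !eqxx.
- by rewrite !eqxx (negPf ac) eq_sym (negPf ac).
- by rewrite (eq_sym b a) (negPf ab) /= !eqxx (eq_sym b a) (negPf ab).
have [<-|bc] := eqVneq b c; rewrite /= !eqxx ?(negPf ab) ?(negPf ac) ?(negPf bc) !(eq_sym b a) ?(negPf ab) //.
by rewrite (eq_sym c a) (eq_sym c b) (negPf ac) (negPf bc).
Qed.

Lemma count3_le (T : Type) (p q r : pred T) (s : seq T) :
  (forall x, p x + q x + r x <= 1)%N -> (count p s + count q s + count r s <= size s)%N.
Proof. by move=> h; elim: s => //= x s IH; have := h x; lia. Qed.

Section Count.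
Variable R : realType.
Notation C := (R[i] : numFieldType).
Notation P1 := (P1 R).
Variables P Q : {poly R[i]}.
Hypothesis sP : size P = 4%N.
Hypothesis sQ : (size Q <= 3)%N.
Hypothesis PQ_coprime : forall z, Q.[z] = 0 -> P.[z] != 0.
Implicit Types (z w v u : R[i]) (k : nat).

Local Notation part_of := (part_of P Q).
Local Notation fib := (fiber P Q).

Let sP' : (size P <= 3.+1)%N. Proof. by rewrite sP. Qed.
Let sQ' : (size Q <= 3.+1)%N. Proof. exact: leqW. Qed.
Let fullP w : full_degree P Q 3 w := full_PQ sP sQ w.

Definition comp k z : set C := connected_component (part_of k) z.
Definition labels k v : seq (set C) := map (comp k) (fib v).
(** A point of sector [k] over which components are counted; any other would do
    ([ncompE]). *)
Definition base k : R[i] := omega R ^+ k.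
Definition ncomp k : nat := size (undup (labels k (base k))).

Lemma sector_base k : (k < 3)%N -> sector k (base k).
Proof.
move=> k3; have := @sector_omegaX R 0 k 1 isT; rewrite mulr1 add0n modn_small//.
apply; rewrite /= mulr1; have h : 0 < Num.sqrt 3 :> R by rewrite sqrtr_gt0.
by apply/andP; split; lra.
Qed.

Lemma size_labels k v : size (labels k v) = 3%N.
Proof. by rewrite size_map (size_fiber sP' sQ'). Qed.

Lemma fib_part k v z : sector k v -> z \in fib v -> part_of k z.
Proof. by move=> kv; exact: (fiber_preim sP' sQ' PQ_coprime kv). Qed.

Lemma comp_eq k x z : part_of k z -> comp k x z <-> comp k z = comp k x.
Proof.
move=> kz; split=> [xz|zx]; first by rewrite /comp (same_connected_component xz).
by rewrite -zx; exact: connected_component_refl.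
Qed.

Lemma sheets_labels k x v : sector k v -> sheets P Q (@sector R k) x v =
  count_mem (comp k x) (labels k v).
Proof.
move=> kv; rewrite /sheets count_map; apply: eq_in_count => z zv /=.
by apply/asboolP/eqP => /(comp_eq x (fib_part kv zv)).
Qed.

Lemma sheets_constP k x v v' : sector k v -> sector k v' ->
  sheets P Q (@sector R k) x v = sheets P Q (@sector R k) x v'.
Proof.
move=> kv kv'; apply: (sheets_const sP' sQ' PQ_coprime) => //.
- exact: sector_open.
- exact: sector_convex.
Qed.

Lemma labels_mem k v v' : sector k v -> sector k v' -> labels k v =i labels k v'.
Proof.
have sub u u' : sector k u -> sector k u' -> {subset labels k u <= labels k u'}.
  move=> ku ku' V /mapP[z zu ->]; rewrite -has_pred1 has_count -sheets_labels//.
  rewrite (sheets_constP z ku' ku) sheets_labels// -has_count has_pred1.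
  exact: map_f.
by move=> kv kv' V; apply/idP/idP; exact: sub.
Qed.

Lemma ncompE k v : (k < 3)%N -> sector k v -> ncomp k = size (undup (labels k v)).
Proof.
move=> k3 kv; apply: perm_size; apply: uniq_perm; rewrite ?undup_uniq// => V.
by rewrite !mem_undup; apply: labels_mem => //; exact: sector_base.
Qed.

Lemma ncomp_gt0 k : (0 < ncomp k)%N.
Proof.
rewrite lt0n size_eq0; apply/eqP => /undup_nil h.
by have := size_labels k (base k); rewrite h.
Qed.

Lemma ncomp_le3 k : (ncomp k <= 3)%N.
Proof. by rewrite -(size_labels k (base k)) size_undup. Qed.

(** Every component lying over a sector meets every fibre over it. *)
Lemma ncomp_le k v (s : seq R[i]) : (k < 3)%N -> sector k v ->
  {subset fib v <= s} -> (ncomp k <= size s)%N.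
Proof.
move=> k3 kv vs; rewrite (ncompE k3 kv) -(size_map (comp k)).
apply: uniq_leq_size; first exact: undup_uniq.
by move=> V; rewrite mem_undup => /mapP[z zv ->]; apply: map_f; exact: vs.
Qed.

Definition region_list : seq (set P1) :=
  [seq (fin : C -> P1) @` V | V <- flatten [seq undup (labels k (base k)) | k <- iota 0 3]].

Lemma fin_image_inj : injective (fun V : set C => (fin : C -> P1) @` V).
Proof.
have sub (V W : set C) : (fin : C -> P1) @` V = (fin : C -> P1) @` W -> V `<=` W.
  move=> e z Vz; have : ((fin : C -> P1) @` W) (fin z) by rewrite -e; exists z.
  by move=> [y Wy [<-]].
by move=> V W e; apply/seteqP; split; exact: sub.
Qed.

Lemma label_part k V : (k < 3)%N -> V \in labels k (base k) ->
  exists2 z, part_of k z & V = comp k z.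
Proof.
by move=> k3 /mapP[z zb ->]; exists z => //; apply: fib_part zb; exact: sector_base.
Qed.

Lemma labels_disjoint k l V : (k < 3)%N -> (l < 3)%N ->
  V \in labels k (base k) -> V \in labels l (base l) -> k = l.
Proof.
move=> k3 l3 /label_part[//|z kz ->] /label_part[//|y ly e].
have : comp l y z by rewrite -e; exact: connected_component_refl.
by move/connected_component_sub; exact: (part_disjoint k3 l3 kz).
Qed.

Lemma region_list_uniq : uniq region_list.
Proof.
rewrite map_inj_uniq; last exact: fin_image_inj.
have dis k l : (k < 3)%N -> (l < 3)%N -> k != l ->
    ~~ has (in_mem^~ (mem (undup (labels k (base k))))) (undup (labels l (base l))).
  move=> k3 l3 kl; apply/hasPn => V; rewrite mem_undup => lV; apply: contra kl.
  by rewrite /= mem_undup => kV; rewrite (labels_disjoint k3 l3 kV lV).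
rewrite /= cats0 !cat_uniq !undup_uniq has_cat negb_or !dis//.
Qed.

Lemma region_listP U : regions_of (jmap P Q) U <-> U \in region_list.
Proof.
rewrite /regions_of offgraphE//; split.
  move=> [_ [z [k k3 kz] <-] <-]; rewrite component_fin; last by exists k.
  rewrite (component_part k3 kz); apply/mapP; exists (comp k z) => //.
  apply/flatten_mapP; exists k; first by rewrite mem_iota.
  have kq : sector k (quot P Q z) by case: kz.
  rewrite mem_undup (labels_mem (sector_base k3) kq).
  by apply: map_f; apply: (preim_fiber sP' sQ' PQ_coprime (fun w _ => fullP w) kz).
move=> /mapP[V /flatten_mapP[k + +] ->]; rewrite mem_iota add0n => /andP[_ k3].
rewrite mem_undup => /(label_part k3)[z kz ->]; exists (fin z).
  by exists z => //; exists k.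
by rewrite component_fin ?(component_part k3 kz)//; exists k.
Qed.

Lemma type_of_jmap : type_of (jmap P Q) =
  sort geq (flatten [seq gons_of_sector (ncomp k) | k <- iota 0 3]).
Proof.
rewrite (type_of_enum region_list_uniq region_listP); apply: sort_geq_perm.
rewrite -map_comp map_flatten -map_comp /=.
have piece k : (k < 3)%N ->
    perm_eq [seq (gon_of (jmap P Q) \o (fun V : set C => (fin : C -> P1) @` V)) i | i <- undup (labels k (base k))]
     (gons_of_sector (ncomp k)).
  move=> k3; rewrite /ncomp; apply: perm_trans (gons_of_labels (size_labels k (base k))).
  rewrite (@eq_in_map _ _ _ (fun V => (count_mem V (labels k (base k))).*2) _).1//.
  move=> V; rewrite mem_undup => /(label_part k3)[z kz ->] /=.
  by rewrite (gon_sheets sP sQ PQ_coprime k3 kz (sector_base k3)) (sheets_labels z (sector_base k3)).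
by rewrite !cats0 !perm_cat ?piece.
Qed.

(** Counting ramification points with multiplicity as roots of the wronskian. *)
Variable ws : seq R[i].
Variable a : R[i].
Hypothesis a0 : a != 0.
Hypothesis WE : wronskian P Q = from_roots a ws.

Definition nram k : nat := count (fun z => `[< part_of k z >]) ws.

Lemma mem_ws z : (z \in ws) = root (wronskian P Q) z.
Proof. by rewrite WE rootZ ?root_prod_XsubC. Qed.

Lemma dvd_count z m : ('X - z%:P) ^+ m %| wronskian P Q -> (m <= count_mem z ws)%N.
Proof.
rewrite WE dvdpZr//; elim: m ws => // m IH s; rewrite exprS => h.
have zs : z \in s.
  by rewrite -root_prod_XsubC -dvdp_XsubCl; apply: dvdp_trans h; exact: dvdp_mulIl.
have pe := perm_to_rem zs; move: h; rewrite (perm_big _ pe) big_cons /=.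
rewrite dvdp_mul2l ?polyXsubC_eq0// => /IH.
by have /permP -> := pe; rewrite /= eqxx.
Qed.

Lemma part_unramified_uniq k w : sector k w ->
  (forall z, part_of k z -> z \in ws -> w <> quot P Q z) -> uniq (fib w).
Proof.
move=> kw h; apply: (unramified_uniq sP' sQ' (fullP w)) => z zw.
rewrite -mem_ws; apply/negP => zws; apply: (h z) => //; first exact: fib_part zw.
by move: zw; rewrite (mem_fiber_quot sP' sQ' PQ_coprime)// => /andP[_ /eqP].
Qed.

(** Each ramification point over a sector can lower the number of components
    by at most one. *)
Lemma ncomp_nram k : (k < 3)%N -> (3 <= ncomp k + nram k)%N.
Proof.
move=> k3; case n0 : (nram k) => [|[|m]]; last first.
- by rewrite !addnS !ltnS; have := ncomp_gt0 k; lia.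
- rewrite addn1 ltnS.
  have [x0 x0ws kx0] : exists2 x, x \in ws & part_of k x.
    have : has (fun z => `[< part_of k z >]) ws by rewrite has_count -/(nram k) n0.
    by move=> /hasP[x xw /asboolP kx]; exists x.
  have only z : part_of k z -> z \in ws -> z = x0.
    move=> kz zws; apply/eqP/negPn/negP => zx0.
    have pe := perm_to_rem x0ws; have := n0; rewrite /nram (permP pe) /=.
    rewrite asboolT//= add1n => -[/eqP]; rewrite -leqn0 leqNgt -has_count => /hasPn h.
    have zr : z \in rem x0 ws by move: zws; rewrite (perm_mem pe) inE (negPf zx0).
    by have /asboolP := h z zr.
  have cx0 : count_mem x0 ws = 1%N.
    apply/eqP; rewrite eqn_leq -has_count has_pred1 x0ws andbT -n0.
    by apply: sub_count => z /eqP ->; exact/asboolP.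
  set c := quot P Q x0; have kc : sector k c by case: kx0.
  have x0c : x0 \in fib c by rewrite (mem_fiber_quot sP' sQ' PQ_coprime)// eqxx andbT; case: kx0.
  have c2 : count_mem x0 (fib c) = 2%N.
    apply/eqP; rewrite eqn_leq; apply/andP; split.
      rewrite leqNgt; apply/negP => /ramified2_dvd/dvd_count.
      by rewrite cx0.
    by apply: (root_ramified sP' sQ' PQ_coprime) => //; [rewrite -mem_ws|case: kx0].
  have [x1 x1c x10] : exists2 x1, x1 \in fib c & x1 != x0.
    apply: contrapT => h; have : all (pred1 x0) (fib c).
      by apply/allP => z zc; apply/negPn/negP => zx0; apply: h; exists z.
    by rewrite all_count c2 (size_fiber sP' sQ').
  have sx1 : simple_over P Q 3 c x1 (@sector R k).
    split=> // [|w kw wc].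
      apply: (unramified_simple sP' sQ' (fullP c) x1c); rewrite -mem_ws.
      by apply: contraNN x10 => /(only _ (fib_part kc x1c)) ->.
    by apply: part_unramified_uniq kw _ => z kz /(only _ kz) -> /eqP; rewrite (negPf wc).
  have ne : comp k x0 != comp k x1.
    apply: contraNneq x10 => e; rewrite eq_sym; apply/eqP.
    apply: (component_alone sP' sQ' PQ_coprime _ _ kc sx1 _ x0c).
    - exact: sector_open.
    - exact: sector_convex.
    - by apply/(comp_eq x1 kx0).
  rewrite (ncompE k3 kc); apply: (@uniq_leq_size _ [:: comp k x0; comp k x1]).
    by rewrite /= inE ne.
  by move=> V; rewrite !inE mem_undup => /orP[] /eqP ->; apply: map_f.
rewrite addn0 (ncompE k3 (sector_base k3)) undup_id ?size_labels//.
have none z : part_of k z -> z \notin ws.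
  move=> kz; apply/negP => zws.
  have : has (fun z => `[< part_of k z >]) ws by apply/hasP; exists z => //; exact/asboolP.
  by rewrite has_count -/(nram k) n0.
have uw w : sector k w -> uniq (fib w).
  by move=> kw; apply: part_unramified_uniq kw _ => z /none/negP.
have kb := sector_base k3; rewrite map_inj_in_uniq ?uw// => z y zb yb e.
have sy : simple_over P Q 3 (base k) y (@sector R k).
  by split=> // [|w kw _]; [rewrite count_uniq_mem ?yb ?uw|exact: uw].
apply: (component_alone sP' sQ' PQ_coprime _ _ kb sy _ zb).
- exact: sector_open.
- exact: sector_convex.
- by apply/(comp_eq y (fib_part kb zb)).
Qed.

Lemma ncomp_ramified k z : (k < 3)%N -> z \in ws -> part_of k z -> (ncomp k <= 2)%N.
Proof.
move=> k3 zws kz; set c := quot P Q z; have kc : sector k c by case: kz.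
have c2 : (2 <= count_mem z (fib c))%N.
  by apply: (root_ramified sP' sQ' PQ_coprime) => //; [rewrite -mem_ws|case: kz].
apply: leq_trans (ncomp_le k3 kc (s := undup (fib c)) _) _.
  by move=> x; rewrite mem_undup.
rewrite -ltnS -(size_fiber sP' sQ' (fullP c)) ltn_neqAle size_undup andbT.
apply/negP => /eqP e; have uc : uniq (fib c) by apply/negPn; rewrite -ltn_size_undup e ltnn.
by move: c2; rewrite count_uniq_mem//; case: (_ \in _).
Qed.

(** The degree is at most 4, not 5: [Q] has degree at most 2, as infinity is a
    pole. *)
Lemma size_wronskian : (size (wronskian P Q) <= 5)%N.
Proof.
rewrite (leq_trans (size_polyD _ _))// size_polyN geq_max; apply/andP; split.
  apply: leq_trans (size_polyMleq _ _) _.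
  have : (size P^`() <= 3)%N by rewrite -ltnS -sP lt_size_deriv// -size_poly_gt0 sP.
  by have := sQ; lia.
apply: leq_trans (size_polyMleq _ _) _; rewrite sP.
have : (size Q^`() <= 2)%N by rewrite -ltnS (leq_trans (lt_size_deriv (Q_neq0 sP PQ_coprime))).
by move=> h; exact: (leq_add (leqnn 3) h).
Qed.

Lemma nram_sum : (nram 0 + nram 1 + nram 2 <= 4)%N.
Proof.
have sws : (size ws <= 4)%N.
  have := size_wronskian; rewrite WE size_scale// size_prod_XsubC; lia.
apply: leq_trans sws; apply: count3_le => z.
have dis k l : (k < 3)%N -> (l < 3)%N -> k != l -> part_of k z -> ~ part_of l z.
  by move=> k3 l3 kl kz lz; rewrite (part_disjoint k3 l3 kz lz) eqxx in kl.
case: asboolP => h0; case: asboolP => h1; case: asboolP => h2 //.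
all: by [case: (dis 0%N 1%N _ _ _ h0 h1)|case: (dis 0%N 2%N _ _ _ h0 h2)|case: (dis 1%N 2%N _ _ _ h1 h2)].
Qed.

Lemma ncomp_sum : (5 <= ncomp 0 + ncomp 1 + ncomp 2)%N.
Proof.
have := ncomp_nram (isT : 0 < 3)%N; have := ncomp_nram (isT : 1 < 3)%N.
have := ncomp_nram (isT : 2 < 3)%N; have := nram_sum; lia.
Qed.

End Count.

(** * Moving a pole to infinity *)

Section Normalize.
Variable R : realType.
Notation P1 := (P1 R).
Implicit Types (P Q T p q : {poly R[i]}) (z x : R[i]).

Lemma jval_scale (k a b : R[i]) : k != 0 -> jval (k * a) (k * b) = jval a b.
Proof.
move=> k0; rewrite /jval -[RHS](@frac_pt_scale _ (k ^+ 6)) ?expf_neq0//.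
by congr frac_pt; ring.
Qed.

Definition proper_pair P Q := [/\ (size P <= 4)%N, (size Q <= 4)%N,
  forall z, Q.[z] = 0 -> P.[z] != 0 & Q`_3 = 0 -> P`_3 != 0].

Definition normal_pair P Q := [/\ size P = 4%N, (size Q <= 3)%N &
  forall z, Q.[z] = 0 -> P.[z] != 0].

Lemma size_le_coef n P : (size P <= n.+1)%N -> P`_n = 0 -> (size P <= n)%N.
Proof.
move=> sP Pn; rewrite leqNgt; apply/negP => nP.
have e : size P = n.+1 by apply/eqP; rewrite eqn_leq sP.
have : lead_coef P == 0 by rewrite lead_coefE e Pn.
by rewrite lead_coef_eq0 -size_poly_eq0 e.
Qed.

Lemma size_eq_coef n P : (size P <= n.+1)%N -> P`_n != 0 -> size P = n.+1.
Proof.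
move=> sP Pn; apply/eqP; rewrite eqn_leq sP ltnNge; apply: contra Pn => h.
by rewrite nth_default.
Qed.

(** [flip x P] is [X^3 P(x + 1/X)]. *)
Definition flip x P : {poly R[i]} := \poly_(i < 4) (P \Po ('X + x%:P))`_(3 - i).

Lemma size_shift x P : size (P \Po ('X + x%:P)) = size P.
Proof. by apply: size_comp_poly2; exact: size_XaddC. Qed.

Lemma horner_shift x P z : (P \Po ('X + x%:P)).[z] = P.[z + x].
Proof. by rewrite horner_comp hornerD hornerX hornerC. Qed.

Lemma flip_horner x P z : (size P <= 4)%N -> z != 0 ->
  (flip x P).[z] = z ^+ 3 * P.[x + z^-1].
Proof.
move=> sP z0; rewrite addrC -horner_shift.
have sS : (size (P \Po ('X + x%:P)) <= 4)%N by rewrite size_shift.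
rewrite (horner_coef_wide _ sS) /flip horner_poly; move: (_ \Po _) => T.
rewrite !big_ord_recl !big_ord0 /= /bump /= !add1n.
by field.
Qed.

Lemma flip_horner0 x P : (size P <= 4)%N -> (flip x P).[0] = P`_3.
Proof.
move=> sP; rewrite horner_coef0 coef_poly /= subn0.
have [P3|P3] := eqVneq P`_3 0.
  by rewrite P3 nth_default// size_shift size_le_coef.
have s4 := size_eq_coef sP P3.
have := @lead_coef_comp _ P ('X + x%:P); rewrite size_XaddC => /(_ isT).
rewrite !lead_coefE size_shift s4 size_XaddC /= => ->.
by rewrite coefD coefX coefC /= addr0 expr1n mulr1.
Qed.

Lemma flip_coef3 x P : (flip x P)`_3 = P.[x].
Proof. by rewrite coef_poly /= subnn -horner_coef0 horner_shift add0r. Qed.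

Definition moebius x (y : P1) : P1 := translation x (inversion y).
Definition moebius_inv x (y : P1) : P1 := inversion (translation (- x) y).

Lemma moebiusK x : cancel (moebius x) (moebius_inv x).
Proof. by move=> y; rewrite /moebius_inv /moebius translationK inversionK. Qed.

Lemma moebius_invK x : cancel (moebius_inv x) (moebius x).
Proof.
move=> y; rewrite /moebius_inv /moebius inversionK.
by have := @translationK R (- x) y; rewrite opprK.
Qed.

Lemma continuous_moebius x : continuous (moebius x).
Proof.
move=> y; apply: continuous_comp; first exact: continuous_inversion.
exact: continuous_translation.
Qed.

Lemma continuous_moebius_inv x : continuous (moebius_inv x).
Proof.
move=> y; apply: continuous_comp; first exact: continuous_translation.
exact: continuous_inversion.
Qed.

Lemma jmap_flip x P Q : proper_pair P Q -> Q.[x] = 0 ->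
  jmap (flip x P) (flip x Q) = jmap P Q \o moebius x.
Proof.
move=> [sP sQ _ _] Qx; apply/funext => -[z|] /=; last first.
  by rewrite !flip_coef3 add0r.
have [->|z0] := eqVneq z 0; first by rewrite /moebius /= eqxx /= !flip_horner0.
by rewrite /moebius /= (negPf z0) /= !flip_horner// jval_scale ?expf_neq0// addrC.
Qed.

Lemma flip_normal x P Q : proper_pair P Q -> Q.[x] = 0 ->
  normal_pair (flip x P) (flip x Q).
Proof.
move=> [sP sQ PQ PQ3] Qx; split.
- by apply: size_eq_coef; [exact: size_poly|rewrite flip_coef3; exact: PQ].
- by apply: size_le_coef; [exact: size_poly|rewrite flip_coef3].
move=> z; have [->|z0] := eqVneq z 0; first by rewrite !flip_horner0.
rewrite !flip_horner// => /eqP; rewrite mulf_eq0 expf_eq0 (negPf z0) /= => /eqP h.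
by rewrite mulf_neq0 ?expf_neq0// PQ.
Qed.

(** Moving a pole of [P / Q] to infinity by a Moebius transformation puts all
    regions into the plane. *)
Lemma normalize P Q : proper_pair P Q -> exists P' Q',
  normal_pair P' Q' /\ type_of (jmap P Q) = type_of (jmap P' Q').
Proof.
move=> PQ; have [sP sQ cPQ c3] := PQ; have [Q3|Q3] := eqVneq Q`_3 0.
  exists P, Q; split=> //; split=> //; last exact: size_le_coef.
  by apply: size_eq_coef => //; exact: c3.
have [x /rootP Qx] : exists x, root Q x.
  by apply/closed_rootP; rewrite (size_eq_coef sQ Q3).
exists (flip x P), (flip x Q); have [sP' sQ' c'] := flip_normal PQ Qx; split=> //.
rewrite (_ : jmap P Q = jmap (flip x P) (flip x Q) \o moebius_inv x); last first.
  by rewrite jmap_flip//; apply/funext => y /=; rewrite moebius_invK.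
apply: (type_of_homeo (@moebius_invK x) (@moebiusK x) _ _
  (region_list_uniq sP' sQ' c') (region_listP sP' sQ' c')).
- exact: continuous_moebius_inv.
- exact: continuous_moebius.
Qed.

End Normalize.

(** * From curves to pairs of polynomials *)

Section Curves.
Variable R : realType.
Implicit Types (C : crtc R 3) (a b z : R[i]).
Local Notation w := (omega R).

(** [pair1 C / pair2 C] is [lambda] followed by the Moebius transformation that
    takes the two zeros of [j] to [0] and infinity and its three poles
    [0, 1, infinity] to the cube roots of unity. *)
Definition pair1 C : {poly R[i]} := (y1 C - y3 C) + w *: (y2 C - y3 C).
Definition pair2 C : {poly R[i]} := (y1 C - y3 C) + w ^+ 2 *: (y2 C - y3 C).

Lemma omega_neq1 : w - w ^+ 2 != 0.
Proof.
apply/eqP => e; have : (w - w ^+ 2) ^+ 2 = 0 by rewrite e expr0n.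
have h := omega_sqr R; rewrite (_ : _ ^+ 2 = - 3); last by ring: h.
by move/eqP; rewrite oppr_eq0 pnatr_eq0.
Qed.

Lemma y_size C : [/\ (size (y1 C) <= 4)%N, (size (y2 C) <= 4)%N & (size (y3 C) <= 4)%N].
Proof. by have := crtc_maxdeg C; split; lia. Qed.

Lemma diff_size C : (size (y1 C - y3 C)%R <= 4)%N /\ (size (y2 C - y3 C)%R <= 4)%N.
Proof.
have [s1 s2 s3] := y_size C.
by split; rewrite (leq_trans (size_polyD _ _))// size_polyN geq_max ?s1 ?s2.
Qed.

Lemma omega_pair (a b : R[i]) : a + w * b = 0 -> a + w ^+ 2 * b = 0 -> a = 0 /\ b = 0.
Proof.
move=> h1 h2; have : (w - w ^+ 2) * b = (a + w * b) - (a + w ^+ 2 * b) by ring.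
rewrite h1 h2 subrr => /eqP; rewrite mulf_eq0 (negPf omega_neq1) /= => /eqP b0.
by move: h1; rewrite b0 mulr0 addr0.
Qed.

Lemma horner_pair1 C z : (pair1 C).[z] = (y1 C - y3 C).[z] + w * (y2 C - y3 C).[z].
Proof. by rewrite /pair1 hornerD hornerZ. Qed.

Lemma horner_pair2 C z : (pair2 C).[z] = (y1 C - y3 C).[z] + w ^+ 2 * (y2 C - y3 C).[z].
Proof. by rewrite /pair2 hornerD hornerZ. Qed.

Lemma coef_pair1 C k : (pair1 C)`_k = (y1 C - y3 C)`_k + w * (y2 C - y3 C)`_k.
Proof. by rewrite /pair1 (coefD (y1 C - y3 C)) coefZ. Qed.

Lemma coef_pair2 C k : (pair2 C)`_k = (y1 C - y3 C)`_k + w ^+ 2 * (y2 C - y3 C)`_k.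
Proof. by rewrite /pair2 (coefD (y1 C - y3 C)) coefZ. Qed.

Lemma no_triple C z : (y1 C - y3 C).[z] = 0 -> (y2 C - y3 C).[z] != 0.
Proof.
rewrite !hornerD !hornerN => /eqP; rewrite !subr_eq0 => /eqP e1; apply/eqP => e2.
by apply: (crtc_no_triple (c := C)); exists z; rewrite e1 -e2.
Qed.

Lemma no_triple3 C : (y1 C - y3 C)`_3 = 0 -> (y2 C - y3 C)`_3 != 0.
Proof.
rewrite !coefB => /eqP; rewrite !subr_eq0 => /eqP e1; apply/eqP => e2.
by apply: (crtc_no_triple_infty (c := C)); rewrite e1 -e2.
Qed.

Lemma curve_proper C : proper_pair (pair1 C) (pair2 C).
Proof.
have [s1 s2] := diff_size C; split.
- by rewrite (leq_trans (size_polyD _ _))// geq_max s1 (leq_trans (size_scale_leq _ _)).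
- by rewrite (leq_trans (size_polyD _ _))// geq_max s1 (leq_trans (size_scale_leq _ _)).
- move=> z; rewrite horner_pair1 horner_pair2 => h2; apply/eqP => h1.
  by have [/no_triple/eqP] := omega_pair h1 h2.
rewrite coef_pair1 coef_pair2 => h2; apply/eqP => h1.
by have [/no_triple3/eqP] := omega_pair h1 h2.
Qed.

Lemma j_of_lambdaE a b : a != 0 \/ b != 0 ->
  @j_of_lambda R (frac_pt a b) = jval (a + w * b) (a + w ^+ 2 * b).
Proof.
move=> ab; have h := omega_sqr R.
have -> : jval (a + w * b) (a + w ^+ 2 * b) =
    frac_pt (4 * (a ^+ 2 - a * b + b ^+ 2) ^+ 3) (27 * (a ^+ 2 * b ^+ 2 * (a - b) ^+ 2)).
  rewrite /jval -[RHS](@frac_pt_scale _ (-1)) ?oppr_eq0 ?oner_eq0//.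
  by congr frac_pt; ring: h.
rewrite /j_of_lambda /ratmap {3}/frac_pt.
set N := 4%:R *: _; set M := 27%:R *: _.
have [b0|b0] := eqVneq b 0.
  have sq : size ('X^2 - 'X + 1 : {poly R[i]}) = 3%N.
    rewrite -addrA size_polyDl ?size_polyXn// (leq_ltn_trans (size_polyD _ _))//.
    by rewrite size_polyN size_polyX size_poly1.
  have sN : size N = 7%N.
    rewrite size_scale ?pnatr_eq0//; have := size_exp ('X^2 - 'X + 1 : {poly R[i]}) 3.
    by rewrite sq; case: (size _) => //= n ->.
  have sM : (size M <= 6)%N.
    apply: leq_trans (size_scale_leq _ _) _; apply: leq_trans (size_polyMleq _ _) _.
    rewrite size_polyXn /=; have := size_exp ('X - 1 : {poly R[i]}) 2.
    rewrite -polyC1 size_XsubC; case: (size _) => //= n ->; by [].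
  have a0 : a != 0 by case: ab; rewrite ?b0 ?eqxx.
  have -> : (maxn (size N) (size M)).-1 = 6%N by rewrite sN (maxn_idPl _)// (leq_trans sM).
  rewrite [M`_6]nth_default// b0 !mulr0 expr0n /= mulr0 mul0r mulr0.
  by rewrite /frac_pt !eqxx.
have -> : frac_pt a b = fin (a / b) by rewrite /frac_pt (negPf b0).
have NE z : N.[z] = 4 * (z ^+ 2 - z + 1) ^+ 3 by rewrite /N !hornerE.
have ME z : M.[z] = 27 * (z ^+ 2 * (z - 1) ^+ 2) by rewrite /M !hornerE.
rewrite /fin NE ME -[RHS](@frac_pt_scale _ (b ^- 6)) ?invr_neq0 ?expf_neq0//.
by congr frac_pt; field.
Qed.

Lemma j_invariantE C : j_invariant C = jmap (pair1 C) (pair2 C).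
Proof.
have [s1 s2] := diff_size C; have n3 := @no_triple3 C.
have d3 : (maxn (size (y1 C - y3 C)%R) (size (y2 C - y3 C)%R)).-1 = 3%N.
  have [c1|c1] := eqVneq (y1 C - y3 C)`_3 0.
    by rewrite (size_eq_coef s2 (n3 c1)) (maxn_idPr _).
  by rewrite (size_eq_coef s1 c1) (maxn_idPl _).
apply/funext => x; rewrite /j_invariant /= /lambda /ratmap /= d3.
case: x => [z|]; rewrite j_of_lambdaE /=.
- by rewrite horner_pair1 horner_pair2.
- by case: (eqVneq (y1 C - y3 C).[z] 0) => [/no_triple|]; [right|left].
- by rewrite coef_pair1 coef_pair2.
- by case: (eqVneq (y1 C - y3 C)`_3 0) => [/n3|]; [right|left].
Qed.

Definition curve_type (n0 n1 n2 : nat) : seq nat :=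
  sort geq (gons_of_sector n0 ++ gons_of_sector n1 ++ gons_of_sector n2).

Lemma pair_type P Q : normal_pair P Q -> type_of (@jmap R P Q) =
  curve_type (ncomp P Q 0) (ncomp P Q 1) (ncomp P Q 2).
Proof. by move=> [sP sQ c]; rewrite type_of_jmap// /curve_type /= cats0. Qed.

Lemma wronskian_roots (P Q : {poly R[i]}) : normal_pair P Q ->
  exists2 a, a != 0 & exists ws, wronskian P Q = from_roots a ws.
Proof.
move=> [sP sQ c]; have W0 : wronskian P Q != 0 by apply: wronskian_neq0; rewrite ?sP.
have [ws WE] := closed_field_poly_normal (wronskian P Q).
by exists (lead_coef (wronskian P Q)); [rewrite lead_coef_eq0|exists ws].
Qed.

Lemma curve_type_bounds C : exists n0 n1 n2 : nat,
  [/\ (0 < n0 <= 3)%N, (0 < n1 <= 3)%N, (0 < n2 <= 3)%N, (5 <= n0 + n1 + n2)%N &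
   combinatorial_type C = curve_type n0 n1 n2].
Proof.
rewrite combinatorial_typeE j_invariantE.
have [P [Q [nPQ ->]]] := normalize (curve_proper C).
have [a a0 [ws WE]] := wronskian_roots nPQ; have [sP sQ c] := nPQ.
exists (ncomp P Q 0), (ncomp P Q 1), (ncomp P Q 2).
split; rewrite ?(ncomp_gt0 sP sQ) ?(ncomp_le3 sP sQ)//; last exact: pair_type.
exact: (ncomp_sum sP sQ c a0 WE).
Qed.

(** Every admissible pair comes from a curve, with [y3 = 0]: solve the linear
    system for [p] and [q]. *)
Lemma curve_of_pair (P Q : {poly R[i]}) : normal_pair P Q ->
  exists C, combinatorial_type C = curve_type (ncomp P Q 0) (ncomp P Q 1) (ncomp P Q 2).
Proof.
move=> nPQ; have [sP sQ c] := nPQ.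
pose q : {poly R[i]} := (w - w ^+ 2)^-1 *: (P - Q); pose p := P - w *: q.
have PE : p + w *: q = P by rewrite /p subrK.
have QE : p + w ^+ 2 *: q = Q.
  rewrite /p (_ : _ + _ = P - (w - w ^+ 2) *: q); last by rewrite scalerBl; ring.
  by rewrite /q scalerA divff ?omega_neq1// scale1r subKr.
have s4 : (size q <= 4)%N.
  rewrite (leq_trans (size_scale_leq _ _))// (leq_trans (size_polyD _ _))//.
  by rewrite size_polyN geq_max sP /=; exact: leqW.
have p4 : (size p <= 4)%N.
  rewrite (leq_trans (size_polyD _ _))// size_polyN geq_max sP.
  by rewrite (leq_trans (size_scale_leq _ _)).
have P3 : P`_3 != 0 by have := lead_coef_eq0 P; rewrite lead_coefE sP /= -size_poly_eq0 sP => ->.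
have h1 : maxn (size p).-1 (maxn (size q).-1 (size (0 : {poly R[i]})).-1) = 3%N.
  rewrite size_poly0 maxn0; have [q3|q3] := eqVneq q`_3 0.
    have p3 : p`_3 != 0 by apply: contraNneq P3 => p3; rewrite -PE coefD coefZ p3 q3 mulr0 addr0.
    by rewrite (size_eq_coef p4 p3) (maxn_idPl _)// -ltnS; case: (size q) s4.
  by rewrite (size_eq_coef s4 q3) (maxn_idPr _)// -ltnS; case: (size p) p4.
have h2 : ~ exists x : R[i], p.[x] = q.[x] /\ q.[x] = (0 : {poly R[i]}).[x].
  move=> [x [pq]]; rewrite horner0 => q0; have p0 : p.[x] = 0 by rewrite pq.
  have Q0 : Q.[x] = 0 by rewrite -QE hornerD hornerZ p0 q0 mulr0 addr0.
  have P0 : P.[x] = 0 by rewrite -PE hornerD hornerZ p0 q0 mulr0 addr0.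
  by have := c _ Q0; rewrite P0 eqxx.
have h3 : ~ (p`_3 = q`_3 /\ q`_3 = (0 : {poly R[i]})`_3).
  move=> [pq]; rewrite coef0 => q3; have p3 : p`_3 = 0 by rewrite pq.
  by move/eqP: P3; apply; rewrite -PE coefD coefZ p3 q3 mulr0 addr0.
pose C := Crtc (isT : (0 < 3)%N) h1 h2 h3; exists C.
rewrite combinatorial_typeE j_invariantE.
have -> : pair1 C = P by rewrite /pair1 /= !subr0.
have -> : pair2 C = Q by rewrite /pair2 /= !subr0.
exact: pair_type.
Qed.

End Curves.

(** * Realizing the eight types *)

Section Examples.
Variable R : realType.
Implicit Types (v z s : R[i]) (A : R[i]).
Local Notation w := (omega R).

(** The value [k = 3] stands for a point in none of the sectors. *)
Definition located v k := forall l, (l < 3)%N -> sector l v <-> l = k.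

Lemma located_sector k v : (k < 3)%N -> sector k v -> located v k.
Proof. by move=> k3 kv l l3; split=> [lv|->//]; exact: sector_disjoint lv kv. Qed.

Lemma located_none v : neg_real (v ^+ 3) -> located v 3.
Proof. by move=> nv l l3; split=> [/sector_cube//|l3']; rewrite l3' ltnn in l3. Qed.

Lemma sqrt3_bounds : 1 < (Num.sqrt 3 : R) < 2.
Proof.
have s0 : 0 <= (Num.sqrt 3 : R) by exact: sqrtr_ge0.
have s2 : (Num.sqrt 3 : R) ^+ 2 = 3 by rewrite sqr_sqrtr.
by apply/andP; split; nra.
Qed.

Lemma ncomp_of_nram (P Q : {poly R[i]}) a ws k n : normal_pair P Q -> a != 0 ->
  wronskian P Q = from_roots a ws -> (k < 3)%N -> (n <= 3)%N -> nram P Q ws k = (3 - n)%N ->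
  (ncomp P Q k <= n)%N -> ncomp P Q k = n.
Proof.
move=> [sP sQ c] a0 WE k3 n3 nk kn; have := ncomp_nram sP sQ c a0 WE k3.
by rewrite nk; lia.
Qed.

(** [A + (v1 - v2) x^3 / (3 x^2 - 1)] has a triple point at [0] over [A] and
    simple ramification points [1] and [-1] over [v1] and [v2], provided that [A]
    is the midpoint of [v1] and [v2]. *)
Section Triple.
Variables (A v1 v2 : R[i]).
Hypothesis v12 : v1 + v2 = A + A.
Hypothesis v1_neq : v1 != v2.

Definition triple_den : {poly R[i]} := 3%:P * 'X^2 - 1.
Definition triple_num : {poly R[i]} := A%:P * triple_den + (v1 - v2)%:P * 'X^3.

Lemma triple_denE z : triple_den.[z] = 3 * z ^+ 2 - 1.
Proof. by rewrite /triple_den !hornerE. Qed.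

Lemma triple_numE z : triple_num.[z] = A * (3 * z ^+ 2 - 1) + (v1 - v2) * z ^+ 3.
Proof. by rewrite /triple_num hornerD !hornerCM hornerXn triple_denE. Qed.

Lemma size_triple_den : (size triple_den <= 3)%N.
Proof.
rewrite (leq_trans (size_polyD _ _))// size_polyN size_poly1 geq_max andbT.
by rewrite mul_polyC (leq_trans (size_scale_leq _ _))// size_polyXn.
Qed.

Lemma triple_normal : normal_pair triple_num triple_den.
Proof.
split; [|exact: size_triple_den|].
  have sX : size ((v1 - v2)%:P * 'X^3) = 4%N.
    by rewrite mul_polyC size_scale ?subr_eq0// size_polyXn.
  rewrite /triple_num addrC size_polyDl sX// mul_polyC ltnS.
  by rewrite (leq_trans (size_scale_leq _ _))// size_triple_den.
move=> z; rewrite triple_denE triple_numE => e; rewrite e mulr0 add0r.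
rewrite mulf_neq0 ?subr_eq0// expf_neq0//; apply/eqP => z0; move: e.
by rewrite z0 expr0n mulr0 sub0r => /eqP; rewrite oppr_eq0 oner_eq0.
Qed.

Lemma triple_wronskian : wronskian triple_num triple_den =
  from_roots (3 * (v1 - v2)) [:: 0; 0; 1; -1].
Proof.
rewrite /from_roots !big_cons big_nil -mul_polyC /wronskian /triple_num /triple_den.
rewrite !poly.derivE /=.
ring.
Qed.

Lemma quot_triple0 : quot triple_num triple_den 0 = A.
Proof.
rewrite /quot triple_denE triple_numE !expr0n /= !mulr0 addr0 sub0r.
by rewrite mulfK// oppr_eq0 oner_eq0.
Qed.

Lemma quot_triple1 : quot triple_num triple_den 1 = v1.
Proof.
rewrite /quot triple_denE triple_numE !expr1n !mulr1 (_ : 3 - 1 = 2); last by ring.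
apply: (mulIf (_ : (2 : R[i]) != 0)); rewrite ?pnatr_eq0// mulfVK ?pnatr_eq0//.
by rewrite (_ : v1 * 2 = (v1 + v2) + (v1 - v2)); [rewrite v12|]; ring.
Qed.

Lemma quot_tripleN1 : quot triple_num triple_den (-1) = v2.
Proof.
rewrite /quot triple_denE triple_numE sqrrN expr1n mulr1 (_ : 3 - 1 = 2); last by ring.
apply: (mulIf (_ : (2 : R[i]) != 0)); rewrite ?pnatr_eq0// mulfVK ?pnatr_eq0//.
by rewrite (_ : v2 * 2 = (v1 + v2) - (v1 - v2)); [rewrite v12|]; ring.
Qed.

Lemma part_triple k z v l : (k < 3)%N -> triple_den.[z] != 0 ->
  quot triple_num triple_den z = v -> located v l ->
  `[< part_of triple_num triple_den k z >] = (k == l).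
Proof.
move=> k3 dz qz vl; apply/asboolP/eqP => [[_]|kl]; first by rewrite qz => /(vl k k3).
by split; rewrite // qz; apply/(vl k k3).
Qed.

Lemma ncomp_triple k l l1 l2 : (k < 3)%N ->
  located A l -> located v1 l1 -> located v2 l2 -> (k == l1) && (k == l2) = false ->
  (k == l) && ((k == l1) || (k == l2)) = false ->
  ncomp triple_num triple_den k = (if k == l then 1 else if (k == l1) || (k == l2) then 2 else 3)%N.
Proof.
move=> k3 Al vl1 vl2 k12 kl12; have nPQ := triple_normal; have [sP sQ c] := nPQ.
have a0 : 3 * (v1 - v2) != 0 by rewrite mulf_neq0 ?pnatr_eq0// subr_eq0.
have WE := triple_wronskian.
have d0 : triple_den.[0] != 0.
  by rewrite triple_denE expr0n mulr0 sub0r oppr_eq0 oner_eq0.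
have d1 : triple_den.[1] != 0.
  by rewrite triple_denE expr1n mulr1 (_ : 3 - 1 = 2) ?pnatr_eq0//; ring.
have dN1 : triple_den.[-1] != 0.
  by rewrite triple_denE sqrrN expr1n mulr1 (_ : 3 - 1 = 2) ?pnatr_eq0//; ring.
have p0 := part_triple k3 d0 quot_triple0 Al.
have p1 := part_triple k3 d1 quot_triple1 vl1.
have p2 := part_triple k3 dN1 quot_tripleN1 vl2.
have nk : nram triple_num triple_den [:: 0; 0; 1; -1] k = ((k == l).*2 + ((k == l1) + (k == l2)))%N.
  by rewrite /nram /= p0 p1 p2; lia.
set m := (X in _ = X); apply: (@ncomp_of_nram _ _ _ _ k m nPQ a0 WE k3).
  by rewrite /m; case: (k == l) => //; case: (_ || _).
  by rewrite nk /m; move: k12 kl12; do 3 case: eqP.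
rewrite /m.
case: ifP => [/eqP kl|_].
  have kA : sector k A by apply/(Al k k3).
  apply: (ncomp_le sP sQ c (s := [:: 0]) k3 kA) => z.
  rewrite (mem_fiber (n := 3)) ?sP ?(leqW sQ) ?full_PQ// triple_numE triple_denE.
  rewrite -subr_eq0 [X in X == _](_ : _ = (v1 - v2) * z ^+ 3); last by ring.
  by rewrite mulf_eq0 subr_eq0 (negPf v1_neq) expf_eq0 /= inE.
case: ifP => [/orP[k1|k2]|_]; last exact: (ncomp_le3 sP sQ).
  apply: (ncomp_ramified sP sQ c a0 WE k3 (z := 1)); rewrite ?inE ?eqxx ?orbT//.
  by apply/asboolP; rewrite p1.
apply: (ncomp_ramified sP sQ c a0 WE k3 (z := -1)); rewrite ?inE ?eqxx ?orbT//.
by apply/asboolP; rewrite p2.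
Qed.

(** Sectors without ramification have three regions, those with a simple
    ramification point two, and the one with the triple point one. *)
Lemma triple_curve l l1 l2 : located A l -> located v1 l1 -> located v2 l2 ->
  (forall k, (k < 3)%N -> (k == l1) && (k == l2) = false) ->
  (forall k, (k < 3)%N -> (k == l) && ((k == l1) || (k == l2)) = false) ->
  let f k := (if k == l then 1 else if (k == l1) || (k == l2) then 2 else 3)%N in
  exists C : crtc R 3, combinatorial_type C = curve_type (f 0%N) (f 1%N) (f 2%N).
Proof.
move=> Al vl1 vl2 h1 h2 f; have [C CE] := curve_of_pair triple_normal; exists C.
by rewrite CE !(@ncomp_triple _ l l1 l2) ?h1 ?h2.
Qed.

End Triple.

Lemma real_located0 (t : R) : 0 < t -> located (t%:C%C : R[i]) 0.
Proof.
move=> t0; apply: located_sector => //=; have /andP[s1 _] := sqrt3_bounds.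
have : 0 < Num.sqrt 3 * t by rewrite mulr_gt0// (lt_trans ltr01).
by move=> h; apply/andP; split; lra.
Qed.

Lemma real_located_none (t : R) : t <= 0 -> located (t%:C%C : R[i]) 3.
Proof.
move=> t0; apply: located_none; rewrite -rmorphXn; split=> //=.
by rewrite exprS mulr_le0_ge0// sqr_ge0.
Qed.

Definition realized (n0 n1 n2 : nat) :=
  exists C : crtc R 3, combinatorial_type C = curve_type n0 n1 n2.

Lemma double_neq (a b : R) : a != b -> (a%:C%C : R[i]) != b%:C%C.
Proof. by rewrite eq_complex /= eqxx andbT. Qed.

Lemma type333 : realized 3 3 3.
Proof.
have := @triple_curve (- 2)%:C%C (- 1)%:C%C (- 3)%:C%C _ _ 3 3 3.
apply.
- by rewrite -!rmorphD; congr (_%:C%C); lra.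
- by apply: double_neq; apply/eqP; lra.
- by apply: real_located_none; lra.
- by apply: real_located_none; lra.
- by apply: real_located_none; lra.
- by case=> [|[|[|]]].
- by case=> [|[|[|]]].
Qed.

Lemma type233 : realized 2 3 3.
Proof.
have := @triple_curve 0%:C%C 1%:C%C (- 1)%:C%C _ _ 3 0 3.
apply.
- by rewrite -!rmorphD; congr (_%:C%C); lra.
- by apply: double_neq; apply/eqP; lra.
- by apply: real_located_none; lra.
- by apply: real_located0; lra.
- by apply: real_located_none; lra.
- by case=> [|[|[|]]].
- by case=> [|[|[|]]].
Qed.

Lemma type232 : realized 2 3 2.
Proof.
have /andP[s1 s2] := sqrt3_bounds.
have := @triple_curve 0%:C%C (1 +i* 1)%C (- 1 +i* - 1)%C _ _ 3 0 2.
apply.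
- by simpc; congr (_ +i* _)%C; lra.
- by rewrite eq_complex /= negb_and; apply/orP; left; apply/eqP; lra.
- by apply: real_located_none; lra.
- by apply: located_sector => //=; apply/andP; split; lra.
- by apply: located_sector => //=; apply/andP; split; lra.
- by case=> [|[|[|]]].
- by case=> [|[|[|]]].
Qed.

Lemma type133 : realized 1 3 3.
Proof.
have h := omega_sqr R.
have := @triple_curve (1 / 2)%:C%C (- w ^+ 2) (- w) _ _ 0 3 3.
apply.
- by rewrite -rmorphD h (_ : 1 / 2 + 1 / 2 = 1 :> R) ?rmorph1; [ring|lra].
- by rewrite eqr_opp eq_sym -subr_eq0; exact: omega_neq1.
- by apply: real_located0; lra.
- apply: located_none; rewrite (_ : _ ^+ 3 = (-1)%:C%C); last by rewrite rmorphN rmorph1; ring: h.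
  by split=> //=; lra.
- apply: located_none; rewrite (_ : _ ^+ 3 = (-1)%:C%C); last by rewrite rmorphN rmorph1; ring: h.
  by split=> //=; lra.
- by case=> [|[|[|]]].
- by case=> [|[|[|]]].
Qed.

Lemma type213 : realized 2 1 3.
Proof.
have /andP[s1 s2] := sqrt3_bounds.
have := @triple_curve (- 1 +i* 1)%C (2 +i* 2)%C (- 4)%:C%C _ _ 1 0 3.
apply.
- by simpc; congr (_ +i* _)%C; lra.
- by rewrite eq_complex /= negb_and; apply/orP; left; apply/eqP; lra.
- by apply: located_sector => //=; apply/andP; split; lra.
- by apply: located_sector => //=; apply/andP; split; lra.
- by apply: real_located_none; lra.
- by case=> [|[|[|]]].
- by case=> [|[|[|]]].
Qed.

Lemma type122 : realized 1 2 2.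
Proof.
have /andP[s1 s2] := sqrt3_bounds.
have := @triple_curve 1%:C%C (1 +i* 2)%C (1 +i* - 2)%C _ _ 0 1 2.
apply.
- by simpc; congr (_ +i* _)%C; lra.
- by rewrite eq_complex /= negb_and; apply/orP; right; apply/eqP; lra.
- by apply: real_located0; lra.
- by apply: located_sector => //=; apply/andP; split; lra.
- by apply: located_sector => //=; apply/andP; split; lra.
- by case=> [|[|[|]]].
- by case=> [|[|[|]]].
Qed.

(** Two triple points, [0] over [1] in sector 0 and [1] over [i] in sector 1.
    No ramification is left for sector 2, which is deduced from the bound on the
    sum. *)
Lemma type113 : realized 1 1 3.
Proof.
have /andP[s1 s2] := sqrt3_bounds.
pose v : R[i] := (0 +i* 1)%C; pose Q : {poly R[i]} := 3%:P * 'X^2 - 3%:P * 'X + 1.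
pose P : {poly R[i]} := Q + (v - 1)%:P * 'X^3.
have v1 : v != 1 by rewrite eq_complex /= negb_and; apply/orP; left; apply/eqP; lra.
have QE z : Q.[z] = 3 * z ^+ 2 - 3 * z + 1 by rewrite /Q !hornerE.
have PE z : P.[z] = Q.[z] + (v - 1) * z ^+ 3 by rewrite /P hornerD hornerCM hornerXn.
have sQ : (size Q <= 3)%N.
  rewrite /Q !mul_polyC (leq_trans (size_polyD _ _))// geq_max size_poly1 andbT.
  rewrite (leq_trans (size_polyD _ _))// geq_max size_polyN.
  by rewrite !(leq_trans (size_scale_leq _ _)) ?size_polyXn ?size_polyX.
have sP : size P = 4%N.
  have sX : size ((v - 1)%:P * 'X^3) = 4%N.
    by rewrite mul_polyC size_scale ?subr_eq0// size_polyXn.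
  by rewrite /P addrC size_polyDl sX.
have c z : Q.[z] = 0 -> P.[z] != 0.
  move=> Q0; rewrite PE Q0 add0r mulf_neq0 ?subr_eq0// expf_neq0//.
  by apply/eqP => z0; move: Q0; rewrite QE z0 expr0n /= !mulr0 subr0 add0r => /eqP; rewrite oner_eq0.
have nPQ : normal_pair P Q by [].
have [C CE] := curve_of_pair nPQ; exists C; rewrite {}CE.
have [a a0 [ws WE]] := wronskian_roots nPQ; have sum := ncomp_sum sP sQ c a0 WE.
have le1 k A r : (k < 3)%N -> sector k A ->
    (forall z, P.[z] - A * Q.[z] = (v - 1) * (z - r) ^+ 3) -> (ncomp P Q k <= 1)%N.
  move=> k3 kA E; apply: (ncomp_le sP sQ c (s := [:: r]) k3 kA) => z.
  rewrite (mem_fiber (n := 3)) ?sP ?(leqW sQ) ?full_PQ// -subr_eq0 E.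
  by rewrite mulf_eq0 subr_eq0 (negPf v1) expf_eq0 /= subr_eq0 inE.
have n0 : (ncomp P Q 0 <= 1)%N.
  apply: (le1 0%N 1 0) => // [|z]; first by apply/(real_located0 ltr01).
  by rewrite PE subr0; ring.
have n1 : (ncomp P Q 1 <= 1)%N.
  apply: (le1 1%N v 1) => // [|z]; first by rewrite /=; apply/andP; split; lra.
  by rewrite PE QE; ring.
have g0 := ncomp_gt0 sP sQ 0; have g1 := ncomp_gt0 sP sQ 1; have l2 := ncomp_le3 sP sQ 2.
by congr curve_type; lia.
Qed.

(** [x + 1/(2x^2)] commutes with the rotation by [omega].  Its ramification
    points are the cube roots of unity, one over each sector, and the double pole
    [0]. *)
Lemma type222 : realized 2 2 2.
Proof.
pose Q : {poly R[i]} := 2%:P * 'X^2; pose P : {poly R[i]} := 2%:P * 'X^3 + 1.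
have h := omega_sqr R; have n2 : (2 : R[i]) != 0 by rewrite pnatr_eq0.
have QE z : Q.[z] = 2 * z ^+ 2 by rewrite /Q !hornerE.
have PE z : P.[z] = 2 * z ^+ 3 + 1 by rewrite /P !hornerE.
have sQ : (size Q <= 3)%N by rewrite /Q mul_polyC (leq_trans (size_scale_leq _ _))// size_polyXn.
have sP : size P = 4%N.
  by rewrite /P mul_polyC size_polyDl size_scale// size_polyXn// size_poly1.
have c z : Q.[z] = 0 -> P.[z] != 0.
  rewrite QE PE => /eqP; rewrite mulf_eq0 (negPf n2) expf_eq0 /= => /eqP ->.
  by rewrite expr0n mulr0 add0r oner_eq0.
have nPQ : normal_pair P Q by [].
have [C CE] := curve_of_pair nPQ; exists C; rewrite {}CE.
have WE : wronskian P Q = from_roots 4 [:: 0; 1; w; w ^+ 2].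
  rewrite /from_roots !big_cons big_nil -mul_polyC /wronskian /P /Q !poly.derivE /=.
  have hP : w%:P ^+ 2 = -1 - w%:P by rewrite -polyC_exp h polyCB polyCN.
  by rewrite (polyC_exp 2 w); ring: hP.
have a0 : (4 : R[i]) != 0 by rewrite pnatr_eq0.
have w3 : w ^+ 3 = 1 := omega_cube R.
have wn0 : w != 0 by apply/eqP => w0; move/eqP: w3; rewrite w0 expr0n /= eq_sym oner_eq0.
have part k : (k < 3)%N -> part_of P Q k (w ^+ k).
  move=> k3; have wk : Q.[w ^+ k] != 0 by rewrite QE mulf_neq0 ?expf_neq0.
  split=> //; have -> : quot P Q (w ^+ k) = w ^+ k * (3 / 2)%:C%C.
    apply: (mulIf wk); rewrite /quot mulfVK// PE QE -exprM mulnC exprM w3 expr1n.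
    have -> : (3 / 2)%:C%C = 3 / 2 :> R[i] by rewrite rmorphM fmorphV !rmorph_nat.
    by rewrite -[X in _ = X]mulrA [_ * (2 * _)](_ : _ = 3 * (w ^+ k) ^+ 2); [rewrite mulrCA -exprS -exprM mulnC exprM w3 expr1n; ring|field].
  have := @sector_omegaX R 0 k (3 / 2)%:C%C isT; rewrite add0n modn_small//; apply.
  by apply/(@real_located0 (3 / 2)) => //; lra.
have comp k : (k < 3)%N -> ncomp P Q k = 2%N.
  move=> k3; apply: (ncomp_of_nram nPQ a0 WE k3) => //; last first.
    apply: (ncomp_ramified sP sQ c a0 WE k3 _ (part k k3)).
    by move: k3; case: (k) => [|[|[|]]] // _; rewrite !inE ?expr0 ?expr1 eqxx ?orbT.
  have p0 : `[< part_of P Q k 0 >] = false.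
    by apply/asboolP => -[]; rewrite QE expr0n mulr0 eqxx.
  have pl l : (l < 3)%N -> `[< part_of P Q k (w ^+ l) >] = (k == l).
    move=> l3; apply/asboolP/eqP => [kl|->]; last exact: part.
    exact: part_disjoint k3 l3 kl (part l l3).
  have := pl 0%N isT; have := pl 1%N isT; have := pl 2%N isT; rewrite expr0 expr1 => h2 h1 h0.
  by rewrite /nram /= p0 h0 h1 h2; move: k3; case: (k) => [|[|[|]]].
by rewrite !comp.
Qed.

End Examples.

Definition curve_types : seq (seq nat) :=
  [:: curve_type 1 1 3; curve_type 1 2 2; curve_type 2 1 3; curve_type 1 3 3;
      curve_type 2 2 2; curve_type 2 3 2; curve_type 2 3 3; curve_type 3 3 3].

Theorem proposition8 (R : realType) :
  (range (fun C : crtc R 3 => combinatorial_type C) #= `I_8)%card.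
Proof.
have -> : range (fun C : crtc R 3 => combinatorial_type C) = [set` [fset x in curve_types]%fset].
  apply/seteqP; split=> [_ [C _ <-]|t] /=; rewrite in_fset.
    have [n0 [n1 [n2 [b0 b1 b2 b ->]]]] := curve_type_bounds C.
    move: n0 n1 n2 b0 b1 b2 b.
    by do 3 (case=> [|[|[|[|?]]]] //).
  have real n0 n1 n2 : realized R n0 n1 n2 -> range (fun C : crtc R 3 => combinatorial_type C) (curve_type n0 n1 n2).
    by move=> [C <-]; exists C.
  rewrite !inE => /or4P[/eqP->|/eqP->|/eqP->|/or4P[/eqP->|/eqP->|/eqP->|/orP[]/eqP->]]; apply: real.
  - exact: type113.
  - exact: type122.
  - exact: type213.
  - exact: type133.
  - exact: type222.
  - exact: type232.
  - exact: type233.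
  - exact: type333.
apply/card_eq_fsetP.
by rewrite card_fseq undup_id.
Qed.
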